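(* Let $r>0$, let $V,M$ be as in the context, let $c\in[c^*,v_{\max})$, and let $f$ be a travelling wave of speed $c$. There exists a weight function $\phi:\mathbb{R}\times V\to\mathbb{R}$, $\phi=\phi(z,v)$, such that the travelling front is linearly stable in the weighted space $L^2(e^{-2\phi(z,v)}dz\,dv)$ in the following sense: if $u^0\in L^2(e^{-2\phi(z,v)}dz\,dv)$ and $u$ is the solution of the linearized equation $$\partial_tu+(v-c)\partial_zu+(1+r\rho_f)u=\big((1+r)M-rf\big)\rho_u,\qquad u(0,\cdot,\cdot)=u^0,$$ then $$(\forall t\in\mathbb{R}^+)\quad\|u(t)\|_{L^2(e^{-2\phi})}\le\|u^0\|_{L^2(e^{-2\phi})}.$$ Moreover, for every $z_0\in\mathbb{R}$, the function $$t\mapsto\int_{\{z<z_0\}\times V}|u(t,z,v)|^2e^{-2\phi(z,v)}\,dz\,dv+\int_{\{z>z_0\}\times V}\rho_f(z)\,|u(t,z,v)|^2e^{-2\phi(z,v)}\,dz\,dv$$ belongs to $L^1(\mathbb{R}^+)$.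
   Context: The set $V\subset\mathbb{R}$ is compact and symmetric ($V=-V$), $V=\operatorname{supp}M$, $M:V\to[0,\infty)$ is continuous with $\int_VM\,dv=1$, $\int_VvM\,dv=0$, $\int_Vv^2M\,dv<\infty$; $v_{\max}=\sup V$; $\rho_h=\int_Vh\,dv$ for any function $h$. Minimal speed: $c^*$ is the smallest $c\in[0,v_{\max})$ for which there is $\lambda\in(0,\frac1{v_{\max}-c}]$ with $(1+r)\int_V\frac{M(v)}{1+\lambda(c-v)}\,dv=1$. A travelling wave of speed $c$ is a continuous $f:\mathbb{R}\times V\to\mathbb{R}$ solving $(v-c)\partial_zf=(M\rho_f-f)+r\rho_f(M-f)$ in the sense of distributions, with $0\le f(z,v)\le M(v)$, $\lim_{z\to-\infty}f(z,v)=M(v)$, $\lim_{z\to+\infty}f(z,v)=0$. The variable $z=x-ct$ is the space variable in the moving frame. The weight $\phi$ depends on $c$, $f$, $M$, $r$ but not on $u^0$. *)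

(* Defs.v *)
From HB Require Import structures.
From mathcomp Require Import all_boot all_order all_algebra.
From mathcomp Require Import all_classical all_reals all_analysis.

Set Implicit Arguments.
Unset Strict Implicit.
Unset Printing Implicit Defensive.

Import Order.TTheory GRing.Theory Num.Theory.
Import numFieldNormedType.Exports.

Local Open Scope classical_set_scope.
Local Open Scope ring_scope.

(* Functions of v in V, or of (z, v) in R x V, are total functions on R or
   R x R whose values for v outside V never matter: every hypothesis, integral
   and a.e. statement below is restricted to V. *)

Section Smooth.
Context {R : realType} {E : normedModType R}.

(* For E finite dimensional this is the usual class C^n: all iterated
   directional derivatives up to order n exist and are continuous. *)
Fixpoint Cn (n : nat) (g : E -> R) : Prop :=
  continuous g /\
  match n with
  | 0 => True
  | m.+1 => forall w : E,
      (forall x, derivable g x w) /\ Cn m (fun x => 'D_w g x)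
  end.

Definition test_function (g : E -> R) : Prop :=
  (forall n, Cn n g) /\ compact (closure [set x | g x != 0]).

End Smooth.

Section Kinetic.
Context {R : realType}.
Implicit Types (V : set R) (M : R -> R) (r c t : R).

Notation mu := (@lebesgue_measure R).
Notation mu2 := (mu \x mu)%E.
Notation mu3 := (mu2 \x mu)%E.

Definition phase_space V : set (R * R) := setT `*` V.

Definition time_phase_space V : set (R * R * R) :=
  (`[0, +oo[ `*` setT) `*` V.

Record velocity_model V M : Prop := {
  vm_compact : compact V;
  vm_sym : forall v, V v -> V (- v);
  vm_ge0 : forall v, V v -> 0 <= M v;
  vm_continuous : {within V, continuous M};
  vm_supp : V = closure [set v | V v /\ M v != 0];
  vm_mass : (\int[mu]_(v in V) (M v)%:E = 1)%E;
  vm_mean : (\int[mu]_(v in V) (v * M v)%:E = 0)%E;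
  vm_var : (\int[mu]_(v in V) (v ^+ 2 * M v)%:E < +oo)%E
}.

Definition vmax V : R := sup V.

Definition rho V (h : R -> R) : R := \int[mu]_(v in V) h v.

(* The integrand is nonnegative and the integral is extended-real valued, so
   at the endpoint lambda = (vmax - c)^-1 a divergent integral is +oo and does
   not satisfy the equation; the convention 0^-1 = 0 is only felt at the single
   point v = vmax. *)
Definition has_decay_rate r V M c : Prop :=
  exists lambda : R, 0 < lambda <= (vmax V - c)^-1 /\
    ((1 + r)%:E *
      \int[mu]_(v in V) (M v / (1 + lambda * (c - v)))%:E = 1)%E.

Definition is_minimal_speed r V M cstar : Prop :=
  [/\ 0 <= cstar < vmax V,
      has_decay_rate r V M cstar &
      forall c, 0 <= c < vmax V -> has_decay_rate r V M c -> cstar <= c].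

(* (v - c) d_z f = (M rho_f - f) + r rho_f (M - f), tested against
   C^oo_c(R^2) functions restricted to R x V (V need not be open, and the
   equation contains no v-derivative). *)
Definition wave_equation r V M c (f : R -> R -> R) : Prop :=
  forall psi : R * R -> R, test_function psi ->
    \int[mu2]_(x in phase_space V)
      (- ((x.2 - c) * f x.1 x.2 * 'D_((1, 0) : R * R) psi x)) =
    \int[mu2]_(x in phase_space V)
      ((M x.2 * rho V (f x.1) - f x.1 x.2
        + r * rho V (f x.1) * (M x.2 - f x.1 x.2)) * psi x).

Record travelling_wave r V M c (f : R -> R -> R) : Prop := {
  tw_continuous :
    {within phase_space V, continuous (fun x : R * R => f x.1 x.2)};
  tw_equation : wave_equation r V M c f;
  tw_bounds : forall z v, V v -> 0 <= f z v <= M v;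
  tw_left : forall v, V v -> f z v @[z --> -oo] --> M v;
  tw_right : forall v, V v -> f z v @[z --> +oo] --> (0 : R)
}.

(* Local integrability of e^(2 phi) gives, by Cauchy-Schwarz, the inclusion of
   L^2(e^(-2 phi) dz dv) in L^1_loc, so that rho_u makes sense and every
   initial datum in the weighted space has a solution, see below. *)
Record weight V (phi : R -> R -> R) : Prop := {
  weight_measurable :
    measurable_fun (phase_space V) (fun x : R * R => phi x.1 x.2);
  weight_loc : forall L : R,
    (\int[mu2]_(x in `[(- L)%R, L] `*` V)
       (expR (2 * phi x.1 x.2))%:E < +oo)%E
}.

Definition wnorm V (phi g : R -> R -> R) : \bar R :=
  ((\int[mu2]_(x in phase_space V)
      (`|g x.1 x.2| ^+ 2 * expR (- 2 * phi x.1 x.2))%:E) `^ (2^-1)%R)%E.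

Definition in_wL2 V (phi g : R -> R -> R) : Prop :=
  measurable_fun (phase_space V) (fun x : R * R => g x.1 x.2) /\
  (wnorm V phi g < +oo)%E.

(* -(1 + r rho_f) u + ((1 + r) M - r f) rho_u, with g = u(t, ., .). *)
Definition linearized_source r V M (f g : R -> R -> R) (z v : R) : R :=
  ((1 + r) * M v - r * f z v) * rho V (g z) - (1 + r * rho V (f z)) * g z v.

(* Mild solution of
     d_t u + (v - c) d_z u + (1 + r rho_f) u = ((1 + r) M - r f) rho_u
   with u(0) = u0: the equation integrated along the characteristics
   s |-> z - (v - c) (t - s).  The class L^1_loc does not depend on a weight;
   by Gronwall and finite speed of propagation, each locally integrable u0 has
   exactly one such solution, up to null sets. *)
Record linearized_solution r V M c (f u0 : R -> R -> R)
    (u : R -> R -> R -> R) : Prop := {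
  ls_measurable :
    measurable_fun (time_phase_space V)
      (fun x : R * R * R => u x.1.1 x.1.2 x.2);
  ls_loc : forall T L : R,
    (\int[mu3]_(x in (`[0%R, T] `*` `[(- L)%R, L]) `*` V)
       (`|u x.1.1 x.1.2 x.2|)%:E < +oo)%E;
  ls_mild : forall t, 0 <= t ->
    {ae mu2, forall x : R * R, phase_space V x ->
      u t x.1 x.2 =
        u0 (x.1 - (x.2 - c) * t) x.2
        + \int[mu]_(s in `[0, t])
            linearized_source r V M f (u s) (x.1 - (x.2 - c) * (t - s)) x.2}
}.

Definition local_energy V (phi f g : R -> R -> R) (z0 : R) : \bar R :=
  (\int[mu2]_(x in [set z | (z < z0)%R] `*` V)
     (`|g x.1 x.2| ^+ 2 * expR (- 2 * phi x.1 x.2))%:E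
   + \int[mu2]_(x in [set z | (z0 < z)%R] `*` V)
     (rho V (f x.1) * `|g x.1 x.2| ^+ 2 * expR (- 2 * phi x.1 x.2))%:E)%E.

End Kinetic.

(* Main.v *)
Require Import Defs.
From HB Require Import structures.
From mathcomp Require Import all_boot all_order all_algebra.
From mathcomp Require Import all_classical all_reals all_analysis.
From mathcomp Require Import measurable_realfun.
From mathcomp Require Import ring lra.
Import Order.TTheory GRing.Theory Num.Theory.
Import numFieldNormedType.Exports.
Local Open Scope classical_set_scope.
Local Open Scope ring_scope.

(** Why the front is stable.  In the moving frame the linearized equation is
    d_t u + w d_z u + K u = P rho_u, where w = v - c, K = 1 + r rho_f and
    P = (1 + r) M - r f, so that 0 <= P <= (1 + r) M.  The weight is
    e^(-2 phi) = G / F, where F is a positive supersolution of this equation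
    and G a nonnegative supersolution of its adjoint:
<<
      w F_z + (K + b) F >= P rho_F
    - w G_z + (K - 2 b) G >= int P G dv + sigma G        (b >= 0, sigma > 0)
>>
    By the Cauchy-Schwarz inequality rho_u^2 <= rho_F rho_(u^2/F) and Young's
    inequality, q = u^2 / F then satisfies d_t q + w q_z + (K - 2 b) q <= P rho_q,
    and pairing with G gives d/dt int q G + int sigma q G <= 0.  This is both the
    decay of the weighted norm and, since sigma is bounded below on every half
    line z < z0 and by a multiple of rho_f everywhere, the integrability in time
    ([weighted_energy]).

    Exponentials provide F and G.  Write d_m(v) = 1 + m (c - v) and
    I(m) = (1 + r) int M / d_m.  Since c >= c_*, some admissible rate satisfies
    I <= 1, and the smallest such rate la has I(m) > 1 for 0 <= m < la
    ([smallest_rate]).  With K replaced by 1 and P by (1 + r) M, the function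
    e^(-la z) M / d_la is a supersolution and e^(la z) / d_la one of the adjoint
    equation, but when I(la) = 1 they leave nothing for sigma.  The room comes
    from the gap J = I - 1 > 0 at the rates below la: an exponential e^(m z) / d_m
    with m < la is a strict subsolution of the adjoint equation, so subtracting
    such exponentials improves a supersolution.  For v' in V choose the rate
    la - kappa(v') with 0 < kappa(v') <= la proportional to d_la(v'), and put,
    with z measured from a point z_* and z+ = max(z, 0),
<<
    F = e^(-la z) (M / d_la + eta J e^(-kappa z+))
    G = (A e^(la z) + delta e^(la (z - z+))) / d_la
        - int e^(la z - kappa(v') z+) / d_(la - kappa(v')) dv'
>>
    where the argument of J and kappa is v in the first line, and J(v) stands for
    J at the rate la - kappa(v).  The second term of F keeps F positive where M
    vanishes; it adds eta int J e^(-kappa z+) to rho_F, which the slack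
    b = (1 + r) eta d_la int J e^(-kappa z+) pays for
    ([profF_supersolution]).  For G, the gain
    e^(la z) int J e^(-kappa z+) dv' pays for b, for the flux of the delta term
    when z > 0, and the delta term itself then leaves sigma of order e^(-la z); when
    z <= 0 the absorption r rho_f G dominates everything, z_* being chosen such
    that rho_f >= 1/2 to its left and A large ([profG_supersolution]).

    Solutions are only mild and locally integrable, so the computation is carried
    out along characteristics in integrated form.  Multiplying by e^(k t) with a
    large constant k makes every term nonnegative, and u^2 / F is replaced by
    sup_(0 <= a <= N) (2 a |u| - a^2 F), a supremum of affine functions of |u|:
    the inequality for the square thus follows from the Duhamel inequality for |u|
    and from the one for F, without differentiating anything ([tsq_duhamel]).
    A cut-off on a shrinking light cone makes all integrals finite, and monotone
    convergence removes it together with N. *)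

(** * Integrals over the plane *)

Section PlaneIntegrals.
Context {R : realType}.
Notation mu := (@lebesgue_measure R).
Notation mu2 := (mu \x mu)%E.

Lemma measurable_translation (a : R) :
  measurable_fun setT (fun x : measurableTypeR R => x + a : measurableTypeR R).
Proof. exact: measurable_funD. Qed.

Lemma lebesgue_measure_translation (a : R) (A : set R) : measurable A ->
  pushforward mu (fun x : measurableTypeR R => x + a : measurableTypeR R) A = mu A.
Proof.
move=> mA; apply/esym/lebesgue_measure_unique => //=.
  exact: measurable_translation.
move=> mt _ [[b e]] _ <-.
rewrite /pushforward.
have -> : (fun x : R => x + a) @^-1` `]b, e]%classic = `]b - a, e - a]%classic.
  by apply/seteqP; split => x /=; rewrite !in_itv/= ltrBlDr lerBrDr.
rewrite !lebesgue_measure_itv/=.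
by rewrite !lte_fin ltrD2r -!EFinD opprB addrA subrK.
Qed.

Lemma ge0_integral_translation (f : R -> \bar R) (a : R) :
  measurable_fun setT f -> (forall x, 0 <= f x)%E ->
  (\int[mu]_x f (x + a)%R = \int[mu]_x f x)%E.
Proof.
move=> mf f0.
rewrite -[LHS](@ge0_integral_pushforward _ _ _ _ _ _ (measurable_translation a) mu setT f measurableT)//.
apply: eq_measure_integral => [|mt A mA AS]; first exact: measurable_translation.
exact: lebesgue_measure_translation.
Qed.

Lemma integral_mu2E (g : R * R -> \bar R) :
  measurable_fun setT g -> (forall x, 0 <= g x)%E ->
  (\int[mu2]_x g x = \int[mu]_v \int[mu]_y g (y, v))%E.
Proof. by move=> mg g0; exact: (@fubini_tonelli2 _ _ _ _ _ mu mu g mg g0). Qed.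

(** Free transport over the time t maps (y, v) to (y + (v - c) t, v): a shear,
    which preserves Lebesgue measure by translation invariance in y. *)
Definition shear (a : R -> R) (x : R * R) : R * R := (x.1 + a x.2, x.2).

Lemma measurable_shear a : measurable_fun setT a -> measurable_fun setT (shear a).
Proof.
move=> ma; apply/measurable_fun_pair => //=.
apply: measurable_funD => //; exact: measurableT_comp.
Qed.

Lemma ge0_integral_shear (f : R * R -> \bar R) (a : R -> R) :
  measurable_fun setT a ->
  measurable_fun setT f -> (forall x, 0 <= f x)%E ->
  (\int[mu2]_x f (shear a x) = \int[mu2]_x f x)%E.
Proof.
move=> ma mf f0.
have mfs : measurable_fun setT (f \o shear a).
  by apply: measurableT_comp => //; exact: measurable_shear.
rewrite -[LHS]/(\int[mu2]_x (f \o shear a) x)%E.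
rewrite (integral_mu2E _ mfs (fun x => f0 (shear a x))) (integral_mu2E f mf f0).
apply: eq_integral => v _; rewrite /= /shear/=.
apply: (@ge0_integral_translation (fun y => f (y, v))) => //.
by apply: measurableT_comp => //.
Qed.

(** Null sets are pulled back to null sets; this moves an almost everywhere
    statement about positions to one about starting points of characteristics. *)
Lemma ae_shear (P : R * R -> Prop) (a : R -> R) : measurable_fun setT a ->
  {ae mu2, forall x, P x} -> {ae mu2, forall x, P (shear a x)}.
Proof.
move=> ma [N [mN N0 PN]].
have mNs : measurable (shear a @^-1` N).
  by rewrite -[_ @^-1` _]setTI; exact: measurable_shear.
exists (shear a @^-1` N); split => //.
- have iN : (\int[mu2]_x (\1_N x)%:E = 0)%E.
    by rewrite integral_indic// setIT; exact: N0.
  have : (\int[mu2]_x (\1_(shear a @^-1` N) x)%:E = 0)%E.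
    rewrite -[RHS]iN; apply: (ge0_integral_shear (fun x => (\1_N x)%:E) a ma).
      exact/measurable_EFinP/measurable_indic.
    by move=> x; rewrite lee_fin.
  by rewrite integral_indic// setIT; exact.
- by move=> x; exact: PN.
Qed.

(** The integrand has no sign: its positive and negative parts are treated
    separately, and the convention for oo - oo is measurable. *)
Lemma measurable_parametric_integral d1 d2 (T1 : measurableType d1)
    (T2 : measurableType d2) (m2 : {sigma_finite_measure set T2 -> \bar R})
    (f : T1 * T2 -> \bar R) :
  measurable_fun setT f ->
  measurable_fun setT (fun x => \int[m2]_y f (x, y))%E.
Proof.
move=> mf.
rewrite (_ : (fun x => _) = (fun x => \int[m2]_y f^\+ (x, y)) \-
    (fun x => \int[m2]_y f^\- (x, y)))%E; last first.
  apply/funext => x /=; rewrite [LHS]integralE.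
  by congr (_ - _)%E; apply: eq_integral => y _; rewrite ?(funeposE, funenegE).
apply: emeasurable_funB.
  apply: (measurable_fun_fubini_tonelli_F (f^\+)%E) => //.
  exact: measurable_funepos.
apply: (measurable_fun_fubini_tonelli_F (f^\-)%E) => //.
exact: measurable_funeneg.
Qed.

(** Both statements say that f vanishes almost everywhere for the product
    measure. *)
Lemma ae_swap d1 d2 (T1 : measurableType d1) (T2 : measurableType d2)
    (m1 : {sigma_finite_measure set T1 -> \bar R})
    (m2 : {sigma_finite_measure set T2 -> \bar R}) (f : T1 * T2 -> R) :
  measurable_fun setT f ->
  (forall x, {ae m2, forall y, f (x, y) = 0}) ->
  {ae m2, forall y, {ae m1, forall x, f (x, y) = 0}}.
Proof.
move=> mf f0.
have mnf : measurable_fun setT (fun p => `|f p|%:E).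
  by apply/measurable_EFinP; exact: measurableT_comp.
have : (\int[m2]_y \int[m1]_x `|f (x, y)|%:E = 0)%E.
  rewrite -(fubini_tonelli (fun p => `|f p|%:E))//.
  rewrite integral0_eq// => x _.
  under eq_integral do rewrite -abse_EFin.
  apply/(ae_eq_integral_abs m2 measurableT).
    by apply/measurable_EFinP; apply: measurableT_comp.
  by apply: filterS (f0 x) => y + _ => /= ->.
move=> h.
have mg : measurable_fun setT (fun y => \int[m1]_x `|f (x, y)|%:E)%E.
  exact: (measurable_fun_fubini_tonelli_G (fun p => `|f p|%:E)).
have h2 : (\int[m2]_y `|\int[m1]_x `|f (x, y)|%:E| = 0)%E.
  by rewrite -[RHS]h; apply: eq_integral => y _; rewrite gee0_abs// integral_ge0.
move/(ae_eq_integral_abs m2 measurableT mg) : h2.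
apply: filterS => y /(_ I)/= hy.
have : (\int[m1]_x `|(f (x, y))%:E| = 0)%E by rewrite -[RHS]hy.
move/(ae_eq_integral_abs m1 measurableT) => h3.
have /h3 : measurable_fun setT (fun x => (f (x, y))%:E).
  by apply/measurable_EFinP; apply: measurableT_comp.
by apply: filterS => x /(_ I)/= [].
Qed.
End PlaneIntegrals.

(** * Duhamel formulas *)

Section AffineExponential.
Context {R : realType}.
Notation mu := (@lebesgue_measure R).

Lemma FTC_is_derive (F f : R -> R) (a b : R) : a <= b ->
  (forall x, is_derive x (1 : R) F (f x)) -> continuous f ->
  (\int[mu]_(x in `[a, b]) (f x)%:E = (F b - F a)%:E)%E.
Proof.
move=> + dF cf; rewrite le_eqVlt => /predU1P[->|ab].
  by rewrite set_itv1 integral_set1 subrr.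
have cF x : {for x, continuous F}.
  by apply/differentiable_continuous/derivable1_diffP; case: (dF x).
rewrite EFinB; apply: continuous_FTC2 => //.
- exact: continuous_subspaceT.
- split=> [x _||]; first by case: (dF x).
  by apply: cvg_at_right_filter; exact: cF.
  by apply: cvg_at_left_filter; exact: cF.
- by move=> x _; rewrite derive1E; apply: derive_val.
Qed.

Lemma is_derive_expR_affine (k d x : R) :
  is_derive x (1 : R) (fun s => expR (k * s + d)) (k * expR (k * x + d)).
Proof.
have h : is_derive x (1 : R) (fun s : R => k * s + d) k.
  by apply: is_derive_eq; rewrite addr0 [LHS]mulr1.
have := @is_derive1_comp R expR (fun s => k * s + d) x _ _ (is_derive_expR _) h.
by rewrite mulrC.
Qed.

Lemma continuous_expR_affine (k d : R) : continuous (fun s : R => expR (k * s + d)).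
Proof.
move=> x; apply/differentiable_continuous/derivable1_diffP.
by case: (is_derive_expR_affine k d x).
Qed.

Lemma integral_expR_affine (k d a b : R) : a <= b ->
  (\int[mu]_(s in `[a, b]) (k * expR (k * s + d))%:E =
   (expR (k * b + d) - expR (k * a + d))%:E)%E.
Proof.
move=> ab; apply: (FTC_is_derive (fun s => expR (k * s + d))) => //.
  by move=> x; exact: is_derive_expR_affine.
by move=> x; apply: cvgM; [exact: cvg_cst|exact: continuous_expR_affine].
Qed.
End AffineExponential.

Section Duhamel.
Context {R : realType}.
Notation mu := (@lebesgue_measure R).

Lemma ae_imp d (T : measurableType d) (m : {measure set T -> \bar R}) (P Q : T -> Prop) :
  (forall x, P x -> Q x) -> {ae m, forall x, P x} -> {ae m, forall x, Q x}.
Proof. by move=> PQ; apply: filterS. Qed.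

Lemma ae_and d (T : measurableType d) (m : {measure set T -> \bar R}) (P Q : T -> Prop) :
  {ae m, forall x, P x} -> {ae m, forall x, Q x} -> {ae m, forall x, P x /\ Q x}.
Proof. by move=> hP hQ; apply: filterS2 hP hQ => x; split. Qed.

Lemma EFin_Rintegral d (T : measurableType d) (m : {measure set T -> \bar R})
    (D : set T) (f : T -> R) : measurable D -> m.-integrable D (EFin \o f) ->
  (\int[m]_(x in D) f x)%:E = (\int[m]_(x in D) (f x)%:E)%E.
Proof. by move=> mD fi; rewrite /Rintegral fineK//; exact: integrable_fin_num. Qed.

Lemma integrable_bddM d (T : measurableType d) (m : {measure set T -> \bar R})
    (D : set T) (h f : T -> R) (B : R) :
  measurable D -> measurable_fun D h -> (forall x, D x -> `|h x| <= B) ->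
  m.-integrable D (EFin \o f) ->
  m.-integrable D (fun x => (h x * f x)%:E).
Proof.
move=> mD mh hB fi.
have := @integrableMr _ _ _ m D mD h (EFin \o f) mh _ fi.
apply.
exists B; split; first exact: num_real.
by move=> x Bx y Dy /=; exact: le_trans (hB _ Dy) (ltW Bx).
Qed.

Lemma measurable_expR_scale (k : R) (D : set R) : measurable_fun D (fun s => expR (k * s)).
Proof.
by apply: measurable_funTS; apply: measurableT_comp.
Qed.

Lemma expR_scale_bound (k s t : R) : 0 <= s <= t -> `|expR (k * s)| <= expR (`|k| * t).
Proof.
move=> /andP[s0 st]; rewrite ger0_norm ?expR_ge0// ler_expR.
by rewrite (le_trans (ler_norm _))// normrM (ger0_norm s0) ler_wpM2l.
Qed.

Lemma integrable_tensor d1 d2 (T1 : measurableType d1) (T2 : measurableType d2)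
    (m1 : {sigma_finite_measure set T1 -> \bar R})
    (m2 : {sigma_finite_measure set T2 -> \bar R}) (a : T1 -> R) (b : T2 -> R) :
  m1.-integrable setT (EFin \o a) -> m2.-integrable setT (EFin \o b) ->
  (m1 \x m2)%E.-integrable setT (fun p => (a p.1 * b p.2)%:E).
Proof.
move=> ia ib.
have ma : measurable_fun setT a by apply/measurable_EFinP; case/integrableP : ia.
have mb : measurable_fun setT b by apply/measurable_EFinP; case/integrableP : ib.
apply/integrable12ltyP.
  apply/measurable_EFinP; apply: measurable_funM; exact: measurableT_comp.
have /integrableP[_ ia'] := ia; have /integrableP[_ ib'] := ib.
rewrite (_ : (\int[m1]_x \int[m2]_y `|(a x * b y)%:E|)%E =
  (\int[m1]_x `|(a x)%:E| * \int[m2]_y `|(b y)%:E|)%E).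
  by rewrite lte_mul_pinfty// ?integral_ge0// ge0_fin_numE// integral_ge0.
rewrite -ge0_integralZr//; last 2 first.
- by apply: measurableT_comp => //; exact/measurable_EFinP.
- exact: integral_ge0.
apply: eq_integral => x _.
rewrite -ge0_integralZl//.
  by apply: eq_integral => y _; rewrite EFinM abseM.
by apply: measurableT_comp => //; exact/measurable_EFinP.
Qed.

(** Fubini on the triangle x <= s <= t. *)
Lemma Fubini_triangle (k t : R) (g : R -> R) : 0 <= t ->
  mu.-integrable `[0, t] (EFin \o g) ->
  \int[mu]_(s in `[0, t]) (k * expR (k * s) * \int[mu]_(x in `[0, s]) g x) =
  \int[mu]_(x in `[0, t]) ((expR (k * t) - expR (k * x)) * g x).
Proof.
move=> t0 ig.
pose gI := g \_ `[0, t].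
have igI : mu.-integrable setT (EFin \o gI).
  by rewrite /gI -restrict_EFin; apply/(integrable_mkcond _ _).1.
have mgI : measurable_fun setT gI by apply/measurable_EFinP; case/integrableP : igI.
pose H (p : R * R) := if (p.2 <= p.1) && (p.1 <= t) then k * expR (k * p.1) * gI p.2 else 0.
have mH : measurable_fun setT H.
  apply: measurable_fun_ifT => //.
    by apply: measurable_and; apply: measurable_fun_ler.
  apply: measurable_funM.
    apply: measurable_funM => //; apply: measurableT_comp => //.
    by apply: measurable_funM.
  exact: measurableT_comp.
pose C := `|k| * expR (`|k| * t).
have HC p : `|H p| <= C * \1_(`[0, t] : set R) p.1 * `|gI p.2|.
  rewrite /H; case: ifPn => [/andP[p21 p1t]|_]; last by rewrite normr0 !mulr_ge0.
  rewrite !normrM.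
  rewrite /gI patchE; case: ifPn => [|_]; last by rewrite normr0 !mulr0.
  rewrite inE/= in_itv/= => /andP[p20 p2t].
  have p10 : 0 <= p.1 by exact: le_trans p21.
  rewrite indicE mem_set/=; last by rewrite in_itv/= p10.
  rewrite mulr1.
  rewrite ler_wpM2r// ler_wpM2l//.
  by apply: expR_scale_bound; rewrite p10.
have iH : (mu \x mu)%E.-integrable setT (EFin \o H).
  have iC := @integrable_tensor _ _ _ _ mu mu _ _
     (integrableZl measurableT C (integrable_indic_itv 0 t true false)) (integrable_norm igI).
  apply: le_integrable iC => //; first exact/measurable_EFinP.
  by move=> p _; rewrite lee_fin (le_trans (HC p))// ler_norm.
have := Fubini iH.
have isub s : s <= t -> mu.-integrable `[0, s] (EFin \o g).
  move=> st; apply: integrableS ig => // x /=; rewrite !in_itv/= => /andP[-> /=].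
  by move/le_trans; exact.
rewrite (_ : (fun s => _) = (EFin \o
    ((fun s => k * expR (k * s) * \int[mu]_(x in `[0, s]) g x) \_ `[0, t]))); last first.
  apply/funext => s /=; rewrite patchE; case: ifPn => [|]; rewrite ?notin_setE ?inE/= in_itv/=.
    move=> /andP[s0 st].
    rewrite (_ : (fun y => _) = (fun y => (k * expR (k * s))%:E * (EFin \o (g \_ `[0%R, s])) y)%E); last first.
      apply/funext => y; rewrite /H/= st andbT /gI !patchE -EFinM; congr EFin.
      case: ifPn => ys.
        case: ifPn => yt; case: ifPn => ys' //; move: yt ys'; rewrite ?notin_setE ?inE/= !in_itv/= ys ?andbT.
          by move=> /andP[->].
        by move=> h y0; exfalso; apply: h; rewrite y0 (le_trans ys).
      case: ifPn => ys' //; last by rewrite mulr0.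
      by move: ys'; rewrite ?inE/= in_itv/= (negbTE ys) andbF.
    rewrite integralZl//; last first.
      by rewrite -restrict_EFin; apply/(integrable_mkcond _ _).1 => //; exact: isub.
    rewrite [RHS]EFinM EFin_Rintegral//; last exact: isub.
    by rewrite [in RHS]integral_mkcond restrict_EFin.
  move=> s0t; rewrite integral0_eq// => y _; rewrite /H/= /gI patchE.
  case: ifPn => // /andP[ys st]; case: ifPn => //; last by rewrite mulr0.
  rewrite inE/= in_itv/= => /andP[y0 yt]; exfalso; apply: s0t.
  by rewrite st (le_trans y0).
rewrite (_ : (fun y => \int[_]_x _)%E = (EFin \o
    ((fun x => (expR (k * t) - expR (k * x)) * g x) \_ `[0, t]))); last first.
  apply/funext => x /=; rewrite patchE; case: ifPn => [|]; rewrite ?notin_setE ?inE/= in_itv/=.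
    move=> /andP[x0 xt].
    rewrite (_ : (fun y => _) = (fun y => (g x)%:E * ((fun s => (k * expR (k * s + 0))%:E) \_ `[x, t]) y)%E); last first.
      apply/funext => s; rewrite /H/= /gI !patchE mem_set/=; last by rewrite in_itv/= x0 xt.
      rewrite addr0; case: ifPn => xst; first by rewrite mem_set ?in_itv// mulrC EFinM.
      by rewrite memNset ?in_itv//= ?mule0//; exact/negP.
    have := @integral_expR_affine _ k 0 x t xt; rewrite integral_mkcond => h.
    rewrite integralZl//.
      by rewrite h !addr0 -EFinM mulrC.
    apply/(integrable_mkcond _ _).1 => //; apply: continuous_compact_integrable => //.
      exact: segment_compact.
    apply: continuous_subspaceT => y.
    by apply: cvgM; [exact: cvg_cst|exact: continuous_expR_affine].
  move=> x0t; rewrite integral0_eq// => y _; rewrite /H/= /gI patchE.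
  rewrite memNset; last by rewrite /= in_itv.
  by rewrite mulr0 if_same.
by move=> h; rewrite [LHS]Rintegral_mkcond [RHS]Rintegral_mkcond; congr fine; exact: h.
Qed.

(** Variation of constants with a constant rate k of either sign: mild
    solutions with the source g solve the equation with the source g + k U and
    the integrating factor e^(k t). *)
Lemma duhamel (k t U0 : R) (U g : R -> R) : 0 <= t ->
  mu.-integrable `[0, t] (EFin \o g) -> measurable_fun `[0, t] U ->
  {ae mu, forall s, `[0, t]%classic s -> U s = U0 + \int[mu]_(x in `[0, s]) g x} ->
  U t = U0 + \int[mu]_(x in `[0, t]) g x ->
  mu.-integrable `[0, t] (EFin \o U) /\
  expR (k * t) * U t = U0 + \int[mu]_(s in `[0, t]) (expR (k * s) * (g s + k * U s)).
Proof.
move=> t0 ig mU hU Ut.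
have mI : measurable (`[0, t]%classic : set (measurableTypeR R)) by exact: measurable_itv.
pose B := `|U0| + \int[mu]_(x in `[0, t]) `|g x|.
have isub s : s <= t -> mu.-integrable `[0, s] (EFin \o g).
  move=> st; apply: integrableS ig => // x /=; rewrite !in_itv/= => /andP[-> /=].
  by move/le_trans; exact.
pose G s := \int[mu]_(x in `[0, s]) g x.
have GB s : `[0, t]%classic s -> `|U0 + G s| <= B.
  rewrite /= in_itv/= => /andP[s0 st].
  rewrite (le_trans (ler_normD _ _))// lerD2l.
  rewrite (le_trans (le_normr_Rintegral _ _))//; first exact: isub.
  rewrite fine_le//.
  - apply: integrable_fin_num => //; exact: integrable_norm (isub _ st).
  - apply: integrable_fin_num => //; exact: integrable_norm ig.
  - apply: ge0_subset_integral => //.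
    + apply/measurable_EFinP; apply: measurableT_comp => //; apply/measurable_EFinP.
      by case/integrableP : ig.
    + by move=> x /=; rewrite !in_itv/= => /andP[-> /= /le_trans]; exact.
have mG : measurable_fun `[0, t] (fun s => U0 + G s).
  apply: measurable_funD => //; apply: subspace_continuous_measurable_fun => //.
  exact: parameterized_integral_continuous.
have itB (B' : R) (h : R -> R) : measurable_fun `[0, t] h ->
    (forall s, `[0, t]%classic s -> `|h s| <= B') -> mu.-integrable `[0, t] (EFin \o h).
  move=> mh hB; apply: measurable_bounded_integrable => //.
    by rewrite /= lebesgue_measure_itv/= lte_fin; case: ifPn => // _; rewrite -EFinD ltry.
  exists B'; split; first exact: num_real.
  by move=> x Bx y /hB h1 /=; exact: le_trans h1 (ltW Bx).
have iUG := itB _ _ mG GB.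
have iU : mu.-integrable `[0, t] (EFin \o U).
  apply/integrableP; split; first exact/measurable_EFinP.
  case/integrableP : iUG => _; apply: le_lt_trans.
  have mUG : measurable_fun `[0, t] (EFin \o (fun s => U0 + G s)) by exact/measurable_EFinP.
  apply: ae_ge0_le_integral => //.
  - by apply: measurableT_comp => //; exact/measurable_EFinP.
  - exact: measurableT_comp.
  - by apply: ae_imp hU => s + ts => /(_ ts) /= ->.
split => //.
have ie (h : R -> R) : mu.-integrable `[0, t] (EFin \o h) ->
    mu.-integrable `[0, t] (EFin \o (fun s => expR (k * s) * h s)).
  move=> ih; apply: (integrable_bddM _ _ _ _ _ _ (expR (`|k| * t))) => //.
    exact: measurable_expR_scale.
  by move=> s /=; rewrite in_itv/=; exact: expR_scale_bound.
have -> : \int[mu]_(s in `[0, t]) (expR (k * s) * (g s + k * U s)) =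
   \int[mu]_(s in `[0, t]) (expR (k * s) * g s) +
   \int[mu]_(s in `[0, t]) (k * expR (k * s) * (U0 + G s)).
  under eq_Rintegral do rewrite mulrDr.
  rewrite RintegralD//; first last.
  - apply: ie; exact: (integrableZl mI k iU).
  - exact: ie.
  congr (_ + _); congr fine; apply: ae_eq_integral => //.
  - apply/measurable_EFinP; apply: measurable_funM; first exact: measurable_expR_scale.
    exact: measurable_funM.
  - apply/measurable_EFinP; apply: measurable_funM => //.
    by apply: measurable_funM => //; exact: measurable_expR_scale.
  - by apply: ae_imp hU => s + ts => /(_ ts) /= ->; rewrite mulrCA mulrA.
have ic a : mu.-integrable `[0, t] (EFin \o cst a).
  by apply: (itB `|a|) => //; exact: measurable_cst.
have iG : mu.-integrable `[0, t] (EFin \o G).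
  have := integrableB mI iUG (ic U0).
  by apply: eq_integrable => // s _; rewrite /= -EFinB addrC addKr.
have iek h : mu.-integrable `[0, t] (EFin \o h) ->
    mu.-integrable `[0, t] (EFin \o (fun s => k * expR (k * s) * h s)).
  move=> /ie /(integrableZl mI k); apply: eq_integrable => // s _.
  by rewrite /= -EFinM mulrA.
under [X in _ = _ + (_ + X)]eq_Rintegral do rewrite mulrDr.
rewrite RintegralD//; [|exact: (iek _ (ic U0))|exact: iek].
have -> : \int[mu]_(x in `[0, t]) (k * expR (k * x) * U0) = (expR (k * t) - 1) * U0.
  have h0 := integral_expR_affine k 0 0 t t0.
  rewrite RintegralZr//; last first.
    have := iek _ (ic 1); apply: eq_integrable => // s _.
    by rewrite /= mulr1.
  congr (_ * _); rewrite /Rintegral.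
  rewrite (_ : expR (k * t) - 1 = fine (expR (k * t + 0) - expR (k * 0 + 0))%:E); last first.
    by rewrite /= !addr0 mulr0 expR0.
  by rewrite -h0; congr fine; apply: eq_integral => s _; rewrite addr0.
rewrite Fubini_triangle//.
under [X in _ = _ + (_ + (_ + X))]eq_Rintegral do rewrite mulrBl.
rewrite RintegralB//; last 2 first.
- exact: (integrableZl mI _ ig).
- exact: ie.
rewrite RintegralZl// Ut.
by ring.
Qed.
End Duhamel.

(** * The truncated square *)

Section TruncatedSquare.
Context {R : realType}.
Implicit Types (N F u a w b : R).

(** The supremum over 0 <= a <= N of 2 a |u| - a^2 F, attained at
    a = min(N, |u| / F): the square u^2 / F when N >= |u| / F, and of linear
    growth in u otherwise. *)
Definition tsq N F u : R :=
  let a := Num.min N (`|u| / F) in 2 * a * `|u| - a ^+ 2 * F.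

Lemma tsq_ge N F u a : 0 < F -> 0 <= a <= N -> 2 * a * `|u| - a ^+ 2 * F <= tsq N F u.
Proof.
move=> F0 /andP[a0 aN]; rewrite /tsq /=.
set y := `|u| / F; have -> : `|u| = y * F by rewrite /y divfK// gt_eqF.
have [Ny|yN] := leP N y; last by have := sqr_ge0 (a - y); nra.
have : 0 <= (N - a) * ((y - a) + (y - N)) by rewrite mulr_ge0; lra.
by move=> /(mulr_ge0 (ltW F0)); nra.
Qed.

Lemma tsq_min_itv N F u : 0 < F -> 0 <= N -> 0 <= Num.min N (`|u| / F) <= N.
Proof.
move=> F0 N0; rewrite ge_min lexx/= andbT le_min N0/= divr_ge0//; exact: ltW.
Qed.

Lemma tsq_ge0 N F u : 0 < F -> 0 <= N -> 0 <= tsq N F u.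
Proof.
move=> F0 N0; have := @tsq_ge N F u 0 F0; rewrite lexx N0 => /(_ isT).
by apply: le_trans; nra.
Qed.

Lemma tsq_le_lin N F u : 0 < F -> 0 <= N -> tsq N F u <= 2 * N * `|u|.
Proof.
move=> F0 N0; have /andP[a0 aN] := tsq_min_itv N F u F0 N0.
rewrite /tsq/=; set a := Num.min _ _ in a0 aN *.
have u0 := normr_ge0 u; nra.
Qed.

Lemma tsq_le_sqr N F u : 0 < F -> 0 <= N -> tsq N F u <= `|u| ^+ 2 / F.
Proof.
move=> F0 N0; rewrite /tsq/=; set a := Num.min _ _.
set y := `|u| / F; have -> : `|u| = y * F by rewrite /y divfK// gt_eqF.
have -> : (y * F) ^+ 2 / F = y ^+ 2 * F by field; rewrite gt_eqF.
by have := sqr_ge0 (a - y); nra.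
Qed.

Lemma tsq_eq N F u : 0 < F -> `|u| / F <= N -> tsq N F u = `|u| ^+ 2 / F.
Proof.
move=> F0 uN; rewrite /tsq/= min_r//.
by field; rewrite gt_eqF.
Qed.

Lemma tsq_homo N N' F u : 0 < F -> 0 <= N <= N' -> tsq N F u <= tsq N' F u.
Proof.
move=> F0 /andP[N0 NN']; rewrite {1}/tsq/=; apply: tsq_ge => //.
by have /andP[-> /le_trans] := tsq_min_itv N F u F0 N0; exact.
Qed.

(** Young's inequality for the zero order terms: what is lost by the truncation
    is at most b F a^2, which the slack b of the supersolution F provides. *)
Lemma tsq_absorb N F u a w b : 0 < F -> 0 <= a <= N -> 0 <= b -> 2 * b <= w ->
  2 * a * (w * `|u|) <= (w + 2 * b) * tsq N F u + a ^+ 2 * ((w - b) * F).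
Proof.
move=> F0 aN b0 bw; have N0 : 0 <= N by case/andP : aN; exact: le_trans.
have q0 := tsq_ge0 N F u F0 N0.
have [w0|w0] := leP w 0.
  have -> : w = 0 by lra. have -> : b = 0 by lra.
  by rewrite !(mul0r, mulr0, subr0, addr0).
have wb : 0 < w - b by lra.
pose a' := a * ((w - b) / w).
have a'N : 0 <= a' <= N.
  case/andP : aN => a0 aN; rewrite /a' mulr_ge0 ?divr_ge0 ?(ltW w0) ?(ltW wb)//=.
  rewrite (le_trans _ aN)// -[leRHS]mulr1 ler_wpM2l// ler_pdivrMr// mul1r; lra.
have h := tsq_ge N F u a' F0 a'N.
have wwb : 0 < w ^+ 2 / (w - b) by rewrite divr_gt0// exprn_gt0.
have h2 : w ^+ 2 / (w - b) <= w + 2 * b.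
  by rewrite ler_pdivrMr//; nra.
have h3 : w ^+ 2 / (w - b) * (2 * a' * `|u| - a' ^+ 2 * F) =
   2 * a * (w * `|u|) - a ^+ 2 * ((w - b) * F).
  by rewrite /a'; field; rewrite !gt_eqF.
have : w ^+ 2 / (w - b) * (2 * a' * `|u| - a' ^+ 2 * F) <= (w + 2 * b) * tsq N F u.
  apply: (@le_trans _ _ (w ^+ 2 / (w - b) * tsq N F u)); first by rewrite ler_wpM2l// ltW.
  by rewrite ler_wpM2r.
by rewrite h3; lra.
Qed.
End TruncatedSquare.

(** * Duhamel inequalities along one characteristic *)

Section DuhamelInequality.
Context {R : realType}.
Notation mu := (@lebesgue_measure R).

Lemma patch_itvE (f : R -> \bar R) (a b x : R) :
  (f \_ `[a, b]) x = if a <= x <= b then f x else 0%E.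
Proof.
rewrite patchE; case: ifPn; rewrite ?inE ?notin_setE/= in_itv/=; first by move=> ->.
by move=> /negP/negbTE ->.
Qed.

Lemma measurable_itv_integral (f : R -> \bar R) (a b : R -> R) :
  measurable_fun setT f -> measurable_fun setT a -> measurable_fun setT b ->
  measurable_fun setT (fun t => \int[mu]_(s in `[a t, b t]) f s)%E.
Proof.
move=> mf ma mb.
rewrite (_ : (fun t => _) = fun t => (\int[mu]_s
   (if ((a t <= s) && (s <= b t))%R then f s else 0))%E); last first.
  apply/funext => t; rewrite integral_mkcond; apply: eq_integral => s _.
  by rewrite patch_itvE.
apply: (@measurable_parametric_integral _ _ _ _ _ mu
  (fun p => if (a p.1 <= p.2) && (p.2 <= b p.1) then f p.2 else 0%E)).
apply: measurable_fun_ifT => //=.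
- by apply: measurable_and; apply: measurable_fun_ler => //; exact: measurableT_comp.
- exact: measurableT_comp.
Qed.

(** Tonelli on the triangle s <= x <= t. *)
Lemma Tonelli_triangle (f g : R -> \bar R) (t : R) :
  measurable_fun setT f -> measurable_fun setT g ->
  (forall s, 0 <= f s)%E -> (forall s, 0 <= g s)%E ->
  (\int[mu]_(x in `[0%R, t]) (f x * \int[mu]_(s in `[0%R, x]) g s) =
   \int[mu]_(s in `[0%R, t]) (g s * \int[mu]_(x in `[s, t]) f x))%E.
Proof.
move=> mf mg f0 g0.
pose H (p : R * R) := if [&& 0 <= p.2, p.2 <= p.1 & p.1 <= t] then (f p.1 * g p.2)%E else 0%E.
have mH : measurable_fun setT H.
  apply: measurable_fun_ifT => //.
    by do !apply: measurable_and; apply: measurable_fun_ler.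
  by apply: emeasurable_funM; exact: measurableT_comp.
have H0 p : (0 <= H p)%E by rewrite /H; case: ifP => // _; exact: mule_ge0.
have := @fubini_tonelli _ _ _ _ _ mu mu H mH H0.
have -> : (\int[mu]_x \int[mu]_y H (x, y) =
    \int[mu]_(x in `[0%R, t]) (f x * \int[mu]_(s in `[0%R, x]) g s))%E.
  rewrite [RHS]integral_mkcond; apply: eq_integral => x _; rewrite patch_itvE.
  case: ifPn => [/andP[x0 xt]|xt].
    rewrite [in RHS]integral_mkcond -ge0_integralZl//; last 2 first.
    - exact/(measurable_restrictT _ _).1/measurable_funTS.
    - by move=> s _; exact: erestrict_ge0.
    apply: eq_integral => s _; rewrite /H/= patch_itvE xt andbT.
    by case: ifPn => //; rewrite mule0.
  rewrite integral0_eq// => s _; rewrite /H/=; case: ifPn => // /and3P[s0 sx xt'].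
  by move: xt; rewrite xt' (le_trans s0).
have -> : (\int[mu]_y \int[mu]_x H (x, y) =
    \int[mu]_(s in `[0%R, t]) (g s * \int[mu]_(x in `[s, t]) f x))%E.
  rewrite [RHS]integral_mkcond; apply: eq_integral => s _; rewrite patch_itvE.
  case: ifPn => [/andP[s0 st]|st].
    rewrite [in RHS]integral_mkcond -ge0_integralZl//; last 2 first.
    - exact/(measurable_restrictT _ _).1/measurable_funTS.
    - by move=> x _; exact: erestrict_ge0.
    apply: eq_integral => x _; rewrite /H/= patch_itvE s0 /=.
    by case: ifPn => //; [rewrite muleC|rewrite mule0].
  rewrite integral0_eq// => x _; rewrite /H/=; case: ifPn => // /and3P[s0 sx xt'].
  by move: st; rewrite s0 (le_trans sx).
by [].
Qed.

(** With K <= k, the term (k - K) |U| added by the integrating factor is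
    nonnegative, so that absolute values can be taken inside the integral. *)
Lemma duhamel_le (k t U0 : R) (U S K : R -> R) (h : R -> \bar R) : 0 <= t ->
  measurable_fun setT U -> measurable_fun setT S -> measurable_fun setT K ->
  measurable_fun setT h ->
  (forall s, 0 <= K s <= k) ->
  (forall s, `|S s|%:E <= h s)%E ->
  mu.-integrable `[0, t] (EFin \o (fun s => S s - K s * U s)) ->
  {ae mu, forall s, `[0, t]%classic s ->
     U s = U0 + \int[mu]_(x in `[0, s]) (S x - K x * U x)} ->
  U t = U0 + \int[mu]_(x in `[0, t]) (S x - K x * U x) ->
  ((expR (k * t) * `|U t|)%:E <=
   `|U0|%:E + \int[mu]_(s in `[0%R, t]) ((expR (k * s))%:E * (h s + ((k - K s) * `|U s|)%:E)))%E.
Proof.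
move=> t0 mU mS mK mh K0 Sh ig hU Ut.
have [|iU eU] := @duhamel _ k t U0 U _ t0 ig _ hU Ut; first exact: measurable_funTS.
have k0 : 0 <= k by have /andP[] := K0 0; exact: le_trans.
have -> : (expR (k * t) * `|U t|) = `|expR (k * t) * U t|.
  by rewrite normrM ger0_norm// expR_ge0.
rewrite eU.
have ii : mu.-integrable `[0, t]
    (EFin \o (fun s => expR (k * s) * (S s - K s * U s + k * U s))).
  apply: (integrable_bddM _ _ _ _ _ _ (expR (`|k| * t))) => //.
  - exact: measurable_expR_scale.
  - by move=> s /=; rewrite in_itv/=; exact: expR_scale_bound.
  - have mI : measurable (`[0, t]%classic : set (measurableTypeR R)) by exact: measurable_itv.
    exact: (integrableD mI ig (integrableZl mI k iU)).
apply: le_trans (_ : (`|U0|%:E + `|\int[mu]_(s in `[0, t])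
   (expR (k * s) * (S s - K s * U s + k * U s))|%:E <= _)%E).
  by rewrite -EFinD lee_fin ler_normD.
rewrite leeD2l// EFin_normr_Rintegral//.
apply: le_trans (le_abse_integral _ _ _) _ => //.
  by case/integrableP : ii.
have mm : measurable_fun setT (fun s => (expR (k * s))%:E * (h s + ((k - K s) * `|U s|)%:E))%E.
  apply: emeasurable_funM; first by apply/measurable_EFinP; exact: measurable_expR_scale.
  apply: emeasurable_funD => //; apply/measurable_EFinP; apply: measurable_funM.
    exact: measurable_funB.
  exact: measurableT_comp.
apply: ge0_le_integral => //.
- by apply: measurableT_comp => //; case/integrableP : ii.
- exact: measurable_funTS.
move=> s _ /=; rewrite normrM ger0_norm ?expR_ge0// EFinM lee_wpmul2l//.
have -> : S s - K s * U s + k * U s = S s + (k - K s) * U s by ring.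
rewrite (@le_trans _ _ (`|S s| + (k - K s) * `|U s|)%:E)//.
  rewrite lee_fin (le_trans (ler_normD _ _))// lerD2l normrM ger0_norm// subr_ge0.
  by case/andP : (K0 s).
by rewrite EFinD leeD2r.
Qed.
End DuhamelInequality.

Section TruncatedDuhamel.
Context {R : realType}.
Notation mu := (@lebesgue_measure R).

Lemma measurable_invr : measurable_fun setT (@GRing.inv R).
Proof.
rewrite -(setUv [set 0 : R]); apply/measurable_funU => //; first exact: measurableC.
split; first exact: measurable_fun_set1.
apply: open_continuous_measurable_fun; first by apply: closed_openC; rewrite -set_itv1; exact: interval_closed.
by move=> x; rewrite inE/= => /eqP x0; exact: inv_continuous.
Qed.

Lemma measurable_funV d (T : measurableType d) (D : set T) (f : T -> R) :
  measurable_fun D f -> measurable_fun D (fun x => (f x)^-1).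
Proof. exact: measurableT_comp measurable_invr. Qed.

Lemma measurable_tsq d (T : measurableType d) (N : R) (F U : T -> R) :
  measurable_fun setT F -> measurable_fun setT U ->
  measurable_fun setT (fun x => tsq N (F x) (U x)).
Proof.
move=> mF mU.
have mq : measurable_fun setT (fun x => Num.min N (`|U x| / F x)).
  apply: measurable_minr => //; apply: measurable_funM; first exact: measurableT_comp.
  exact: measurable_funV.
apply: measurable_funB; apply: measurable_funM => //.
- exact: measurable_funM.
- exact: measurableT_comp.
- exact: measurable_funX.
Qed.

(** Take a optimal at time t and combine 2 a times the inequality for |U| with
    a^2 times the inequality for F; the starting value is then at most the
    truncated square of U0, and Young's inequality bounds the integrands. The
    hypothesis on h, hF and hq is the Cauchy-Schwarz inequality for the velocity
    averages in dual form. *)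
Lemma tsq_duhamel (k t N U0 : R) (U F w b : R -> R) (h hF hq : R -> \bar R) :
  0 <= t -> 0 <= N ->
  measurable_fun setT U -> measurable_fun setT F -> measurable_fun setT w ->
  measurable_fun setT b -> measurable_fun setT h -> measurable_fun setT hF ->
  measurable_fun setT hq ->
  (forall s, 0 < F s) -> (forall s, 0 <= b s) -> (forall s, 2 * b s <= w s) ->
  (forall s, 0 <= h s)%E -> (forall s, 0 <= hF s)%E -> (forall s, 0 <= hq s)%E ->
  (forall s a, 0 <= a <= N -> ((2 * a)%:E * h s <= hq s + (a ^+ 2)%:E * hF s)%E) ->
  ((expR (k * t) * `|U t|)%:E <= `|U0|%:E +
    \int[mu]_(s in `[0%R, t]) ((expR (k * s))%:E * (h s + (w s * `|U s|)%:E)))%E ->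
  ((F 0)%:E +
    \int[mu]_(s in `[0%R, t]) ((expR (k * s))%:E * (hF s + ((w s - b s) * F s)%:E))
    <= (expR (k * t) * F t)%:E)%E ->
  ((expR (k * t) * tsq N (F t) (U t))%:E <= (tsq N (F 0%R) U0)%:E +
    \int[mu]_(s in `[0%R, t]) ((expR (k * s))%:E *
       (hq s + ((w s + 2 * b s) * tsq N (F s) (U s))%:E)))%E.
Proof.
move=> t0 N0 mU mF mw mb mh mhF mhq F0 b0 bw h0 hF0 hq0 hha Hu HF.
set A := (\int[mu]_(s in _) _)%E in Hu.
set C := (\int[mu]_(s in _) _)%E in HF.
set B := (\int[mu]_(s in _) _)%E.
have me : measurable_fun setT (fun s : R => (expR (k * s))%:E).
  by apply/measurable_EFinP; exact: measurable_expR_scale.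
have w0 s : 0 <= w s by have := b0 s; have := bw s; lra.
have mtsq := measurable_tsq _ _ N F U mF mU.
have mU' : measurable_fun setT (fun s => `|U s|) by exact: measurableT_comp.
have mA : measurable_fun setT (fun s => (expR (k * s))%:E * (h s + (w s * `|U s|)%:E))%E.
  apply: emeasurable_funM => //; apply: emeasurable_funD => //.
  by apply/measurable_EFinP; exact: measurable_funM.
have mC : measurable_fun setT (fun s => (expR (k * s))%:E * (hF s + ((w s - b s) * F s)%:E))%E.
  apply: emeasurable_funM => //; apply: emeasurable_funD => //.
  by apply/measurable_EFinP; apply: measurable_funM => //; exact: measurable_funB.
have mB : measurable_fun setT (fun s => (expR (k * s))%:E *
       (hq s + ((w s + 2 * b s) * tsq N (F s) (U s))%:E))%E.
  apply: emeasurable_funM => //; apply: emeasurable_funD => //.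
  apply/measurable_EFinP; apply: measurable_funM.
    by apply: measurable_funD => //; exact: measurable_funM.
  exact: mtsq.
have A0 s : (0 <= (expR (k * s))%:E * (h s + (w s * `|U s|)%:E))%E.
  by rewrite mule_ge0 ?lee_fin ?expR_ge0// adde_ge0// lee_fin mulr_ge0.
have C0 s : (0 <= (expR (k * s))%:E * (hF s + ((w s - b s) * F s)%:E))%E.
  rewrite mule_ge0 ?lee_fin ?expR_ge0// adde_ge0// lee_fin mulr_ge0 ?(ltW (F0 _))//.
  by have := b0 s; have := bw s; lra.
have B0 s : (0 <= (expR (k * s))%:E * (hq s + ((w s + 2 * b s) * tsq N (F s) (U s))%:E))%E.
  rewrite mule_ge0 ?lee_fin ?expR_ge0// adde_ge0// lee_fin mulr_ge0 ?tsq_ge0//.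
  by have := b0 s; have := w0 s; lra.
pose a := Num.min N (`|U t| / F t).
have aN : 0 <= a <= N by exact: tsq_min_itv.
have a0 : 0 <= a by case/andP : aN.
have key : ((2 * a)%:E * A <= B + (a ^+ 2)%:E * C)%E.
  rewrite /A /B /C -!ge0_integralZl//; last 4 first.
  - exact: measurable_funTS.
  - by rewrite lee_fin sqr_ge0.
  - exact: measurable_funTS.
  - by rewrite lee_fin mulr_ge0.
  rewrite -ge0_integralD//; last 3 first.
  - exact: measurable_funTS.
  - by move=> s _; rewrite mule_ge0// lee_fin sqr_ge0.
  - by apply: measurable_funTS; exact: emeasurable_funM.
  apply: ge0_le_integral => //.
  - by move=> s _; rewrite mule_ge0// lee_fin mulr_ge0.
  - by apply: measurable_funTS; exact: emeasurable_funM.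
  - by apply: measurable_funTS; apply: emeasurable_funD => //; exact: emeasurable_funM.
  move=> s _.
  have wb0 : 0 <= w s - b s by have := b0 s; have := bw s; lra.
  have w2b0 : 0 <= w s + 2 * b s by have := b0 s; have := w0 s; lra.
  have q0 : 0 <= tsq N (F s) (U s) by exact: tsq_ge0.
  rewrite muleCA [X in (_ <= _ + X)%E]muleCA -ge0_muleDr; last 2 first.
  - by rewrite adde_ge0// lee_fin mulr_ge0.
  - by rewrite mule_ge0 ?lee_fin ?sqr_ge0// adde_ge0// lee_fin mulr_ge0// ltW.
  rewrite lee_wpmul2l ?lee_fin ?expR_ge0//.
  rewrite ge0_muleDr//; last by rewrite lee_fin mulr_ge0.
  rewrite [X in (_ <= _ + X)%E]ge0_muleDr//; last by rewrite lee_fin mulr_ge0// ltW.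
  rewrite addeACA leeD//; first exact: hha.
  by rewrite -!EFinM -EFinD lee_fin tsq_absorb.
have C_ge0 : (0 <= C)%E by exact: integral_ge0.
have B_ge0 : (0 <= B)%E by exact: integral_ge0.
have Cfin : C \is a fin_num.
  rewrite ge0_fin_numE//; apply: (@le_lt_trans _ _ (expR (k * t) * F t)%:E); last exact: ltry.
  by apply: le_trans HF; rewrite leeDr// lee_fin ltW.
have [->|Bfin] := eqVneq B +oo%E; first by rewrite addey// leey.
have {}Bfin : B \is a fin_num by rewrite ge0_fin_numE// lt_neqAle Bfin leey.
have h1 : ((2 * a * (expR (k * t) * `|U t|))%:E <=
    (2 * a * `|U0|)%:E + (B + (a ^+ 2)%:E * C))%E.
  apply: (@le_trans _ _ ((2 * a)%:E * (`|U0|%:E + A))%E).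
    by rewrite [leLHS]EFinM lee_wpmul2l// lee_fin mulr_ge0.
  rewrite ge0_muleDr//; last exact: integral_ge0.
  by rewrite EFinM leeD2l.
move: h1 HF; rewrite -(fineK Cfin) -(fineK Bfin) -!(EFinM, EFinD) !lee_fin => h1 h2.
have h3 := tsq_ge N (F 0) U0 a (F0 0) aN.
have -> : tsq N (F t) (U t) = 2 * a * `|U t| - a ^+ 2 * F t by [].
have a20 := sqr_ge0 a.
have := ler_wpM2l a20 h2.
by lra.
Qed.
End TruncatedDuhamel.

Section CharacteristicEnergy.
Context {R : realType}.
Notation mu := (@lebesgue_measure R).

(** The weighted balance on one characteristic, integrated against the adjoint
    inequality for G.  The terms B q G occur on both sides; they are cancelled
    after an exchange of the time integrals, and their integral has to be finite
    for that. *)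
Lemma char_energy (k T q0 : R) (q B G : R -> R) (hq n : R -> \bar R) :
  0 <= T -> 0 <= q0 ->
  measurable_fun setT q -> measurable_fun setT B -> measurable_fun setT G ->
  measurable_fun setT hq -> measurable_fun setT n ->
  (forall s, 0 <= q s) -> (forall s, 0 <= B s) -> (forall s, 0 <= G s) ->
  (forall s, 0 <= hq s)%E -> (forall s, 0 <= n s)%E ->
  {ae mu, forall x, `[0, T]%classic x ->
    ((expR (k * x) * q x)%:E <= q0%:E +
       \int[mu]_(s in `[0%R, x]) ((expR (k * s))%:E * (hq s + (B s * q s)%:E)))%E} ->
  (forall s, 0 <= s <= T ->
    ((expR (- k * T) * G T)%:E +
       \int[mu]_(x in `[s, T]) ((expR (- k * x))%:E * (n x + (B x * G x)%:E))
     <= (expR (- k * s) * G s)%:E)%E) ->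
  (\int[mu]_(s in `[0%R, T]) (q s * (B s * G s))%:E < +oo)%E ->
  (\int[mu]_(s in `[0%R, T]) ((q s)%:E * n s) +
     (expR (- k * T) * G T)%:E * (q0%:E +
        \int[mu]_(s in `[0%R, T]) ((expR (k * s))%:E * (hq s + (B s * q s)%:E))) <=
   (q0 * G 0)%:E + \int[mu]_(s in `[0%R, T]) (hq s * (G s)%:E))%E.
Proof.
move=> T0 q00 mq mB mG mhq mn q_ge0 B_ge0 G_ge0 hq_ge0 n_ge0 HQ HG fin.
have me (l : R) : measurable_fun setT (fun s : R => (expR (l * s))%:E).
  by apply/measurable_EFinP; exact: measurable_expR_scale.
have e_ge0 (l s : R) : (0 <= (expR (l * s))%:E)%E by rewrite lee_fin expR_ge0.
pose y s := ((expR (k * s))%:E * (hq s + (B s * q s)%:E))%E.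
pose N s := ((expR (- k * s))%:E * (n s + (B s * G s)%:E))%E.
have mBq : measurable_fun setT (fun s => (B s * q s)%:E).
  by apply/measurable_EFinP; exact: measurable_funM.
have mBG : measurable_fun setT (fun s => (B s * G s)%:E).
  by apply/measurable_EFinP; exact: measurable_funM.
have my : measurable_fun setT y.
  by apply: emeasurable_funM => //; exact: emeasurable_funD.
have mN : measurable_fun setT N.
  by apply: emeasurable_funM => //; exact: emeasurable_funD.
have y0 s : (0 <= y s)%E by rewrite mule_ge0// adde_ge0// lee_fin mulr_ge0.
have N0 s : (0 <= N s)%E by rewrite mule_ge0// adde_ge0// lee_fin mulr_ge0.
have BG0 s : (0 <= (B s * G s)%:E)%E by rewrite lee_fin mulr_ge0.
have Bq0 s : (0 <= (B s * q s)%:E)%E by rewrite lee_fin mulr_ge0.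
have mqE : measurable_fun setT (fun s => (q s)%:E) by exact/measurable_EFinP.
have mGE : measurable_fun setT (fun s => (G s)%:E) by exact/measurable_EFinP.
pose Y x := (\int[mu]_(s in `[0%R, x]) y s)%E.
pose gT := expR (- k * T) * G T.
have gT0 : (0 <= gT%:E)%E by rewrite lee_fin mulr_ge0 ?expR_ge0.
have mY : measurable_fun setT Y by exact: measurable_itv_integral.
have Y0 x : (0 <= Y x)%E by exact: integral_ge0.
have mNs : measurable_fun setT (fun s => \int[mu]_(x in `[s, T]) N x)%E.
  by apply: measurable_itv_integral.
have Ns0 s : (0 <= \int[mu]_(x in `[s, T]) N x)%E by exact: integral_ge0.
have q0E : (0 <= q0%:E)%E by rewrite lee_fin.
rewrite -/(Y T) -/gT.
set X1 := (\int[mu]_(s in _) _)%E.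
set X2 := (\int[mu]_(s in `[0%R, T]) (q s * (B s * G s))%:E)%E in fin.
have S1 : (X1 + X2 <= \int[mu]_(x in `[0%R, T]) (N x * (q0%:E + Y x)))%E.
  rewrite /X1 /X2 -ge0_integralD//; last 4 first.
  - by move=> s _; rewrite mule_ge0// lee_fin.
  - by apply: measurable_funTS; exact: emeasurable_funM.
  - by move=> s _; rewrite lee_fin mulr_ge0// mulr_ge0.
  - by apply: measurable_funTS; apply/measurable_EFinP; do !apply: measurable_funM.
  apply: ae_ge0_le_integral => //.
  - move=> s _; rewrite adde_ge0//; first by rewrite mule_ge0// lee_fin.
    by rewrite lee_fin mulr_ge0// mulr_ge0.
  - apply: measurable_funTS; apply: emeasurable_funD; first exact: emeasurable_funM.
    by apply/measurable_EFinP; do !apply: measurable_funM.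
  - by move=> s _; rewrite mule_ge0// adde_ge0.
  - by apply: measurable_funTS; apply: emeasurable_funM => //; exact: emeasurable_funD.
  apply: ae_imp HQ => x + xT => /(_ xT) h.
  apply: le_trans (lee_wpmul2l (N0 x) h).
  rewrite (EFinM (expR (k * x))) /N muleACA -EFinM mulNr -expRD addNr expR0 mul1e.
  by rewrite EFinM -ge0_muleDr// muleC.
have S2 : (\int[mu]_(x in `[0%R, T]) (N x * (q0%:E + Y x)) =
   q0%:E * \int[mu]_(x in `[0%R, T]) N x +
   \int[mu]_(s in `[0%R, T]) (y s * \int[mu]_(x in `[s, T]) N x))%E.
  rewrite -Tonelli_triangle// muleC -ge0_integralZr//; last exact: measurable_funTS.
  rewrite -ge0_integralD//; last 4 first.
  - by move=> s _; rewrite mule_ge0.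
  - by apply: measurable_funTS; exact: emeasurable_funM.
  - by move=> s _; apply: mule_ge0 => //; exact: Y0.
  - by apply: measurable_funTS; apply: emeasurable_funM => //; exact: mY.
  by apply: eq_integral => s _; apply: ge0_muleDr => //; exact: Y0.
have S3 : (gT%:E * (q0%:E + Y T) = q0%:E * gT%:E +
    \int[mu]_(s in `[0%R, T]) (y s * gT%:E))%E.
  rewrite ge0_muleDr// muleC; congr (_ + _)%E.
  by rewrite muleC; apply/esym/ge0_integralZr => //; exact: measurable_funTS.
have S4 : (q0%:E * (\int[mu]_(x in `[0%R, T]) N x + gT%:E) <= (q0 * G 0)%:E)%E.
  rewrite [leRHS]EFinM lee_wpmul2l//.
  have := HG 0; rewrite lexx T0 => /(_ isT).
  by rewrite mulr0 expR0 mul1r addeC.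
have S5 : (\int[mu]_(s in `[0%R, T]) (y s * (\int[mu]_(x in `[s, T]) N x + gT%:E))
    <= \int[mu]_(s in `[0%R, T]) (hq s * (G s)%:E) + X2)%E.
  rewrite /X2 -ge0_integralD//; last 4 first.
  - by move=> s _; rewrite mule_ge0// lee_fin.
  - by apply: measurable_funTS; exact: emeasurable_funM.
  - by move=> s _; rewrite lee_fin mulr_ge0// mulr_ge0.
  - by apply: measurable_funTS; apply/measurable_EFinP; do !apply: measurable_funM.
  apply: ge0_le_integral => //.
  - by move=> s _; rewrite mule_ge0// adde_ge0.
  - apply: measurable_funTS; apply: emeasurable_funM => //.
    exact: emeasurable_funD.
  - apply: measurable_funTS; apply: emeasurable_funD; first exact: emeasurable_funM.
    by apply/measurable_EFinP; do !apply: measurable_funM.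
  move=> s /=; rewrite in_itv/= => /HG; rewrite addeC => h.
  apply: le_trans (lee_wpmul2l (y0 s) h) _.
  rewrite /y (EFinM (expR (- k * s))) muleACA -EFinM mulNr -expRD addrN expR0 mul1e.
  by rewrite ge0_muleDl// -EFinM (_ : B s * q s * G s = q s * (B s * G s))//; ring.
have X2fin : X2 \is a fin_num.
  by rewrite ge0_fin_numE//; apply: integral_ge0 => s _; rewrite lee_fin mulr_ge0// mulr_ge0.
rewrite -(leeD2rE _ _ X2fin) addeAC.
apply: le_trans (leeD2r _ S1) _.
have e1 : (q0%:E * \int[mu]_(x in `[0%R, T]) N x + q0%:E * gT%:E =
    q0%:E * (\int[mu]_(x in `[0%R, T]) N x + gT%:E))%E.
  by apply/esym/ge0_muleDr => //; exact: integral_ge0.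
rewrite S2 S3 addeACA e1.
rewrite -[leRHS]addeA; apply: leeD => //; apply: le_trans S5.
rewrite -ge0_integralD//; last 4 first.
- by move=> s _; rewrite mule_ge0.
- by apply: measurable_funTS; exact: emeasurable_funM.
- by move=> s _; rewrite mule_ge0.
- by apply: measurable_funTS; exact: emeasurable_funM.
apply: ge0_le_integral => //.
- by move=> s _; rewrite adde_ge0// mule_ge0.
- by apply: measurable_funTS; apply: emeasurable_funD; exact: emeasurable_funM.
- by apply: measurable_funTS; apply: emeasurable_funM => //; exact: emeasurable_funD.
by move=> s _; rewrite (ge0_muleDr _ (Ns0 s) gT0).
Qed.
End CharacteristicEnergy.

(** * Exponentials with a kink *)

Section Kink.
Context {R : realType}.
Notation mu := (@lebesgue_measure R).

(** The kink at 0 of the exponent lets one exponential have different rates on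
    the two half lines; all profiles below are combinations of these functions. *)
Definition kexp (al be z : R) := expR (al * z - be * Num.max z 0).

(** The derivative of kexp away from 0. *)
Definition dkexp (al be z : R) := (al - (if 0 < z then be else 0)) * kexp al be z.

Lemma measurable_kexp (al be : R) : measurable_fun setT (kexp al be).
Proof.
apply: measurableT_comp => //; apply: measurable_funB; apply: measurable_funM => //.
exact: measurable_maxr.
Qed.

Lemma measurable_dkexp (al be : R) : measurable_fun setT (dkexp al be).
Proof.
apply: measurable_funM; last exact: measurable_kexp.
apply: measurable_funB => //; apply: measurable_fun_ifT => //.
exact: measurable_fun_ltr.
Qed.

(** The fundamental theorem of calculus for e^(k s) kexp (z0 + w s), which is
    piecewise smooth: the path crosses the kink at most once. *)
Lemma kexp_path (k al be z0 w a b : R) : a <= b ->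
  (\int[mu]_(s in `[a, b]) (expR (k * s) *
      (k * kexp al be (z0 + w * s) + w * dkexp al be (z0 + w * s)))%:E =
   (expR (k * b) * kexp al be (z0 + w * b) - expR (k * a) * kexp al be (z0 + w * a))%:E)%E.
Proof.
have mf : measurable_fun setT (fun s => expR (k * s) *
      (k * kexp al be (z0 + w * s) + w * dkexp al be (z0 + w * s))).
  have mz : measurable_fun setT (fun s => z0 + w * s).
    by apply: measurable_funD => //; exact: measurable_funM.
  apply: measurable_funM; first exact: measurable_expR_scale.
  apply: measurable_funD; apply: measurable_funM => //.
    by apply: measurableT_comp mz; exact: measurable_kexp.
  by apply: measurableT_comp mz; exact: measurable_dkexp.
(* On a segment where the sign of z0 + w s is constant the integrand is smooth,
   except at one time where the derivative is not defined. *)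
have pos a' b' : a' <= b' -> 0 <= z0 + w * a' -> 0 <= z0 + w * b' ->
  (\int[mu]_(s in `[a', b']) (expR (k * s) *
      (k * kexp al be (z0 + w * s) + w * dkexp al be (z0 + w * s)))%:E =
   (expR (k * b') * kexp al be (z0 + w * b') - expR (k * a') * kexp al be (z0 + w * a'))%:E)%E.
  move=> ab za zb.
  have kE s : 0 <= z0 + w * s -> expR (k * s) * kexp al be (z0 + w * s) =
      expR ((k + w * (al - be)) * s + (al - be) * z0).
    move=> zs; rewrite /kexp max_l// -expRD; congr expR; ring.
  apply: (@etrans _ _ (expR ((k + w * (al - be)) * b' + (al - be) * z0)
    - expR ((k + w * (al - be)) * a' + (al - be) * z0))%:E); last by rewrite -!kE.
  rewrite -integral_expR_affine//.
  apply: ae_eq_integral => //.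
  - exact/measurable_EFinP/measurable_funTS.
  - apply/measurable_EFinP/measurable_funTS; apply: measurable_funM => //.
    apply: measurableT_comp => //; apply: measurable_funD => //; exact: measurable_funM.
  exists [set (- z0 / w)]; split => //.
    exact: lebesgue_measure_set1.
  move=> s /=; apply: contra_notP => /eqP sN /=; rewrite in_itv/= => /andP[s1 s2].
  have zs : 0 <= z0 + w * s.
    have [w0|w0] := leP 0 w; first by rewrite (le_trans za)// lerD2l ler_wpM2l.
    by rewrite (le_trans zb)// lerD2l ler_wnM2l// ltW.
  congr EFin; rewrite -kE// /dkexp.
  have [->|w0] := eqVneq w 0; first by rewrite !mul0r !addr0; ring.
  case: ifPn => [_|]; first by ring.
  rewrite -leNgt => zs'; exfalso; move: sN.
  have : z0 + w * s = 0 by apply/eqP; rewrite eq_le zs zs'.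
  move/eqP; rewrite addrC addr_eq0 => /eqP h; rewrite -h mulrAC divff// mul1r eqxx.
  by [].
have neg a' b' : a' <= b' -> z0 + w * a' <= 0 -> z0 + w * b' <= 0 ->
  (\int[mu]_(s in `[a', b']) (expR (k * s) *
      (k * kexp al be (z0 + w * s) + w * dkexp al be (z0 + w * s)))%:E =
   (expR (k * b') * kexp al be (z0 + w * b') - expR (k * a') * kexp al be (z0 + w * a'))%:E)%E.
  move=> ab za zb.
  have kE s : z0 + w * s <= 0 -> expR (k * s) * kexp al be (z0 + w * s) =
      expR ((k + w * al) * s + al * z0).
    move=> zs; rewrite /kexp max_r// -expRD; congr expR; ring.
  apply: (@etrans _ _ (expR ((k + w * al) * b' + al * z0)
    - expR ((k + w * al) * a' + al * z0))%:E); last by rewrite -!kE.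
  rewrite -integral_expR_affine//.
  apply: eq_integral => s; rewrite inE/= in_itv/= => /andP[s1 s2].
  have zs : z0 + w * s <= 0.
    have [w0|w0] := leP 0 w; first by rewrite (le_trans _ zb)// lerD2l ler_wpM2l.
    by rewrite (le_trans _ za)// lerD2l ler_wnM2l// ltW.
  by congr EFin; rewrite -kE// /dkexp ltNge zs/=; ring.
(* Otherwise the segment is cut at the time m of the crossing. *)
have split_at m : a <= m <= b -> z0 + w * m = 0 ->
   ((0 <= z0 + w * a) /\ (z0 + w * b <= 0)) \/ ((z0 + w * a <= 0) /\ (0 <= z0 + w * b)) ->
  (\int[mu]_(s in `[a, b]) (expR (k * s) *
      (k * kexp al be (z0 + w * s) + w * dkexp al be (z0 + w * s)))%:E =
   (expR (k * b) * kexp al be (z0 + w * b) - expR (k * a) * kexp al be (z0 + w * a))%:E)%E.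
  move=> /andP[am mb] zm h.
  rewrite (@itv_bndbnd_setU _ _ _ (BRight m)) ?bnd_simp//.
  rewrite integral_setU_EFin//=; last 2 first.
  - exact: measurable_funTS.
  - apply/disj_setPS => s /=; rewrite !in_itv/= => -[/andP[_ h1] /andP[h2 _]].
    by move: h1; rewrite leNgt h2.
  rewrite integral_itv_obnd_cbnd; last exact/measurable_EFinP/measurable_funTS.
  have z0' : 0 <= z0 + w * m <= 0 by rewrite zm lexx.
  case/andP : z0' => z1 z2.
  by case: h => -[ha hb]; [rewrite pos// neg//|rewrite neg// pos//];
    rewrite -EFinD; congr EFin; ring.
move=> ab.
have [za|za] := leP 0 (z0 + w * a); have [zb|zb] := leP 0 (z0 + w * b).
- exact: pos.
- have w0 : w < 0 by nra.
  apply: (split_at (- z0 / w)).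
  - by apply/andP; split; [rewrite ler_ndivlMr//|rewrite ler_ndivrMr//]; lra.
  - by field; rewrite lt_eqF.
  - by left; split => //; exact: ltW.
- have w0 : 0 < w by nra.
  apply: (split_at (- z0 / w)).
  - by apply/andP; split; [rewrite ler_pdivlMr//|rewrite ler_pdivrMr//]; lra.
  - by field; rewrite gt_eqF.
  - by right; split => //; exact: ltW.
- by apply: neg => //; exact: ltW.
Qed.
End Kink.

(** * The weighted energy inequality *)

Section PhaseMeasure.
Context {R : realType}.
Notation mu := (@lebesgue_measure R).
Notation mu2 := (mu \x mu)%E.

Lemma mu2_sigma_finite : sigma_finite setT mu2.
Proof.
have /sigma_finiteP[F [TF ndF Foo]] := sigma_finiteT mu.
exists (fun n => F n `*` F n).
  rewrite -setXTT TF predeqE => -[x y]; split.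
    move=> [/= [n _ Fnx] [l _ Fly]]; exists (maxn n l) => //; split.
    - by move: x Fnx; exact/subsetPset/ndF/leq_maxl.
    - by move: y Fly; exact/subsetPset/ndF/leq_maxr.
  by move=> [n _ []/= ? ?]; split; exists n.
move=> l; have [mF Fl] := Foo l.
split; first exact: measurableX.
by rewrite product_measure1E// lte_mul_pinfty// ge0_fin_numE.
Qed.
Definition mu2_sf_mixin := Measure_isSigmaFinite.Build _ _ _ mu2 mu2_sigma_finite.
(** The product measure as a sigma-finite measure, as needed to apply Tonelli's
    theorem with the plane as a factor. *)
Definition mu2S : {sigma_finite_measure set (measurableTypeR R * measurableTypeR R)%type -> \bar R} := HB.pack mu2 mu2_sf_mixin.

Lemma integral_mu2E_vz (g : R * R -> \bar R) :
  measurable_fun setT g -> (forall x, 0 <= g x)%E ->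
  (\int[mu2]_x g x = \int[mu]_z \int[mu]_v g (z, v))%E.
Proof. by move=> mg g0; exact: (@fubini_tonelli1 _ _ _ _ _ mu mu g mg g0). Qed.

Lemma Tonelli_time_phase (g : R * (R * R) -> \bar R) :
  measurable_fun setT g -> (forall x, 0 <= g x)%E ->
  (\int[mu]_s \int[mu2]_x g (s, x) = \int[mu2]_x \int[mu]_s g (s, x))%E.
Proof. by move=> mg g0; exact: (@fubini_tonelli _ _ _ _ _ mu mu2S g mg g0). Qed.

End PhaseMeasure.

Section Energy.
Context {R : realType}.
Notation mu := (@lebesgue_measure R).
Notation mu2 := (mu \x mu)%E.

(** The position at time p.1 of the characteristic that starts from p.2. *)
Definition path_of (c : R) (p : R * (R * R)) : R * R :=
  (p.2.1 + (p.2.2 - c) * p.1, p.2.2).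

Lemma path_of0 c (x : R * R) : path_of c (0, x) = x.
Proof. by rewrite /path_of/= mulr0 addr0 -surjective_pairing. Qed.

Lemma measurable_path_of c : measurable_fun setT (path_of c).
Proof.
have m21 : measurable_fun setT (fun p : R * (R * R) => p.2.1) by exact: measurableT_comp.
have m22 : measurable_fun setT (fun p : R * (R * R) => p.2.2) by exact: measurableT_comp.
apply/measurable_fun_pair => //=; apply: measurable_funD => //.
by apply: measurable_funM => //; exact: measurable_funB.
Qed.

Lemma measurable_shear_speed (c s : R) : measurable_fun setT (fun v : R => (v - c) * s).
Proof. by apply: measurable_funM => //; exact: measurable_funB. Qed.

Lemma ge0_integral_path (c s : R) (f : R * R -> \bar R) :
  measurable_fun setT f -> (forall x, 0 <= f x)%E ->
  (\int[mu2]_x f (path_of c (s, x)) = \int[mu2]_x f x)%E.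
Proof.
move=> mf f0; apply: (ge0_integral_shear f (fun v => (v - c) * s)) => //.
exact: measurable_shear_speed.
Qed.

Lemma measurable_fun_pair_r d1 d2 d3 (T1 : measurableType d1) (T2 : measurableType d2)
  (T3 : measurableType d3) (f : T1 * T2 -> T3) (x : T1) :
  measurable_fun setT f -> measurable_fun setT (fun y => f (x, y)).
Proof. by move=> mf; apply: measurableT_comp. Qed.

Lemma measurable_fun_pair_l d1 d2 d3 (T1 : measurableType d1) (T2 : measurableType d2)
  (T3 : measurableType d3) (f : T1 * T2 -> T3) (y : T2) :
  measurable_fun setT f -> measurable_fun setT (fun x => f (x, y)).
Proof. by move=> mf; apply: measurableT_comp. Qed.

Context (c wmax k : R) (W : set R) (P F G b sg : R -> R -> R) (K : R -> R) (PM : R).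
Context (u : R -> R -> R -> R) (u0 : R -> R -> R).

Context (mW : measurable W) (finW : (mu W < +oo)%E) (wmax0 : 0 < wmax)
  (Wc : forall v, W v -> `|v - c| < wmax).
Context (mP : measurable_fun setT (fun x : R * R => P x.1 x.2))
  (P0 : forall z v, 0 <= P z v) (PB : forall z v, P z v <= PM)
  (PW : forall z v, ~ W v -> P z v = 0).
Context (mK : measurable_fun setT K) (K0 : forall z, 0 <= K z <= k).
Context (mu_ : measurable_fun setT (fun p : R * (R * R) => u p.1 p.2.1 p.2.2))
  (uW : forall t z v, ~ W v -> u t z v = 0)
  (mu0 : measurable_fun setT (fun x : R * R => u0 x.1 x.2))
  (uloc : forall T L : R, (\int[mu]_(s in `[0%R, T]) \int[mu]_(z in `[(- L)%R, L])
     \int[mu]_v `|u s z v|%:E < +oo)%E).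

(** The right-hand side of the linearized equation, written with general
    coefficients P and K. *)
Definition ksource (s z v : R) : R :=
  P z v * (\int[mu]_v' u s z v') - K z * u s z v.

(** The properties of the characteristic starting at x that hold for almost
    every x and suffice to argue on it alone. *)
Definition char_good (t : R) (x : R * R) : Prop :=
  [/\ mu.-integrable `[0, t] (fun s => (ksource s (path_of c (s, x)).1 x.2)%:E),
    {ae mu, forall s, `[0, t]%classic s ->
       u s (path_of c (s, x)).1 x.2 = u0 x.1 x.2 +
         \int[mu]_(s' in `[0, s]) ksource s' (path_of c (s', x)).1 x.2} &
     u t (path_of c (t, x)).1 x.2 = u0 x.1 x.2 +
         \int[mu]_(s' in `[0, t]) ksource s' (path_of c (s', x)).1 x.2].

Context (mild : forall t, 0 <= t -> {ae mu2, forall x : R * R, W x.2 ->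
   u t x.1 x.2 = u0 (x.1 - (x.2 - c) * t) x.2 +
     \int[mu]_(s in `[0, t]) ksource s (x.1 - (x.2 - c) * (t - s)) x.2}).

Lemma measurable_average (f : R * (R * R) -> \bar R) : measurable_fun setT f ->
  measurable_fun setT (fun p : R * R => \int[mu]_v f (p.1, (p.2, v)))%E.
Proof.
move=> mf; apply: (@measurable_parametric_integral _ _ _ _ _ mu
  (fun q : (R * R) * R => f (q.1.1, (q.1.2, q.2)))).
apply: measurableT_comp => //; apply/measurable_fun_pair => /=.
  exact: measurableT_comp.
by apply/measurable_fun_pair => //=; exact: measurableT_comp.
Qed.

Lemma measurable_path_comp d (T : measurableType d) (f : R * (R * R) -> T) :
  measurable_fun setT f ->
  measurable_fun setT (fun p : R * (R * R) => f (p.1, path_of c p)).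
Proof.
move=> mf; apply: measurableT_comp => //; apply/measurable_fun_pair => //=.
exact: measurable_path_of.
Qed.

Lemma measurable_ksource :
  measurable_fun setT (fun p : R * (R * R) => ksource p.1 p.2.1 p.2.2).
Proof.
apply: measurable_funB; apply: measurable_funM => //.
- exact: (@measurableT_comp _ _ _ _ _ _ (fun x : R * R => P x.1 x.2) _ snd).
- rewrite (_ : (fun p => _) = (fun q : R * R => fine (\int[mu]_v (u q.1 q.2 v)%:E)%E) \o
    (fun p : R * (R * R) => (p.1, p.2.1)))//.
  apply: measurableT_comp.
    apply: measurableT_comp => //.
    apply: (measurable_average (fun p => (u p.1 p.2.1 p.2.2)%:E)).
    exact/measurable_EFinP.
  by apply/measurable_fun_pair => //=; exact: measurableT_comp.
- by apply: measurableT_comp => //; exact: measurableT_comp.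
Qed.

Lemma measurable_ksource_path :
  measurable_fun setT (fun p : R * (R * R) => ksource p.1 (path_of c p).1 p.2.2).
Proof. exact: (measurable_path_comp _ _ (fun p => ksource p.1 p.2.1 p.2.2) measurable_ksource). Qed.

Lemma measurable_u_path :
  measurable_fun setT (fun p : R * (R * R) => u p.1 (path_of c p).1 p.2.2).
Proof. exact: (measurable_path_comp _ _ (fun p => u p.1 p.2.1 p.2.2) mu_). Qed.

Lemma mild_along_characteristics (t : R) : 0 <= t ->
  {ae mu2, forall x, W x.2 -> u t (path_of c (t, x)).1 x.2 = u0 x.1 x.2 +
         \int[mu]_(s' in `[0, t]) ksource s' (path_of c (s', x)).1 x.2}.
Proof.
move=> t0; have := ae_shear _ _ (measurable_shear_speed c t) (mild t t0).
apply: ae_imp => x /= h Wx; rewrite h//= addrK; congr (_ + _).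
apply: eq_Rintegral => s _; congr (ksource _ _ _); rewrite /path_of/=; ring.
Qed.

(** The velocity average of |u| as an extended real, finite or not. *)
Definition average (s z : R) : \bar R := (\int[mu]_v `|u s z v|%:E)%E.

Lemma average_ge0 s z : (0 <= average s z)%E.
Proof. exact: integral_ge0. Qed.

Lemma measurable_average_u : measurable_fun setT (fun p : R * R => average p.1 p.2).
Proof.
apply: (measurable_average (fun p => `|u p.1 p.2.1 p.2.2|%:E)).
by apply/measurable_EFinP; exact: measurableT_comp.
Qed.

Lemma measurable_u_v s z : measurable_fun setT (fun v => u s z v).
Proof.
apply: (measurable_fun_pair_r _ _ _ _ _ _ (fun p : (R * R) * R => u p.1.1 p.1.2 p.2) (s, z)).
apply: (@measurableT_comp _ _ _ _ _ _ (fun p : R * (R * R) => u p.1 p.2.1 p.2.2) _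
  (fun p : (R * R) * R => (p.1.1, (p.1.2, p.2)))) => //.
apply/measurable_fun_pair => /=; first exact: measurableT_comp.
by apply/measurable_fun_pair => //=; exact: measurableT_comp.
Qed.

Lemma le_abs_fine (x : \bar R) : (`|fine x|%:E <= `|x|)%E.
Proof. by case: x => [x| |]//=; rewrite normr0 leey. Qed.

Lemma abs_Rintegral_average s z : (`|\int[mu]_v u s z v|%:E <= average s z)%E.
Proof.
apply: le_trans (le_abs_fine _) _; apply: le_abse_integral => //.
by apply/measurable_EFinP; exact: measurable_u_v.
Qed.

Lemma abs_ksource_le s z v :
  (`|ksource s z v|%:E <= (P z v)%:E * average s z + (k * `|u s z v|)%:E)%E.
Proof.
apply: (@le_trans _ _ ((P z v)%:E * `|\int[mu]_v' u s z v'|%:E + (k * `|u s z v|)%:E)%E).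
  rewrite -EFinM -EFinD lee_fin /ksource (le_trans (ler_normB _ _))//.
  rewrite !normrM (ger0_norm (P0 _ _)) lerD2l ler_wpM2r//.
  by have /andP[h1 h2] := K0 z; rewrite ger0_norm.
by rewrite leeD2r// lee_wpmul2l ?lee_fin//; exact: abs_Rintegral_average.
Qed.

Lemma ksource_out s z v : ~ W v -> ksource s z v = 0.
Proof. by move=> Wv; rewrite /ksource PW// uW// mul0r mulr0 subr0. Qed.

Lemma k_ge0 : 0 <= k.
Proof. by have /andP[h1 h2] := K0 0; exact: le_trans h2. Qed.

Lemma PM_ge0 : 0 <= PM.
Proof. exact: le_trans (P0 0 0) (PB 0 0). Qed.

Lemma integral_abs_ksource_le s z :
  (\int[mu]_v `|ksource s z v|%:E <= (PM * fine (mu W) + k)%:E * average s z)%E.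
Proof.
have mu1 : measurable_fun setT (fun v => `|u s z v|).
  by apply: measurableT_comp => //; exact: measurable_u_v.
apply: (@le_trans _ _ (\int[mu]_v ((PM * \1_W v)%:E * average s z + (k * `|u s z v|)%:E))%E).
  apply: ge0_le_integral => //.
  - apply/measurable_EFinP; apply: measurableT_comp => //.
    exact: (measurable_fun_pair_r _ _ _ _ _ _ _ _ (measurable_fun_pair_r _ _ _ _ _ _ _ s measurable_ksource)).
  - apply: emeasurable_funD.
      apply: emeasurable_funM => //; apply/measurable_EFinP; exact: measurable_funM.
    by apply/measurable_EFinP; exact: measurable_funM.
  move=> v _; have [Wv|Wv] := pselect (W v).
    apply: le_trans (abs_ksource_le _ _ _) _; rewrite leeD2r// lee_wpmul2r//.
      exact: average_ge0.
    by rewrite lee_fin indicE mem_set// mulr1.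
  by rewrite ksource_out// normr0 adde_ge0// ?mule_ge0// ?average_ge0// lee_fin mulr_ge0// ?k_ge0// PM_ge0.
rewrite ge0_integralD//; last 4 first.
- move=> v _; rewrite mule_ge0 ?average_ge0// lee_fin mulr_ge0 ?PM_ge0//.
- by apply: emeasurable_funM => //; apply/measurable_EFinP; exact: measurable_funM.
- by move=> v _; rewrite lee_fin mulr_ge0// k_ge0.
- by apply/measurable_EFinP; exact: measurable_funM.
rewrite ge0_integralZr//; last 3 first.
- by apply/measurable_EFinP; exact: measurable_funM.
- by move=> v _; rewrite lee_fin mulr_ge0 ?PM_ge0.
- exact: average_ge0.
have -> : ((PM * fine (mu W) + k)%:E * average s z =
   (PM * fine (mu W))%:E * average s z + k%:E * average s z)%E.
  by rewrite EFinD ge0_muleDl// lee_fin ?k_ge0// mulr_ge0 ?PM_ge0// fine_ge0.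
under eq_integral do rewrite EFinM.
rewrite ge0_integralZl//; last 2 first.
- exact/measurable_EFinP.
- by rewrite lee_fin PM_ge0.
rewrite integral_indic// setIT EFinM fineK ?ge0_fin_numE//.
rewrite leeD2l//.
under eq_integral do rewrite EFinM.
rewrite ge0_integralZl//; last 2 first.
- exact/measurable_EFinP.
- by rewrite lee_fin k_ge0.
Qed.

Lemma measurable_time_integral (a b' : R) (f : R * (R * R) -> \bar R) :
  measurable_fun setT f ->
  measurable_fun setT (fun x => \int[mu]_(s in `[a, b']) f (s, x))%E.
Proof.
move=> mf; under eq_fun do rewrite integral_mkcond.
apply: (@measurable_parametric_integral _ _ _ _ _ mu
  (fun q : (R * R) * R => ((fun s => f (s, q.1)) \_ `[a, b']) q.2)).
under eq_fun do rewrite patch_itvE.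
apply: measurable_fun_ifT => //.
  by apply: measurable_and; apply: measurable_fun_ler.
apply: (@measurableT_comp _ _ _ _ _ _ _ _ (fun q : (R * R) * R => (q.2, q.1)) mf).
exact/measurable_fun_pair.
Qed.

(** Transport preserves Lebesgue measure at each time, so that integrating a
    function along characteristics is integrating it over time and phase space. *)
Lemma Tonelli_path (t : R) (f : R * (R * R) -> \bar R) :
  measurable_fun setT f -> (forall p, 0 <= f p)%E ->
  (\int[mu2]_x \int[mu]_(s in `[0%R, t]) f (s, path_of c (s, x)) =
   \int[mu]_(s in `[0%R, t]) \int[mu2]_x f (s, x))%E.
Proof.
move=> mf f0.
pose g (p : R * (R * R)) := (if (0 <= p.1 <= t)%R then f (p.1, path_of c p) else 0)%E.
have mg : measurable_fun setT g.
  apply: measurable_fun_ifT => //.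
    by apply: measurable_and; apply: measurable_fun_ler.
  exact: measurable_path_comp.
have g0 p : (0 <= g p)%E by rewrite /g; case: ifP.
have := Tonelli_time_phase g mg g0.
rewrite (_ : (\int[mu2]_x \int[mu]_s g (s, x))%E =
  (\int[mu2]_x \int[mu]_(s in `[0%R, t]) f (s, path_of c (s, x)))%E); last first.
  apply: eq_integral => x _; rewrite [RHS]integral_mkcond.
  by apply: eq_integral => s _; rewrite patch_itvE.
move=> <-; rewrite [RHS]integral_mkcond; apply: eq_integral => s _.
rewrite patch_itvE /g /=; case: ifP => _; last by rewrite integral0_eq.
apply: (ge0_integral_path c s (fun x => f (s, x))) => //.
exact: measurable_fun_pair_r.
Qed.

Lemma path_in_slab (N t s : R) (x : R * R) : W x.2 -> 0 <= s <= t -> `|x.1| <= N ->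
  `|(path_of c (s, x)).1| <= N + wmax * t.
Proof.
move=> /Wc w /andP[s0 st] xN; rewrite /path_of/=.
rewrite (le_trans (ler_normD _ _))// lerD// normrM (ger0_norm s0).
by rewrite ler_pM// ltW.
Qed.

(** Speeds are bounded by wmax, hence characteristics starting in a bounded
    interval stay in a bounded interval up to time t, where u is integrable. *)
Lemma integral_slab_ksource_lty (N t : R) : 0 <= t ->
  (\int[mu2]_x ((\1_(`[- N, N] : set R) x.1)%:E *
     \int[mu]_(s in `[0%R, t]) `|ksource s (path_of c (s, x)).1 x.2|%:E) < +oo)%E.
Proof.
move=> t0; set L := N + wmax * t.
pose g (p : R * (R * R)) :=
  ((\1_(`[- L, L] : set R) p.2.1)%:E * `|ksource p.1 p.2.1 p.2.2|%:E)%E.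
have mks : measurable_fun setT (fun p : R * (R * R) => `|ksource p.1 p.2.1 p.2.2|%:E).
  by apply/measurable_EFinP; apply: measurableT_comp => //; exact: measurable_ksource.
have mg : measurable_fun setT g.
  apply: emeasurable_funM => //; apply/measurable_EFinP.
  apply: measurableT_comp; first exact: measurable_indic.
  exact: measurableT_comp.
have g0 p : (0 <= g p)%E by rewrite mule_ge0// lee_fin.
have mks2 : measurable_fun setT (fun p : R * (R * R) => `|ksource p.1 (path_of c p).1 p.2.2|%:E).
  by apply/measurable_EFinP; apply: measurableT_comp => //; exact: measurable_ksource_path.
have mint : measurable_fun setT (fun x : R * R =>
   \int[mu]_(s in `[0%R, t]) `|ksource s (path_of c (s, x)).1 x.2|%:E)%E.
  exact: (measurable_time_integral _ _ (fun p => `|ksource p.1 (path_of c p).1 p.2.2|%:E)).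
apply: (@le_lt_trans _ _ (\int[mu2]_x \int[mu]_(s in `[0%R, t]) g (s, path_of c (s, x)))%E).
  apply: ge0_le_integral => //.
  - by move=> x _; rewrite mule_ge0 ?lee_fin//; apply: integral_ge0.
  - apply: emeasurable_funM => //; apply/measurable_EFinP.
    by apply: measurableT_comp => //; exact: measurable_indic.
  - apply: (measurable_time_integral _ _ (fun p => g (p.1, path_of c p))).
    exact: measurable_path_comp.
  move=> x _; rewrite indicE; case: (boolP (x.1 \in _)) => [|_]; last first.
    by rewrite mul0e integral_ge0.
  rewrite inE/= in_itv/= -ler_norml => xN; rewrite mul1e.
  apply: ge0_le_integral => //.
  - apply: measurable_funTS.
    exact: (measurable_fun_pair_l _ _ _ _ _ _ _ x mks2).
  - apply: measurable_funTS.
    exact: (measurable_fun_pair_l _ _ _ _ _ _ _ x (measurable_path_comp _ _ g mg)).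
  move=> s /=; rewrite in_itv/= => st; rewrite /g/=.
  have [Wx|Wx] := pselect (W x.2); last by rewrite ksource_out// normr0 mule0.
  rewrite indicE mem_set ?mul1e//= in_itv/= -ler_norml.
  exact: path_in_slab.
rewrite Tonelli_path//.
have C0 : 0 <= PM * fine (mu W) + k by rewrite addr_ge0 ?k_ge0// mulr_ge0 ?PM_ge0// fine_ge0.
pose a s := (\int[mu]_(z in `[(- L)%R, L]) average s z)%E.
have ma : measurable_fun setT a.
  rewrite /a; under eq_fun do rewrite integral_mkcond.
  apply: (@measurable_parametric_integral _ _ _ _ _ mu
    (fun q : R * R => ((fun z => average q.1 z) \_ `[- L, L]) q.2)).
  under eq_fun do rewrite patch_itvE.
  apply: measurable_fun_ifT => //; last exact: measurable_average_u.
  by apply: measurable_and; apply: measurable_fun_ler.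
have a0 s : (0 <= a s)%E by apply: integral_ge0 => z _; exact: average_ge0.
apply: (@le_lt_trans _ _ (\int[mu]_(s in `[0%R, t]) ((PM * fine (mu W) + k)%:E * a s))%E).
  apply: ge0_le_integral => //.
  - by move=> s _; exact: integral_ge0.
  - apply: measurable_funTS.
    exact: (@measurable_parametric_integral _ _ _ _ _ mu2S g).
  - by apply: measurable_funTS; exact: emeasurable_funM.
  move=> s _; rewrite /g/=.
  have mgs : measurable_fun setT (fun x => g (s, x)) by exact: measurable_fun_pair_r.
  rewrite -[X in (X <= _)%E]/(\int[mu2]_x (fun x => g (s, x)) x)%E.
  rewrite integral_mu2E_vz//.
  rewrite /a -ge0_integralZl//; last 2 first.
  - apply: measurable_funTS; exact: (measurable_fun_pair_r _ _ _ _ _ _ _ s measurable_average_u).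
  - by move=> z _; exact: average_ge0.
  rewrite [leRHS]integral_mkcond; apply: ge0_le_integral => //.
  - by move=> z _; exact: integral_ge0.
  - exact: (@measurable_parametric_integral _ _ _ _ _ mu (fun x => g (s, x))).
  - apply/(measurable_restrictT _ _).1 => //; apply: measurable_funTS; apply: emeasurable_funM => //.
    exact: (measurable_fun_pair_r _ _ _ _ _ _ _ s measurable_average_u).
  move=> z _; rewrite patch_itvE /g/=.
  case: ifPn => zL.
    rewrite indicE mem_set/= ?in_itv//.
    by under eq_integral do rewrite mul1e; exact: integral_abs_ksource_le.
  rewrite indicE memNset/= ?in_itv//=; last exact/negP.
  by rewrite integral0_eq// => v _; rewrite mul0e.
rewrite ge0_integralZl//; last exact: measurable_funTS.
by rewrite lte_mul_pinfty ?lee_fin//; exact: uloc.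
Qed.

Lemma measurable_ksource_x (x : R * R) :
  measurable_fun setT (fun s => ksource s (path_of c (s, x)).1 x.2).
Proof. exact: (measurable_fun_pair_l _ _ _ _ _ _ _ x measurable_ksource_path). Qed.

Lemma ksource_integrable_ae (t : R) : 0 <= t -> {ae mu2, forall x,
  mu.-integrable `[0, t] (fun s => (ksource s (path_of c (s, x)).1 x.2)%:E)}.
Proof.
move=> t0.
pose Phi x := (\int[mu]_(s in `[0%R, t]) `|ksource s (path_of c (s, x)).1 x.2|%:E)%E.
have mPhi : measurable_fun setT Phi.
  apply: (measurable_time_integral _ _ (fun p => `|ksource p.1 (path_of c p).1 p.2.2|%:E)).
  by apply/measurable_EFinP; apply: measurableT_comp => //; exact: measurable_ksource_path.
have Phi0 x : (0 <= Phi x)%E by exact: integral_ge0.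
have h n : {ae mu2, forall x, `|x.1| <= n%:R -> (Phi x < +oo)%E}.
  pose g (x : R * R) := ((\1_(`[- n%:R, n%:R] : set R) x.1)%:E * Phi x)%E.
  have mg : measurable_fun setT g.
    apply: emeasurable_funM => //; apply/measurable_EFinP.
    by apply: measurableT_comp => //; exact: measurable_indic.
  have g0 x : (0 <= g x)%E by rewrite mule_ge0// lee_fin.
  have ig : mu2.-integrable setT g.
    apply/integrableP; split => //.
    under eq_integral do rewrite gee0_abs//.
    exact: integral_slab_ksource_lty.
  have := integrable_ae measurableT ig.
  apply: ae_imp => x /(_ I); rewrite ge0_fin_numE// => + xn.
  by rewrite /g indicE mem_set/= ?mul1e// in_itv/= -ler_norml.
have := ae_foralln h; apply: ae_imp => x hx.
apply/integrableP; split.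
  by apply/measurable_EFinP; apply: measurable_funTS; exact: measurable_ksource_x.
apply: (hx (Num.truncn `|x.1|).+1); rewrite ltW//.
by have /andP[] := truncn_itv (normr_ge0 x.1).
Qed.

(** Tonelli's theorem: the mild formulation holds at each time for almost every
    position, hence along almost every characteristic for almost every time. *)
Lemma char_good_ae (t : R) : 0 <= t -> {ae mu2, forall x, W x.2 -> char_good t x}.
Proof.
move=> t0.
pose I (p : R * (R * R)) :=
  \int[mu]_(s' in `[0, p.1]) ksource s' (path_of c (s', p.2)).1 p.2.2.
have mI : measurable_fun setT I.
  rewrite /I /Rintegral; apply: measurableT_comp => //.
  under eq_fun do rewrite integral_mkcond.
  apply: (@measurable_parametric_integral _ _ _ _ _ mu (fun q : (R * (R * R)) * R =>
    ((fun s' => (ksource s' (path_of c (s', q.1.2)).1 q.1.2.2)%:E) \_ `[0, q.1.1]) q.2)).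
  under eq_fun do rewrite patch_itvE.
  apply: measurable_fun_ifT => //.
    apply: measurable_and; apply: measurable_fun_ler => //.
    exact: measurableT_comp.
  apply/measurable_EFinP.
  apply: (@measurableT_comp _ _ _ _ _ _ _ _ (fun q : (R * (R * R)) * R => (q.2, q.1.2))
    measurable_ksource_path).
  by apply/measurable_fun_pair => //=; exact: measurableT_comp.
pose D (p : R * (R * R)) := \1_W p.2.2 * (\1_(`[0, t] : set R) p.1 *
  (u p.1 (path_of c p).1 p.2.2 - (u0 p.2.1 p.2.2 + I p))).
have mD : measurable_fun setT D.
  apply: measurable_funM.
    apply: measurableT_comp; first exact: measurable_indic.
    exact: measurableT_comp.
  apply: measurable_funM; first by apply: measurableT_comp => //; exact: measurable_indic.
  apply: measurable_funB; first exact: measurable_u_path.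
  apply: measurable_funD => //.
  exact: (@measurableT_comp _ _ _ _ _ _ (fun x : R * R => u0 x.1 x.2) _ snd).
have D0 s : {ae mu2S, forall x, D (s, x) = 0}.
  have [s0t|s0t] := boolP (0 <= s <= t); last first.
    have s0 : \1_(`[0, t] : set R) s = 0 :> R.
      by rewrite indicE memNset//= in_itv/=; exact/negP.
    by apply: aeW => x; rewrite /D/= s0 mul0r mulr0.
  have s0 : 0 <= s by case/andP : s0t.
  have := mild_along_characteristics s s0; apply: ae_imp => x hx.
  rewrite /D/= indicE; case: (boolP (x.2 \in W)) => [|_]; last by rewrite mul0r.
  by rewrite inE => /hx ->; rewrite /I/= subrr !mulr0.
have h1 := mild_along_characteristics t t0.
have h2 := ksource_integrable_ae t t0.
have h3 := @ae_swap _ _ _ _ _ mu mu2S D mD D0.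
have h12 := @ae_and _ _ _ mu2S _ _ h1 h2.
have := @ae_and _ _ _ mu2S _ _ h12 h3.
apply: ae_imp => x [[hx1 hx2] hx3] Wx; split => //; last exact: hx1.
apply: ae_imp hx3 => s; rewrite /D/= => + st.
rewrite !indicE !mem_set// !mul1r => /eqP; rewrite subr_eq0 => /eqP ->.
by [].
Qed.

(** The density of F over W, where F is positive everywhere. *)
Definition massF (z : R) : \bar R := (\int[mu]_v (F z v * \1_W v)%:E)%E.
Definition fluxG (z : R) : \bar R := (\int[mu]_v (P z v * G z v)%:E)%E.

Context (mF : measurable_fun setT (fun x : R * R => F x.1 x.2))
  (mG : measurable_fun setT (fun x : R * R => G x.1 x.2))
  (mb : measurable_fun setT (fun x : R * R => b x.1 x.2))
  (msg : measurable_fun setT (fun x : R * R => sg x.1 x.2))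
  (F0 : forall z v, 0 < F z v) (G0 : forall z v, 0 <= G z v)
  (b0 : forall z v, 0 <= b z v) (bK : forall z v, 2 * b z v <= k - K z)
  (sg0 : forall z v, 0 <= sg z v) (GW : forall z v, ~ W v -> G z v = 0)
  (u0W : forall z v, ~ W v -> u0 z v = 0).

Context (HF : forall y v t, W v -> 0 <= t ->
  ((F y v)%:E + \int[mu]_(s in `[0%R, t]) ((expR (k * s))%:E *
     ((P (path_of c (s, (y, v))).1 v)%:E * massF (path_of c (s, (y, v))).1 +
      ((k - K (path_of c (s, (y, v))).1 - b (path_of c (s, (y, v))).1 v) *
        F (path_of c (s, (y, v))).1 v)%:E)) <=
   (expR (k * t) * F (path_of c (t, (y, v))).1 v)%:E)%E).

Context (HG : forall y v s t, W v -> 0 <= s <= t ->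
  ((expR (- k * t) * G (path_of c (t, (y, v))).1 v)%:E +
   \int[mu]_(x in `[s, t]) ((expR (- k * x))%:E *
     ((fluxG (path_of c (x, (y, v))).1 +
        (sg (path_of c (x, (y, v))).1 v * G (path_of c (x, (y, v))).1 v)%:E) +
      ((k - K (path_of c (x, (y, v))).1 + 2 * b (path_of c (x, (y, v))).1 v) *
        G (path_of c (x, (y, v))).1 v)%:E)) <=
   (expR (- k * s) * G (path_of c (s, (y, v))).1 v)%:E)%E).

Context (fluxG_loc : forall L : R, exists C : R,
   forall z, `|z| <= L -> (fluxG z <= C%:E)%E).

Definition cutq (N s z v : R) : R := tsq N (F z v) (u s z v).
Definition massq (N s z : R) : \bar R := (\int[mu]_v (cutq N s z v)%:E)%E.

Lemma measurable_massF : measurable_fun setT massF.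
Proof.
apply: (@measurable_parametric_integral _ _ _ _ _ mu (fun x => (F x.1 x.2 * \1_W x.2)%:E)).
apply/measurable_EFinP; apply: measurable_funM => //.
by apply: measurableT_comp => //; exact: measurable_indic.
Qed.

Lemma measurable_fluxG : measurable_fun setT fluxG.
Proof.
apply: (@measurable_parametric_integral _ _ _ _ _ mu (fun x => (P x.1 x.2 * G x.1 x.2)%:E)).
by apply/measurable_EFinP; exact: measurable_funM.
Qed.

Lemma massF_ge0 z : (0 <= massF z)%E.
Proof. by apply: integral_ge0 => v _; rewrite lee_fin mulr_ge0// ltW. Qed.

Lemma fluxG_ge0 z : (0 <= fluxG z)%E.
Proof. by apply: integral_ge0 => v _; rewrite lee_fin mulr_ge0. Qed.

Lemma measurable_phase_comp d (T : measurableType d) (f : R * R -> T) :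
  measurable_fun setT f -> measurable_fun setT (fun p : R * (R * R) => f (path_of c p)).
Proof. by move=> mf; apply: measurableT_comp => //; exact: measurable_path_of. Qed.

Lemma measurable_along (f : R * R -> R) (x : R * R) : measurable_fun setT f ->
  measurable_fun setT (fun s => f (path_of c (s, x))).
Proof.
move=> mf; exact: (measurable_fun_pair_l _ _ _ _ _ _ _ x (measurable_phase_comp _ _ f mf)).
Qed.

Lemma measurable_cutq N : measurable_fun setT (fun p : R * (R * R) => cutq N p.1 p.2.1 p.2.2).
Proof.
apply: measurable_tsq => //.
exact: (@measurableT_comp _ _ _ _ _ _ (fun x : R * R => F x.1 x.2) _ snd).
Qed.

Lemma cutq_ge0 N s z v : 0 <= N -> 0 <= cutq N s z v.
Proof. by move=> N0; exact: tsq_ge0. Qed.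

Lemma cutq_out N s z v : 0 <= N -> ~ W v -> cutq N s z v = 0.
Proof.
move=> N0 Wv; apply/eqP; rewrite eq_le cutq_ge0// andbT.
by rewrite (le_trans (tsq_le_lin _ _ _ _ _))// uW// normr0 mulr0.
Qed.

Lemma massq_ge0 N s z : 0 <= N -> (0 <= massq N s z)%E.
Proof. by move=> N0; apply: integral_ge0 => v _; rewrite lee_fin cutq_ge0. Qed.

Lemma measurable_massq N : measurable_fun setT (fun p : R * R => massq N p.1 p.2).
Proof.
apply: (measurable_average (fun p => (cutq N p.1 p.2.1 p.2.2)%:E)).
by apply/measurable_EFinP; exact: measurable_cutq.
Qed.

Lemma measurable_cutq_v N s z : measurable_fun setT (fun v => cutq N s z v).
Proof.
have h : measurable_fun setT (fun x : R * R => cutq N s x.1 x.2).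
  exact: (measurable_fun_pair_r _ _ _ _ _ _ (fun p : R * (R * R) => cutq N p.1 p.2.1 p.2.2) s (measurable_cutq N)).
exact: (measurable_fun_pair_r _ _ _ _ _ _ _ z h).
Qed.

Lemma measurable_F_v z : measurable_fun setT (fun v => F z v).
Proof. exact: (measurable_fun_pair_r _ _ _ _ _ _ (fun x : R * R => F x.1 x.2) z). Qed.

(** The dual form of the Cauchy-Schwarz inequality rho_u^2 <= rho_q rho_F:
    integrate 2 a |u| - a^2 F <= q over velocities. *)
Lemma average_le_mass N s z a : 0 <= a <= N ->
  ((2 * a)%:E * average s z <= massq N s z + (a ^+ 2)%:E * massF z)%E.
Proof.
move=> aN; have a0 : 0 <= a by case/andP : aN.
have N0 : 0 <= N by case/andP : aN; exact: le_trans.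
have mFW : measurable_fun setT (fun v => (F z v * \1_W v)%:E).
  apply/measurable_EFinP; apply: measurable_funM; first exact: measurable_F_v.
  exact: measurable_indic.
have FW0 v : (0 <= (F z v * \1_W v)%:E)%E by rewrite lee_fin mulr_ge0// ltW.
have mcq : measurable_fun setT (fun v => (cutq N s z v)%:E).
  by apply/measurable_EFinP; exact: measurable_cutq_v.
have mun : measurable_fun setT (fun v => `|u s z v|%:E).
  by apply/measurable_EFinP; apply: measurableT_comp => //; exact: measurable_u_v.
rewrite /average /massq /massF -ge0_integralZl//; last by rewrite lee_fin mulr_ge0.
rewrite -ge0_integralZl//; last by rewrite lee_fin sqr_ge0.
rewrite -ge0_integralD//; last 3 first.
- by move=> v _; rewrite lee_fin cutq_ge0.
- by move=> v _; rewrite mule_ge0// lee_fin sqr_ge0.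
- exact: emeasurable_funM.
apply: ge0_le_integral => //.
- by move=> v _; rewrite mule_ge0// lee_fin mulr_ge0.
- exact: emeasurable_funM.
- by apply: emeasurable_funD => //; exact: emeasurable_funM.
move=> v _; rewrite -!EFinM -EFinD lee_fin.
have [Wv|Wv] := pselect (W v).
  rewrite indicE mem_set// mulr1.
  by have := tsq_ge N (F z v) (u s z v) a (F0 z v) aN; rewrite /cutq; lra.
rewrite uW// normr0 mulr0 addr_ge0// ?cutq_ge0//.
by rewrite mulr_ge0 ?sqr_ge0// mulr_ge0// ltW.
Qed.

Lemma measurable_average_path d (T : measurableType d) (x : R * R) (h : R * R -> T) :
  measurable_fun setT h -> measurable_fun setT (fun s => h (s, (path_of c (s, x)).1)).
Proof.
move=> mh; apply: measurableT_comp => //; apply/measurable_fun_pair => //=.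
rewrite /path_of/=; apply: measurable_funD => //; exact: measurable_funM.
Qed.

Lemma measurable_z_path (x : R * R) : measurable_fun setT (fun s => (path_of c (s, x)).1).
Proof. rewrite /path_of/=; apply: measurable_funD => //; exact: measurable_funM. Qed.

Lemma measurable_z_comp d (T : measurableType d) (x : R * R) (h : R -> T) :
  measurable_fun setT h -> measurable_fun setT (fun s => h (path_of c (s, x)).1).
Proof. by move=> mh; apply: measurableT_comp => //; exact: measurable_z_path. Qed.

Lemma measurable_u_x (x : R * R) : measurable_fun setT (fun s => u s (path_of c (s, x)).1 x.2).
Proof. exact: (measurable_fun_pair_l _ _ _ _ _ _ _ x measurable_u_path). Qed.

Lemma cutq_at (N t tau : R) (x : R * R) : 0 <= N -> W x.2 -> char_good t x ->
  0 <= tau <= t ->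
  u tau (path_of c (tau, x)).1 x.2 = u0 x.1 x.2 +
     \int[mu]_(s' in `[0, tau]) ksource s' (path_of c (s', x)).1 x.2 ->
  ((expR (k * tau) * cutq N tau (path_of c (tau, x)).1 x.2)%:E <=
   (tsq N (F x.1 x.2) (u0 x.1 x.2))%:E +
   \int[mu]_(s in `[0%R, tau]) ((expR (k * s))%:E *
     ((P (path_of c (s, x)).1 x.2)%:E * massq N s (path_of c (s, x)).1 +
      ((k - K (path_of c (s, x)).1 + 2 * b (path_of c (s, x)).1 x.2) *
        cutq N s (path_of c (s, x)).1 x.2)%:E)))%E.
Proof.
move=> N0 Wx [ig hae _] /andP[tau0 taut] hu.
pose z s := (path_of c (s, x)).1.
have mPx : measurable_fun setT (fun s => P (z s) x.2).
  exact: (measurable_along (fun p => P p.1 p.2)).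
have mFx : measurable_fun setT (fun s => F (z s) x.2).
  exact: (measurable_along (fun p => F p.1 p.2)).
have mbx : measurable_fun setT (fun s => b (z s) x.2).
  exact: (measurable_along (fun p => b p.1 p.2)).
have mUx := measurable_u_x x.
have mKx : measurable_fun setT (fun s => K (z s)) by exact: measurable_z_comp.
have mSx : measurable_fun setT (fun s => P (z s) x.2 * \int[mu]_v' u s (z s) v').
  apply: measurable_funM => //.
  apply: (measurable_average_path _ _ x (fun p => fine (\int[mu]_v' (u p.1 p.2 v')%:E)%E)).
  apply: measurableT_comp => //.
  apply: (measurable_average (fun p => (u p.1 p.2.1 p.2.2)%:E)).
  exact/measurable_EFinP.
have mhx : measurable_fun setT (fun s => (P (z s) x.2)%:E * average s (z s))%E.
  apply: emeasurable_funM; first exact/measurable_EFinP.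
  exact: (measurable_average_path _ _ x (fun p => average p.1 p.2) measurable_average_u).
have mhFx : measurable_fun setT (fun s => (P (z s) x.2)%:E * massF (z s))%E.
  apply: emeasurable_funM; first exact/measurable_EFinP.
  exact: (measurable_z_comp _ _ x massF measurable_massF).
have mhqx : measurable_fun setT (fun s => (P (z s) x.2)%:E * massq N s (z s))%E.
  apply: emeasurable_funM; first exact/measurable_EFinP.
  exact: (measurable_average_path _ _ x (fun p => massq N p.1 p.2) (measurable_massq N)).
have Fx0 : F x.1 x.2 = F (z 0) x.2 by rewrite /z path_of0.
rewrite Fx0.
apply: (tsq_duhamel k tau N (u0 x.1 x.2) (fun s => u s (z s) x.2) (fun s => F (z s) x.2)
  (fun s => k - K (z s)) (fun s => b (z s) x.2)
  (fun s => (P (z s) x.2)%:E * average s (z s))%E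
  (fun s => (P (z s) x.2)%:E * massF (z s))%E
  (fun s => (P (z s) x.2)%:E * massq N s (z s))%E) => //.
- exact: measurable_funB.
- by move=> s; rewrite mule_ge0 ?lee_fin// average_ge0.
- by move=> s; rewrite mule_ge0 ?lee_fin// massF_ge0.
- by move=> s; rewrite mule_ge0 ?lee_fin// massq_ge0.
- move=> s a aN; rewrite muleCA [X in (_ <= _ + X)%E]muleCA -ge0_muleDr ?massq_ge0//.
    by rewrite lee_wpmul2l ?lee_fin//; exact: average_le_mass.
  by rewrite mule_ge0 ?massF_ge0// lee_fin sqr_ge0.
- apply: (duhamel_le k tau (u0 x.1 x.2) (fun s => u s (z s) x.2)
    (fun s => P (z s) x.2 * \int[mu]_v' u s (z s) v') (fun s => K (z s))) => //.
  + move=> s; rewrite normrM (ger0_norm (P0 _ _)) EFinM lee_wpmul2l ?lee_fin//.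
    exact: abs_Rintegral_average.
  + apply: integrableS ig => // s /=; rewrite !in_itv/= => /andP[-> /= h].
    exact: le_trans taut.
  + apply: ae_imp hae => s h; rewrite /= in_itv/= => /andP[s0 st]; apply: h.
    by rewrite /= in_itv/= s0 (le_trans st).
- have := HF x.1 x.2 tau Wx tau0.
  by rewrite -surjective_pairing -Fx0.
Qed.

(** The indicator function of the backward light cone: it is nonincreasing in
    time along every characteristic, because speeds are less than wmax. *)
Definition chi (L s z : R) : R := if `|z| <= L - wmax * s then 1 else 0.

Lemma chi_ge0 L s z : 0 <= chi L s z.
Proof. by rewrite /chi; case: ifP. Qed.

Lemma measurable_chi L : measurable_fun setT (fun p : R * R => chi L p.1 p.2).
Proof.
apply: measurable_fun_ifT => //; apply: measurable_fun_ler.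
  exact: measurableT_comp.
by apply: measurable_funB => //; exact: measurable_funM.
Qed.

(** On a characteristic the cone is left at a single time, which is nonnegative
    exactly when the starting point lies inside. *)
Lemma chi_path L s (x : R * R) : W x.2 ->
  (`|(path_of c (s, x)).1| <= L - wmax * s) =
  (s <= Num.min ((L - x.1) / ((x.2 - c) + wmax)) ((L + x.1) / (wmax - (x.2 - c)))).
Proof.
move=> /Wc; rewrite ltr_norml => /andP[w1 w2].
rewrite le_min ler_pdivlMr; last by lra.
rewrite ler_pdivlMr; last by lra.
rewrite ler_norml /path_of/=; apply/andP/andP => -[h1 h2]; split; lra.
Qed.

(** The energy balance holds up to the exit time of the light cone, and the
    cut-off vanishes afterwards. *)
Lemma char_energy_cut N L t (x : R * R) : 0 <= N -> 0 <= t -> W x.2 -> char_good t x ->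
  ((chi L t (path_of c (t, x)).1 * (cutq N t (path_of c (t, x)).1 x.2 *
      G (path_of c (t, x)).1 x.2))%:E +
   \int[mu]_(s in `[0%R, t]) ((chi L s (path_of c (s, x)).1)%:E *
      ((cutq N s (path_of c (s, x)).1 x.2)%:E * (fluxG (path_of c (s, x)).1 +
        (sg (path_of c (s, x)).1 x.2 * G (path_of c (s, x)).1 x.2)%:E))) <=
   (tsq N (F x.1 x.2) (u0 x.1 x.2) * G x.1 x.2)%:E +
   \int[mu]_(s in `[0%R, t]) ((chi L s (path_of c (s, x)).1)%:E *
      (((P (path_of c (s, x)).1 x.2)%:E * massq N s (path_of c (s, x)).1) *
       (G (path_of c (s, x)).1 x.2)%:E)))%E.
Proof.
move=> N0 t0 Wx good; have [ig hae ht] := good.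
pose z s := (path_of c (s, x)).1.
pose ts := Num.min ((L - x.1) / ((x.2 - c) + wmax)) ((L + x.1) / (wmax - (x.2 - c))).
pose T := Num.min t ts.
have chiE s : chi L s (z s) = if s <= ts then 1 else 0 by rewrite /chi chi_path.
have mchix : measurable_fun setT (fun s => (chi L s (z s))%:E).
  apply/measurable_EFinP.
  exact: (@measurableT_comp _ _ _ _ _ _ (fun p : R * R => chi L p.1 p.2) _ (fun s => (s, z s))
    (measurable_chi L) (measurable_fun_pair (@measurable_id _ _ _) (measurable_z_path x))).
have intE (f : R -> \bar R) : (\int[mu]_(s in `[0%R, t]) ((chi L s (z s))%:E * f s) =
    \int[mu]_(s in `[0%R, T]) f s)%E.
  rewrite integral_mkcond [RHS]integral_mkcond; apply: eq_integral => s _.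
  rewrite !patch_itvE chiE /T; have -> : (s <= Num.min t ts) = (s <= t) && (s <= ts) by rewrite le_min.
  by case: (0 <= s); case: (s <= t); case: (s <= ts) => /=; rewrite ?mul1e ?mul0e.
have zE s : (path_of c (s, x)).1 = z s by [].
rewrite !zE !intE.
pose q s := cutq N s (z s) x.2.
pose Gx s := G (z s) x.2.
pose B s := k - K (z s) + 2 * b (z s) x.2.
pose n s := (fluxG (z s) + (sg (z s) x.2 * G (z s) x.2)%:E)%E.
pose hq s := ((P (z s) x.2)%:E * massq N s (z s))%E.
have mq : measurable_fun setT q.
  exact: (measurable_fun_pair_l _ _ _ _ _ _ _ x
    (measurable_path_comp _ _ (fun p => cutq N p.1 p.2.1 p.2.2) (measurable_cutq N))).
have mGx : measurable_fun setT Gx by exact: (measurable_along (fun p => G p.1 p.2)).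
have mB : measurable_fun setT B.
  apply: measurable_funD.
    by apply: measurable_funB => //; exact: measurable_z_comp.
  by apply: measurable_funM => //; exact: (measurable_along (fun p => b p.1 p.2)).
have mn : measurable_fun setT n.
  apply: emeasurable_funD; first exact: (measurable_z_comp _ _ x fluxG measurable_fluxG).
  apply/measurable_EFinP; apply: measurable_funM => //.
  exact: (measurable_along (fun p => sg p.1 p.2)).
have mhq : measurable_fun setT hq.
  apply: emeasurable_funM.
    by apply/measurable_EFinP; exact: (measurable_along (fun p => P p.1 p.2)).
  exact: (measurable_average_path _ _ x (fun p => massq N p.1 p.2) (measurable_massq N)).
have q_ge0 s : 0 <= q s by exact: cutq_ge0.
have kK s : 0 <= k - K (z s) by rewrite subr_ge0; have /andP[] := K0 (z s).
have B_ge0 s : 0 <= B s by rewrite addr_ge0// mulr_ge0.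
have n_ge0 s : (0 <= n s)%E by rewrite adde_ge0 ?fluxG_ge0// lee_fin mulr_ge0.
have hq_ge0 s : (0 <= hq s)%E by rewrite mule_ge0 ?lee_fin// massq_ge0.
have q00 : 0 <= tsq N (F x.1 x.2) (u0 x.1 x.2) by exact: tsq_ge0.
have G00 : G x.1 x.2 = Gx 0 by rewrite /Gx/= /z path_of0.
have [T0|T0] := ltP T 0.
  have tsl : (t <= ts) = false.
    by apply/negbTE; rewrite -ltNge; move: T0; rewrite /T gt_min => /orP[]; [lra|move/lt_le_trans; apply].
  rewrite set_itv_ge -?ltNge ?bnd_simp// !integral_set0 chiE tsl mul0r !adde0 lee_fin.
  by rewrite mulr_ge0.
have HQ : {ae mu, forall y, `[0, T]%classic y ->
    ((expR (k * y) * q y)%:E <= (tsq N (F x.1 x.2) (u0 x.1 x.2))%:E +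
       \int[mu]_(s in `[0%R, y]) ((expR (k * s))%:E * (hq s + (B s * q s)%:E)))%E}.
  apply: ae_imp hae => s hs; rewrite /= in_itv/= /T le_min => /and3P[s0 st _].
  apply: (cutq_at N t s x) => //; first by rewrite s0.
  by apply: hs; rewrite /= in_itv/= s0.
have HGx s : 0 <= s <= T ->
    ((expR (- k * T) * Gx T)%:E +
       \int[mu]_(y in `[s, T]) ((expR (- k * y))%:E * (n y + (B y * Gx y)%:E))
     <= (expR (- k * s) * Gx s)%:E)%E.
  by move=> sT; have := HG x.1 x.2 s T Wx sT; rewrite -surjective_pairing.
have Gs s : 0 <= s <= T -> Gx s <= expR (k * t) * Gx 0.
  move=> /andP[s0 sT].
  have := HG x.1 x.2 0 s Wx; rewrite lexx s0 -surjective_pairing -/z => /(_ isT).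
  have st : s <= t by move: sT; rewrite /T le_min => /andP[].
  rewrite mulr0 expR0 mul1r => h.
  have {}h : expR (- k * s) * Gx s <= Gx 0.
    rewrite -lee_fin; apply: le_trans h; rewrite leeDl//; apply: integral_ge0 => y _.
    by rewrite mule_ge0 ?lee_fin ?expR_ge0// adde_ge0 ?n_ge0// lee_fin mulr_ge0//; exact: B_ge0.
  have -> : Gx s = expR (k * s) * (expR (- k * s) * Gx s).
    by rewrite mulrA -expRD mulNr addrN expR0 mul1r.
  apply: ler_pM => //; rewrite ?expR_ge0 ?mulr_ge0 ?expR_ge0//; first exact: G0.
  by rewrite ler_expR ler_wpM2l// k_ge0.
have iU : mu.-integrable `[0, t] (EFin \o (fun s => u s (z s) x.2)).
  apply: (duhamel k t (u0 x.1 x.2) _ (fun s => ksource s (z s) x.2) t0 ig _ hae ht).1.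
  by apply: measurable_funTS; exact: measurable_u_x.
have fin : (\int[mu]_(s in `[0%R, T]) (q s * (B s * Gx s))%:E < +oo)%E.
  pose C := 2 * N * (2 * k * (expR (k * t) * Gx 0)).
  have mI : measurable (`[0, t]%classic : set (measurableTypeR R)) by exact: measurable_itv.
  have /integrableP[_] := integrableZl mI C (integrable_norm iU).
  apply: le_lt_trans.
  apply: (@le_trans _ _ (\int[mu]_(s in `[0%R, T]) `|C%:E * (`|u s (z s) x.2|%R)%:E|)%E).
    apply: ge0_le_integral => //.
    - by move=> s _; rewrite lee_fin mulr_ge0// mulr_ge0//; exact: G0.
    - by apply: measurable_funTS; apply/measurable_EFinP; do !apply: measurable_funM.
    - apply: measurable_funTS; apply: measurableT_comp => //; apply/measurable_EFinP.
      by apply: measurable_funM => //; apply: measurableT_comp => //; exact: measurable_u_x.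
    move=> s /=; rewrite in_itv/= => sT; rewrite lee_fin.
    rewrite (le_trans _ (ler_norm _))// /C mulrAC.
    apply: ler_pM => //; first by rewrite mulr_ge0//; exact: G0.
      exact: tsq_le_lin.
    apply: ler_pM => //; first exact: G0.
      rewrite /B; have := bK (z s) x.2; have /andP[k1 _] := K0 (z s); lra.
    exact: Gs.
  apply: ge0_subset_integral => //.
    apply: measurable_funTS; apply: measurableT_comp => //; apply/measurable_EFinP.
    by apply: measurable_funM => //; apply: measurableT_comp => //; exact: measurable_u_x.
  by move=> s /=; rewrite !in_itv/= /T le_min => /and3P[-> -> _].
have CE := char_energy k T _ q B Gx hq n T0 q00 mq mB mGx mhq mn q_ge0 B_ge0
  (fun s => G0 (z s) x.2) hq_ge0 n_ge0 HQ HGx fin.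
rewrite G00; apply: le_trans CE; rewrite [leLHS]addeC; apply: leeD => //.
rewrite chiE; case: ifPn => [tts|_]; last first.
  rewrite mul0r mule_ge0 ?lee_fin ?mulr_ge0 ?expR_ge0//; first exact: G0.
  rewrite adde_ge0 ?lee_fin//; apply: integral_ge0 => s _.
  by rewrite mule_ge0 ?lee_fin ?expR_ge0// adde_ge0// lee_fin mulr_ge0.
have Tt : T = t by rewrite /T min_l.
rewrite mul1r Tt.
have tt' : 0 <= t <= t by rewrite t0 lexx.
have h := cutq_at N t t x N0 Wx good tt' ht.
have eG : (0 <= (expR (- k * t) * Gx t)%:E)%E by rewrite lee_fin mulr_ge0 ?expR_ge0//; exact: G0.
apply: le_trans (lee_wpmul2l eG h).
rewrite -EFinM lee_fin (_ : _ * _ * (_ * _) = (expR (- k * t) * expR (k * t)) *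
  (cutq N t (z t) x.2 * G (z t) x.2)); last by rewrite /Gx; ring.
by rewrite -expRD mulNr addNr expR0 mul1r.
Qed.

Lemma measurable_phase2 d (T : measurableType d) (f : R * R -> T) : measurable_fun setT f ->
  measurable_fun setT (fun p : R * (R * R) => f p.2).
Proof. by move=> mf; apply: measurableT_comp. Qed.

Lemma measurable_time_z d (T : measurableType d) (f : R * R -> T) : measurable_fun setT f ->
  measurable_fun setT (fun p : R * (R * R) => f (p.1, p.2.1)).
Proof.
move=> mf; apply: measurableT_comp => //; apply/measurable_fun_pair => //=.
exact: measurableT_comp.
Qed.

Lemma measurable_space_z d (T : measurableType d) (f : R -> T) : measurable_fun setT f ->
  measurable_fun setT (fun p : R * (R * R) => f p.2.1).
Proof. by move=> mf; apply: measurableT_comp => //; exact: measurableT_comp. Qed.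

(** Integrate the balance over all characteristics.  The gain term, P rho_q
    against G, becomes the flux int P G against q after Tonelli's theorem in the
    velocities, and cancels the corresponding part of the loss; inside the cone
    both are finite. *)
Lemma truncated_energy N L t : 0 <= N -> 0 <= t ->
  (\int[mu2]_x (chi L t x.1 * (cutq N t x.1 x.2 * G x.1 x.2))%:E +
   \int[mu]_(s in `[0%R, t]) \int[mu2]_x
      (chi L s x.1 * (cutq N s x.1 x.2 * (sg x.1 x.2 * G x.1 x.2)))%:E <=
   \int[mu2]_x (tsq N (F x.1 x.2) (u0 x.1 x.2) * G x.1 x.2)%:E)%E.
Proof.
move=> N0 t0.
pose A1 (x : R * R) := (chi L t x.1 * (cutq N t x.1 x.2 * G x.1 x.2))%:E.
pose A2 (p : R * (R * R)) := ((chi L p.1 p.2.1)%:E * ((cutq N p.1 p.2.1 p.2.2)%:E * fluxG p.2.1))%E.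
pose A3 (p : R * (R * R)) :=
  (chi L p.1 p.2.1 * (cutq N p.1 p.2.1 p.2.2 * (sg p.2.1 p.2.2 * G p.2.1 p.2.2)))%:E.
pose A4 (p : R * (R * R)) := ((chi L p.1 p.2.1)%:E * (((P p.2.1 p.2.2)%:E * massq N p.1 p.2.1)
  * (G p.2.1 p.2.2)%:E))%E.
pose Q0 (x : R * R) := (tsq N (F x.1 x.2) (u0 x.1 x.2) * G x.1 x.2)%:E.
have mchi3 := measurable_time_z _ _ (fun p => chi L p.1 p.2) (measurable_chi L).
have mq3 := measurable_cutq N.
have mG3 := measurable_phase2 _ _ (fun x => G x.1 x.2) mG.
have mP3 := measurable_phase2 _ _ (fun x => P x.1 x.2) mP.
have msg3 := measurable_phase2 _ _ (fun x => sg x.1 x.2) msg.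
have mflux3 := measurable_space_z _ _ fluxG measurable_fluxG.
have mmass3 := measurable_time_z _ _ (fun p => massq N p.1 p.2) (measurable_massq N).
have q_ge0 s z v : 0 <= cutq N s z v by exact: cutq_ge0.
have chi_0 := chi_ge0.
have mA1 : measurable_fun setT A1.
  apply/measurable_EFinP.
  apply: (measurable_fun_pair_r _ _ _ _ _ _ (fun p : R * (R * R) =>
    chi L p.1 p.2.1 * (cutq N p.1 p.2.1 p.2.2 * G p.2.1 p.2.2)) t).
  by apply: measurable_funM => //; exact: measurable_funM.
have mA2 : measurable_fun setT A2.
  apply: emeasurable_funM; first exact/measurable_EFinP.
  by apply: emeasurable_funM => //; exact/measurable_EFinP.
have mA3 : measurable_fun setT A3.
  apply/measurable_EFinP; apply: measurable_funM => //; apply: measurable_funM => //.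
  exact: measurable_funM.
have mA4 : measurable_fun setT A4.
  apply: emeasurable_funM; first exact/measurable_EFinP.
  apply: emeasurable_funM; last exact/measurable_EFinP.
  by apply: emeasurable_funM => //; exact/measurable_EFinP.
have mQ0 : measurable_fun setT Q0.
  by apply/measurable_EFinP; apply: measurable_funM => //; exact: measurable_tsq.
have A1_ge0 x : (0 <= A1 x)%E by rewrite lee_fin !mulr_ge0.
have A2_ge0 p : (0 <= A2 p)%E by rewrite !mule_ge0 ?lee_fin// fluxG_ge0.
have A3_ge0 p : (0 <= A3 p)%E by rewrite lee_fin !mulr_ge0.
have A4_ge0 p : (0 <= A4 p)%E by rewrite !mule_ge0 ?lee_fin// massq_ge0.
have Q0_ge0 x : (0 <= Q0 x)%E by rewrite lee_fin mulr_ge0// tsq_ge0.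
have mu2D (f g : R * R -> \bar R) : measurable_fun setT f -> measurable_fun setT g ->
    (forall x, 0 <= f x)%E -> (forall x, 0 <= g x)%E ->
    (\int[mu2]_x (f x + g x) = \int[mu2]_x f x + \int[mu2]_x g x)%E.
  by move=> mf mg f0 g0; rewrite ge0_integralD.
have A2E s : (\int[mu2]_x A2 (s, x) = \int[mu]_z ((chi L s z)%:E * (massq N s z * fluxG z)))%E.
  rewrite (integral_mu2E_vz (fun x => A2 (s, x)))//; last exact: measurable_fun_pair_r.
  apply: eq_integral => z _; rewrite /A2/=.
  rewrite ge0_integralZl ?lee_fin//.
  - congr (_ * _)%E; rewrite ge0_integralZr ?fluxG_ge0//.
    + by apply/measurable_EFinP; exact: measurable_cutq_v.
    + by move=> v _; rewrite lee_fin.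
  - apply: emeasurable_funM => //; apply/measurable_EFinP; exact: measurable_cutq_v.
  - by move=> v _; rewrite mule_ge0 ?lee_fin// fluxG_ge0.
have A24 s : (\int[mu2]_x A2 (s, x) = \int[mu2]_x A4 (s, x))%E.
  rewrite A2E (integral_mu2E_vz (fun x => A4 (s, x)))//; last exact: measurable_fun_pair_r.
  apply: eq_integral => z _; rewrite /A4/=.
  under eq_integral => v _ do rewrite [X in (_ * X)%E]muleAC -EFinM [X in (_ * X)%E]muleC muleA.
  rewrite ge0_integralZl ?mule_ge0 ?lee_fin ?massq_ge0//; first by rewrite muleA.
  - apply/measurable_EFinP; apply: measurable_funM.
      exact: (measurable_fun_pair_r _ _ _ _ _ _ (fun x : R * R => P x.1 x.2) z).
    exact: (measurable_fun_pair_r _ _ _ _ _ _ (fun x : R * R => G x.1 x.2) z).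
  - by move=> v _; rewrite lee_fin mulr_ge0.
have massq_le s z : (massq N s z <= (2 * N)%:E * average s z)%E.
  rewrite /average -ge0_integralZl//; last 2 first.
  - by apply/measurable_EFinP; apply: measurableT_comp => //; exact: measurable_u_v.
  - by rewrite lee_fin mulr_ge0.
  apply: ge0_le_integral => //.
  - by move=> v _; rewrite lee_fin.
  - by apply/measurable_EFinP; exact: measurable_cutq_v.
  - apply: emeasurable_funM => //; apply/measurable_EFinP.
    by apply: measurableT_comp => //; exact: measurable_u_v.
  - by move=> v _; rewrite -EFinM lee_fin; exact: tsq_le_lin.
have mxA (A : R * (R * R) -> \bar R) : measurable_fun setT A ->
    measurable_fun setT (fun s => \int[mu2]_x A (s, x))%E.
  by move=> mA; exact: (@measurable_parametric_integral _ _ _ _ _ mu2S A).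
have Xfin : (\int[mu]_(s in `[0%R, t]) \int[mu2]_x A2 (s, x) < +oo)%E.
  have [C hC] := fluxG_loc L.
  pose C' := 2 * N * Num.max C 0.
  have C'0 : 0 <= C' by rewrite !mulr_ge0// le_max lexx orbT.
  pose a s := (\int[mu]_(z in `[(- L)%R, L]) average s z)%E.
  have ma : measurable_fun setT a.
    rewrite /a; under eq_fun do rewrite integral_mkcond.
    apply: (@measurable_parametric_integral _ _ _ _ _ mu
      (fun q : R * R => ((fun z => average q.1 z) \_ `[- L, L]) q.2)).
    under eq_fun do rewrite patch_itvE.
    apply: measurable_fun_ifT => //; last exact: measurable_average_u.
    by apply: measurable_and; apply: measurable_fun_ler.
  have a0 s : (0 <= a s)%E by apply: integral_ge0 => z _; exact: average_ge0.
  apply: (@le_lt_trans _ _ (\int[mu]_(s in `[0%R, t]) (C'%:E * a s))%E); last first.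
    rewrite ge0_integralZl//; last exact: measurable_funTS.
    by rewrite lte_mul_pinfty ?lee_fin//; exact: uloc.
  apply: ge0_le_integral => //.
  - by move=> s _; exact: integral_ge0.
  - by apply: measurable_funTS; exact: mxA.
  - by apply: measurable_funTS; exact: emeasurable_funM.
  move=> s /=; rewrite in_itv/= => /andP[s0 st].
  have mav : measurable_fun setT (average s).
    exact: (measurable_fun_pair_r _ _ _ _ _ _ _ s measurable_average_u).
  rewrite A2E /a -ge0_integralZl//; last 2 first.
  - exact: measurable_funTS.
  - by move=> z _; exact: average_ge0.
  rewrite [leRHS]integral_mkcond; apply: ge0_le_integral => //.
  - by move=> z _; rewrite !mule_ge0 ?lee_fin ?massq_ge0 ?fluxG_ge0.
  - apply: emeasurable_funM.
      apply/measurable_EFinP.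
      exact: (measurable_fun_pair_r _ _ _ _ _ _ _ s (measurable_chi L)).
    apply: emeasurable_funM; last exact: measurable_fluxG.
    exact: (measurable_fun_pair_r _ _ _ _ _ _ _ s (measurable_massq N)).
  - apply/(measurable_restrictT _ _).1 => //; apply: measurable_funTS.
    exact: emeasurable_funM.
  move=> z _; rewrite patch_itvE /chi.
  case: ifPn => zs; last by rewrite mul0e; case: ifP => // _; rewrite mule_ge0 ?lee_fin// average_ge0.
  have zL : `|z| <= L by rewrite (le_trans zs)// gerBl mulr_ge0// ltW.
  rewrite -ler_norml zL mul1e /C' EFinM muleAC.
  apply: lee_pmul => //; [exact: massq_ge0|exact: fluxG_ge0|].
  by apply: le_trans (hC _ zL) _; rewrite lee_fin le_max lexx.
have A2fin : (\int[mu]_(s in `[0%R, t]) \int[mu2]_x A2 (s, x))%E \is a fin_num.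
  rewrite ge0_fin_numE//; apply: integral_ge0 => s _; exact: integral_ge0.
rewrite -(leeD2rE _ _ A2fin).
have mpath (A : R * (R * R) -> \bar R) : measurable_fun setT A ->
    measurable_fun setT (fun p => A (p.1, path_of c p)).
  exact: measurable_path_comp.
have mA23 : measurable_fun setT (fun p => A2 p + A3 p)%E by exact: emeasurable_funD.
have -> : (\int[mu2]_x (tsq N (F x.1 x.2) (u0 x.1 x.2) * G x.1 x.2)%:E +
    \int[mu]_(s in `[0%R, t]) \int[mu2]_x A2 (s, x) =
  \int[mu2]_x (Q0 x + \int[mu]_(s in `[0%R, t]) A4 (s, path_of c (s, x))))%E.
  rewrite [RHS]ge0_integralD//; last 2 first.
  - by move=> x _; exact: integral_ge0.
  - exact: (measurable_time_integral _ _ (fun p => A4 (p.1, path_of c p)) (mpath _ mA4)).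
  congr (_ + _)%E; apply: etrans (esym (Tonelli_path t A4 mA4 A4_ge0)).
  by apply: eq_integral => s _; exact: A24.
have -> : (\int[mu2]_x (chi L t x.1 * (cutq N t x.1 x.2 * G x.1 x.2))%:E +
    \int[mu]_(s in `[0%R, t]) \int[mu2]_x
      (chi L s x.1 * (cutq N s x.1 x.2 * (sg x.1 x.2 * G x.1 x.2)))%:E +
    \int[mu]_(s in `[0%R, t]) \int[mu2]_x A2 (s, x) =
  \int[mu2]_x (A1 (path_of c (t, x)) +
    \int[mu]_(s in `[0%R, t]) (A2 (s, path_of c (s, x)) + A3 (s, path_of c (s, x)))))%E.
  rewrite [RHS]ge0_integralD//; last 3 first.
  - exact: (measurable_fun_pair_r _ _ _ _ _ _ _ t (measurable_phase_comp _ _ A1 mA1)).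
  - by move=> x _; apply: integral_ge0 => s _; exact: adde_ge0.
  - exact: (measurable_time_integral _ _ _ (mpath _ mA23)).
  have e1 := ge0_integral_path c t A1 mA1 A1_ge0.
  have e2 := Tonelli_path t (fun p => A2 p + A3 p)%E mA23 (fun p => adde_ge0 (A2_ge0 p) (A3_ge0 p)).
  rewrite -[LHS]addeA; congr (_ + _)%E; first exact: esym e1.
  apply: etrans (esym e2); rewrite [LHS]addeC -ge0_integralD//; last 4 first.
  - by move=> s _; apply: integral_ge0 => x _; exact: A2_ge0.
  - by apply: measurable_funTS; exact: (mxA A2 mA2).
  - by move=> s _; apply: integral_ge0 => x _; exact: (A3_ge0 (s, x)).
  - by apply: measurable_funTS; exact: (mxA A3 mA3).
  apply: eq_integral => s _; apply/esym.
  exact: (mu2D (fun x => A2 (s, x)) (fun x => A3 (s, x)) (measurable_fun_pair_r _ _ _ _ _ _ _ s mA2)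
    (measurable_fun_pair_r _ _ _ _ _ _ _ s mA3) (fun x => A2_ge0 (s, x)) (fun x => A3_ge0 (s, x))).
apply: ae_ge0_le_integral => //.
- by move=> x _; rewrite adde_ge0//; apply: integral_ge0 => s _; exact: adde_ge0.
- apply: emeasurable_funD.
    exact: (measurable_fun_pair_r _ _ _ _ _ _ _ t (measurable_phase_comp _ _ A1 mA1)).
  exact: (measurable_time_integral _ _ _ (mpath _ mA23)).
- by move=> x _; rewrite adde_ge0//; exact: integral_ge0.
- apply: emeasurable_funD => //.
  exact: (measurable_time_integral _ _ (fun p => A4 (p.1, path_of c p)) (mpath _ mA4)).
have := char_good_ae t t0; apply: ae_imp => x hx _.
have [Wx|Wx] := pselect (W x.2); last first.
  rewrite /A1/= cutq_out// mul0r mulr0 add0e integral0_eq//; last first.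
    by move=> s _; rewrite /A2 /A3/= cutq_out// !mul0r mul0e mulr0 mule0 adde0.
  by rewrite adde_ge0//; exact: integral_ge0.
have := char_energy_cut N L t x N0 t0 Wx (hx Wx).
apply: le_trans; rewrite leeD2l//.
rewrite le_eqVlt; apply/orP; left; apply/eqP.
apply: eq_integral => s _; rewrite /A2 /A3/=.
rewrite [in RHS](ge0_muleDr _ (fluxG_ge0 _)) ?lee_fin ?mulr_ge0//.
by rewrite [in RHS]ge0_muleDr ?mule_ge0 ?fluxG_ge0 ?lee_fin ?mulr_ge0// -!EFinM.
Qed.

Lemma monotone_cvg_integral d (T : measurableType d) (m : {measure set T -> \bar R})
    (D : set T) (f_ : nat -> T -> \bar R) (f : T -> \bar R) :
  measurable D -> (forall n, measurable_fun D (f_ n)) ->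
  (forall n x, D x -> 0 <= f_ n x)%E ->
  (forall x, D x -> {homo f_^~ x : n n' / (n <= n')%N >-> (n <= n')%E}) ->
  (forall x, D x -> f_ n x @[n --> \oo] --> f x) ->
  (\int[m]_(x in D) f_ n x)%E @[n --> \oo] --> (\int[m]_(x in D) f x)%E.
Proof.
move=> mD mf f0 nd cf.
rewrite (_ : (\int[m]_(x in D) f x)%E = (\int[m]_(x in D) limn (f_^~ x))%E).
  exact: cvg_monotone_convergence.
by apply: eq_integral => x; rewrite inE => Dx; apply/esym/cvg_lim => //; exact: cf.
Qed.

Lemma cut_nondecreasing s z v h (n n' : nat) : 0 <= h -> (n <= n')%N ->
  chi n%:R s z * (cutq n%:R s z v * h) <= chi n'%:R s z * (cutq n'%:R s z v * h).
Proof.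
move=> h0 nn'; have nR : (n%:R <= n'%:R :> R) by rewrite ler_nat.
apply: ler_pM; rewrite ?chi_ge0 ?mulr_ge0 ?cutq_ge0//.
  rewrite /chi; case: ifPn => // h1; last by case: ifP.
  by rewrite ifT// (le_trans h1)// lerD2r.
by rewrite ler_wpM2r//; apply: tsq_homo => //; rewrite ler0n.
Qed.

Lemma cut_cvg s z v h :
  (chi n%:R s z * (cutq n%:R s z v * h))%:E @[n --> \oo] -->
  (`|u s z v| ^+ 2 / F z v * h)%:E.
Proof.
apply: cvg_near_cst; near=> n.
have h1 : `|z| + wmax * s <= n%:R by near: n; exact: nbhs_infty_ger.
have h2 : `|u s z v| / F z v <= n%:R by near: n; exact: nbhs_infty_ger.
by rewrite /chi ifT ?mul1r ?lerBrDr// /cutq tsq_eq.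
Unshelve. all: by end_near. Qed.

(** The truncated energies increase to the weighted ones as the truncation N and
    the size L of the cone tend to infinity. *)
Lemma weighted_energy t : 0 <= t ->
  (\int[mu2]_x (`|u t x.1 x.2| ^+ 2 / F x.1 x.2 * G x.1 x.2)%:E +
   \int[mu]_(s in `[0%R, t]) \int[mu2]_x
      (`|u s x.1 x.2| ^+ 2 / F x.1 x.2 * (sg x.1 x.2 * G x.1 x.2))%:E <=
   \int[mu2]_x (`|u0 x.1 x.2| ^+ 2 / F x.1 x.2 * G x.1 x.2)%:E)%E.
Proof.
move=> t0.
pose h (n : nat) (p : R * (R * R)) (g : R * R -> R) :=
  (chi n%:R p.1 p.2.1 * (cutq n%:R p.1 p.2.1 p.2.2 * g p.2))%:E.
have mh n g : measurable_fun setT g -> measurable_fun setT (fun p => h n p g).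
  move=> mg; apply/measurable_EFinP; apply: measurable_funM.
    exact: (measurable_time_z _ _ (fun p => chi n%:R p.1 p.2) (measurable_chi n%:R)).
  by apply: measurable_funM; [exact: measurable_cutq|exact: measurable_phase2].
have h_ge0 n p g : (forall x, 0 <= g x) -> (0 <= h n p g)%E.
  by move=> g0; rewrite lee_fin mulr_ge0 ?chi_ge0// mulr_ge0// cutq_ge0.
pose g1 (x : R * R) := G x.1 x.2; pose g2 (x : R * R) := sg x.1 x.2 * G x.1 x.2.
have mg1 : measurable_fun setT g1 by [].
have mg2 : measurable_fun setT g2 by exact: measurable_funM.
have g10 x : 0 <= g1 x by exact: G0.
have g20 x : 0 <= g2 x by rewrite mulr_ge0.
have c1 : (\int[mu2]_x h n (t, x) g1)%E @[n --> \oo] -->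
    (\int[mu2]_x (`|u t x.1 x.2| ^+ 2 / F x.1 x.2 * G x.1 x.2)%:E)%E.
  apply: monotone_cvg_integral => //.
  - by move=> n; exact: (measurable_fun_pair_r _ _ _ _ _ _ _ t (mh n g1 mg1)).
  - by move=> n x _; exact: h_ge0.
  - by move=> x _ n n' nn'; rewrite lee_fin cut_nondecreasing.
  - by move=> x _; exact: cut_cvg.
have mi n : measurable_fun setT (fun s => \int[mu2]_x h n (s, x) g2)%E.
  exact: (@measurable_parametric_integral _ _ _ _ _ mu2S (fun p => h n p g2) (mh n g2 mg2)).
have c2 : (\int[mu]_(s in `[0%R, t]) \int[mu2]_x h n (s, x) g2)%E @[n --> \oo] -->
    (\int[mu]_(s in `[0%R, t]) \int[mu2]_x
      (`|u s x.1 x.2| ^+ 2 / F x.1 x.2 * (sg x.1 x.2 * G x.1 x.2))%:E)%E.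
  apply: monotone_cvg_integral => //.
  - by move=> n; apply: measurable_funTS; exact: mi.
  - by move=> n s _; apply: integral_ge0 => x _; exact: h_ge0.
  - move=> s _ n n' nn'; apply: ge0_le_integral => //.
    + by move=> x _; exact: h_ge0.
    + exact: (measurable_fun_pair_r _ _ _ _ _ _ _ s (mh n g2 mg2)).
    + exact: (measurable_fun_pair_r _ _ _ _ _ _ _ s (mh n' g2 mg2)).
    + by move=> x _; rewrite lee_fin cut_nondecreasing.
  - move=> s _; apply: monotone_cvg_integral => //.
    + by move=> n; exact: (measurable_fun_pair_r _ _ _ _ _ _ _ s (mh n g2 mg2)).
    + by move=> n x _; exact: h_ge0.
    + by move=> x _ n n' nn'; rewrite lee_fin cut_nondecreasing.
    + by move=> x _; exact: cut_cvg.
have E0 a z v : (0 <= (a ^+ 2 / F z v * G z v)%:E)%E.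
  by rewrite lee_fin mulr_ge0// divr_ge0 ?sqr_ge0// ltW.
apply: (cvge_to_le (cvgeD _ c1 c2)).
  apply: ge0_adde_def; rewrite inE; apply: integral_ge0 => x _ //.
  by apply: integral_ge0 => y _; rewrite lee_fin !mulr_ge0// invr_ge0 ltW.
apply: nearW => n; apply: le_trans (truncated_energy n%:R n%:R t (ler0n _ _) t0) _.
apply: ge0_le_integral => //.
- by move=> x _; rewrite lee_fin mulr_ge0// tsq_ge0.
- by apply/measurable_EFinP; apply: measurable_funM => //; exact: measurable_tsq.
- apply/measurable_EFinP; apply: measurable_funM => //; apply: measurable_funM => //.
    by apply: measurable_funX; exact: measurableT_comp.
  exact: measurable_funV.
by move=> x _; rewrite lee_fin ler_wpM2r//; exact: tsq_le_sqr.
Qed.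
End Energy.

(** * The dispersion relation *)

Section SmallestRate.
Context {R : realType}.
Notation mu := (@lebesgue_measure R).
Context (r : R) (V : set R) (M : R -> R) (r0 : 0 < r) (VM : velocity_model V M).

Lemma V_measurable : measurable V.
Proof. by apply: compact_measurable; case: VM. Qed.

Lemma V_bounded : exists B, forall v, V v -> `|v| <= B.
Proof.
have [N [_ hN]] := compact_bounded (vm_compact VM).
exists (N + 1) => v Vv; apply: hN => //; rewrite ltrDl//.
Qed.

Lemma V_le_vmax v : V v -> v <= vmax V.
Proof.
move=> Vv; apply: sup_upper_bound => //; split; first by exists v.
by have [B hB] := V_bounded; exists B => x /hB; apply: le_trans; exact: ler_norm.
Qed.

Lemma V_norm_le v : V v -> `|v| <= vmax V.
Proof.
move=> Vv; rewrite ler_norml V_le_vmax// andbT lerNl V_le_vmax//.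
exact: (vm_sym VM).
Qed.

(** The velocity vmax is excluded because 1 + la (c - v) vanishes there at the
    endpoint la = 1 / (vmax - c). *)
Definition Vreg : set R := V `\ vmax V.

Lemma Vreg_measurable : measurable Vreg.
Proof. by apply: measurableD; [exact: V_measurable|]. Qed.

Lemma Vreg_lt v : Vreg v -> v < vmax V.
Proof. by move=> [Vv /eqP vN]; rewrite lt_neqAle vN V_le_vmax. Qed.

Lemma Vreg_norm_le v : Vreg v -> `|v| <= vmax V.
Proof. by move=> [Vv _]; exact: V_norm_le. Qed.

Lemma V_finite : (mu V < +oo)%E.
Proof. exact: compact_finite_measure (vm_compact VM). Qed.

Lemma Vreg_finite : (mu Vreg < +oo)%E.
Proof.
apply: le_lt_trans V_finite; apply: le_measure; rewrite ?inE//.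
- exact: Vreg_measurable.
- exact: V_measurable.
- exact: subIsetl.
Qed.

Lemma measurable_M_V : measurable_fun V M.
Proof.
apply: subspace_continuous_measurable_fun; first exact: V_measurable.
exact: vm_continuous VM.
Qed.

Definition Mreg : R -> R := M \_ Vreg.

Lemma MregE v : Vreg v -> Mreg v = M v.
Proof. by move=> Wv; rewrite /Mreg patchE mem_set. Qed.

Lemma measurable_Mreg : measurable_fun setT Mreg.
Proof.
apply/(measurable_restrictT _ _).1; first exact: Vreg_measurable.
apply: measurable_funS measurable_M_V; first exact: V_measurable.
exact: subIsetl.
Qed.

Lemma Mreg_ge0 v : 0 <= Mreg v.
Proof.
rewrite /Mreg patchE; case: ifPn => //; rewrite inE => -[Vv _].
exact: vm_ge0 VM v Vv.
Qed.

Lemma integral_Vreg (f : R -> \bar R) : measurable_fun V f ->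
  (\int[mu]_(v in Vreg) f v = \int[mu]_(v in V) f v)%E.
Proof.
move=> mf; apply: integral_setD1; first exact: Vreg_measurable.
by apply: measurable_funS mf; [exact: V_measurable|exact: subIsetl].
Qed.

Lemma mass_Mreg : (\int[mu]_(v in Vreg) (Mreg v)%:E = 1)%E.
Proof.
rewrite -(vm_mass VM) -(integral_Vreg (fun v => (M v)%:E)); last first.
  by apply/measurable_EFinP; exact: measurable_M_V.
by apply: eq_integral => v; rewrite inE => Wv; rewrite MregE.
Qed.

Lemma Vreg_measure_gt0 : (0 < mu Vreg)%E.
Proof.
rewrite lt0e measure_ge0 andbT; apply/eqP => W0.
have := mass_Mreg; rewrite null_set_integral//.
- by move=> /eqP; rewrite eqe eq_sym oner_eq0.
- exact: Vreg_measurable.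
- by apply/measurable_EFinP; apply: measurable_funTS; exact: measurable_Mreg.
Qed.

Lemma Mreg_bounded : exists2 B, 0 <= B & forall v, Mreg v <= B.
Proof.
have cM : compact (M @` V).
  by apply: continuous_compact; [exact: (vm_continuous VM)|exact: (vm_compact VM)].
have [N [_ hN]] := compact_bounded cM.
exists (`|N| + 1) => [|v]; first by rewrite addr_ge0.
rewrite /Mreg patchE; case: ifPn => [|_]; last by rewrite addr_ge0.
rewrite inE => -[Vv _]; apply: le_trans (ler_norm _) _.
apply: hN; last by exists v.
by rewrite (le_lt_trans (ler_norm _))// ltrDl.
Qed.

Context (c : R) (c_ge0 : 0 <= c) (c_lt : c < vmax V).

(** The symbol of the stationary transport operator 1 - la (v - c) on
    exponentials of rate la. *)
Definition den (la v : R) : R := 1 + la * (c - v).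

Lemma den_gt0 la v : Vreg v -> 0 <= la <= (vmax V - c)^-1 -> 0 < den la v.
Proof.
move=> Wv /andP[la0 la1]; have vV := Vreg_lt v Wv; rewrite /den.
have cV : 0 < vmax V - c by rewrite subr_gt0.
have [vc|cv] := leP v c.
  by rewrite ltr_wpDr// mulr_ge0// subr_ge0.
have h : la * (v - c) < 1.
  apply: (@le_lt_trans _ _ ((vmax V - c)^-1 * (v - c))).
    by rewrite ler_wpM2r// subr_ge0 ltW.
  by rewrite mulrC ltr_pdivrMr// mul1r ltrD2r.
lra.
Qed.

(** For v <= c this follows from den m v >= 1, and for v > c from the monotony of
    den in the rate.  The constant is uniform up to vmax, where both sides may
    degenerate. *)
Lemma den_comparison la m v : V v -> 0 <= m <= la -> 0 <= den m v ->
  den la v <= (1 + (la - m) * (c + vmax V)) * den m v.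
Proof.
move=> Vv /andP[m0 mla] dm; have vn := V_norm_le v Vv.
have vl : - vmax V <= v by move: vn; rewrite ler_norml => /andP[].
have vV0 : 0 <= vmax V by apply: le_trans vn; exact: normr_ge0.
have [vc|cv] := leP v c.
  have d1 : 1 <= den m v by rewrite /den lerDl mulr_ge0// subr_ge0.
  have h : (la - m) * (c - v) <= (la - m) * (c + vmax V).
    by rewrite ler_wpM2l ?subr_ge0//; lra.
  have h0 : 0 <= (la - m) * (c + vmax V) by rewrite mulr_ge0 ?subr_ge0// addr_ge0.
  have := ler_wpM2l h0 d1; rewrite /den in d1 *; lra.
have h0 : 0 <= (la - m) * (c + vmax V) by rewrite mulr_ge0 ?subr_ge0// addr_ge0.
have h1 : 0 <= (la - m) * (v - c) by rewrite mulr_ge0// subr_ge0// ltW.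
have := mulr_ge0 h0 dm; rewrite /den in dm *; lra.
Qed.

(** The dispersion function I of the overview; the front e^(-la z) is compatible
    with speed c when its value is 1. *)
Definition dispersion (la : R) : \bar R :=
  ((1 + r)%:E * \int[mu]_(v in Vreg) (Mreg v / den la v)%:E)%E.

Lemma measurable_den la : measurable_fun setT (den la).
Proof.
by apply: measurable_funD => //; apply: measurable_funM => //; exact: measurable_funB.
Qed.

Lemma measurable_Mden la : measurable_fun setT (fun v => (Mreg v / den la v)%:E).
Proof.
apply/measurable_EFinP; apply: measurable_funM; first exact: measurable_Mreg.
by apply: measurable_funV; exact: measurable_den.
Qed.

Lemma Mden_ge0 la v : 0 <= la <= (vmax V - c)^-1 -> Vreg v -> (0 <= (Mreg v / den la v)%:E)%E.
Proof.
by move=> la0 Wv; rewrite lee_fin divr_ge0 ?Mreg_ge0// ltW// den_gt0.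
Qed.

Lemma dispersion_comparison la m : 0 <= m <= la -> la <= (vmax V - c)^-1 ->
  (dispersion m <= (1 + (la - m) * (c + vmax V))%:E * dispersion la)%E.
Proof.
move=> /andP[m0 mla] la1.
have hm : 0 <= m <= (vmax V - c)^-1 by rewrite m0 (le_trans mla).
have hl : 0 <= la <= (vmax V - c)^-1 by rewrite (le_trans m0).
have V0 : 0 <= vmax V by rewrite (le_trans c_ge0)// ltW.
have f0 : 0 <= 1 + (la - m) * (c + vmax V).
  by rewrite addr_ge0// mulr_ge0 ?subr_ge0// addr_ge0.
rewrite /dispersion muleCA lee_wpmul2l ?lee_fin ?addr_ge0 ?(ltW r0)//.
rewrite -ge0_integralZl//; last 3 first.
- exact: Vreg_measurable.
- by apply: measurable_funTS; exact: measurable_Mden.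
- by move=> v Wv; exact: Mden_ge0.
apply: ge0_le_integral => //.
- exact: Vreg_measurable.
- by move=> v Wv; exact: Mden_ge0.
- by apply: measurable_funTS; exact: measurable_Mden.
- by apply: measurable_funTS; apply: emeasurable_funM => //; exact: measurable_Mden.
move=> v Wv; rewrite -EFinM lee_fin mulrCA ler_wpM2l ?Mreg_ge0//.
have dl := den_gt0 la v Wv hl; have dm := den_gt0 m v Wv hm.
rewrite ler_pdivlMr// mulrC ler_pdivrMr//.
by apply: den_comparison; [case: Wv|rewrite m0|exact: ltW].
Qed.

Lemma dispersion0 : dispersion 0 = (1 + r)%:E.
Proof.
rewrite /dispersion -[RHS]mule1 -mass_Mreg; congr (_ * _)%E.
by apply: eq_integral => v _; rewrite /den mul0r addr0 divr1.
Qed.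

(** The infimum of the rates with dispersion at most 1 has this property itself:
    by the comparison above, the dispersion cannot jump upwards when the rate
    decreases to a limit.  It is positive because the dispersion at 0 is 1 + r. *)
Lemma smallest_rate (la1 : R) : 0 < la1 <= (vmax V - c)^-1 -> (dispersion la1 <= 1)%E ->
  exists la, [/\ 0 < la <= (vmax V - c)^-1, (dispersion la <= 1)%E &
    forall m, 0 <= m < la -> (1 < dispersion m)%E].
Proof.
move=> hla1 dla1.
pose S : set R := [set la | 0 < la <= (vmax V - c)^-1 /\ (dispersion la <= 1)%E].
have V0 : 0 <= vmax V by rewrite (le_trans c_ge0)// ltW.
have hS : has_inf S.
  split; first by exists la1.
  by exists 0 => x [/andP[x0 _] _]; exact: ltW.
pose la := inf S.
have la_ge0 : 0 <= la by apply: lb_le_inf; [by exists la1|move=> x [/andP[x0 _] _]; exact: ltW].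
have la_le x : S x -> la <= x by move=> Sx; apply: inf_lbound => //; case: hS.
(* The infimum is attained. *)
have dla : (dispersion la <= 1)%E.
  apply/lee_addgt0Pr => e e0.
  have e'0 : 0 < e / (c + vmax V + 1).
    by rewrite divr_gt0// ltr_wpDl// addr_ge0.
  have [x Sx xla] := inf_adherent e'0 hS.
  have [/andP[x0 x1] dx] := Sx.
  have hx : 0 <= la <= x by rewrite la_ge0 la_le.
  apply: le_trans (dispersion_comparison x la hx x1) _.
  have f0 : 0 <= 1 + (x - la) * (c + vmax V).
    by rewrite addr_ge0// mulr_ge0 ?subr_ge0 ?la_le// addr_ge0.
  apply: le_trans (lee_wpmul2l _ dx) _; first by rewrite lee_fin.
  rewrite mule1 -EFinD lee_fin lerD2l.
  have hxe : x - la <= e / (c + vmax V + 1) by rewrite lerBlDl; exact: ltW.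
  have cV : 0 < c + vmax V + 1 by rewrite ltr_wpDl// addr_ge0.
  apply: (@le_trans _ _ (e / (c + vmax V + 1) * (c + vmax V + 1))).
    apply: ler_pM => //; rewrite ?subr_ge0 ?la_le ?addr_ge0//.
    by rewrite lerDl.
  by rewrite divfK// gt_eqF.
have la_gt0 : 0 < la.
  rewrite lt_neqAle la_ge0 andbT; apply/eqP => la0.
  by move: dla; rewrite -la0 dispersion0 lee_fin gerDl leNgt r0.
exists la; split => //.
  by rewrite la_gt0/= (le_trans (la_le la1 _))//; case/andP : hla1.
move=> m /andP[m0 mla]; rewrite ltNge; apply/negP => dm.
move: m0; rewrite le_eqVlt => /predU1P[m0|m0].
  by move: dm; rewrite -m0 dispersion0 lee_fin gerDl leNgt r0.
have : S m.
  split => //; rewrite m0/= (le_trans (ltW mla))// (le_trans (la_le la1 _))//.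
  by case/andP : hla1.
by move/la_le; rewrite leNgt mla.
Qed.
End SmallestRate.

(** * Integrals over a set of finite measure *)

Section SetIntegrals.
Context {R : realType}.
Notation mu := (@lebesgue_measure R).
Context (W : set R) (mW : measurable W) (finW : (mu W < +oo)%E).

Lemma integral_indicE (f : R -> \bar R) :
  (\int[mu]_(v in W) f v = \int[mu]_v (f v * (\1_W v)%:E))%E.
Proof. by rewrite integral_mkcond epatch_indic. Qed.

Lemma measurable_set_integral d (T : measurableType d) (f : T * R -> \bar R) :
  measurable_fun setT f ->
  measurable_fun setT (fun x => \int[mu]_(v in W) f (x, v))%E.
Proof.
move=> mf; under eq_fun do rewrite integral_indicE.
apply: (measurable_parametric_integral _ _ _ _ mu (fun p => f p * (\1_W p.2)%:E)%E).
apply: emeasurable_funM => //; apply/measurable_EFinP.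
by apply: measurableT_comp => //; exact: measurable_indic.
Qed.

Lemma measurable_set_Rintegral d (T : measurableType d) (f : T * R -> R) :
  measurable_fun setT f ->
  measurable_fun setT (fun x => \int[mu]_(v in W) f (x, v)).
Proof.
move=> mf; apply: measurableT_comp => //.
by apply: (measurable_set_integral _ _ (EFin \o f)); exact/measurable_EFinP.
Qed.

Lemma integrable_set (g : R -> R) (C : R) :
  measurable_fun setT g -> (forall v, W v -> `|g v| <= C) ->
  mu.-integrable W (EFin \o g).
Proof.
move=> mg gC; apply: measurable_bounded_integrable => //.
  exact: measurable_funTS.
exists C; split; first exact: num_real.
by move=> x Cx v Wv; apply: le_trans (gC v Wv) (ltW Cx).
Qed.

Lemma ge0_integrable (g : R -> R) : measurable_fun setT g ->
  (forall v, W v -> 0 <= g v) -> (\int[mu]_(v in W) (g v)%:E < +oo)%E ->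
  mu.-integrable W (fun v => (g v)%:E).
Proof.
move=> mg g0 gy; apply/integrableP; split.
  by apply/measurable_EFinP; exact: measurable_funTS.
rewrite (_ : (\int[mu]_(x in W) _)%E = \int[mu]_(v in W) (g v)%:E)%E//.
by apply: eq_integral => v; rewrite inE => Wv; rewrite /= ger0_norm// g0.
Qed.

Lemma integrable_scale (k : R) (g : R -> R) : mu.-integrable W (EFin \o g) ->
  mu.-integrable W (fun v => (k * g v)%:E).
Proof. by move=> ig; apply: (integrable_bddM _ _ _ _ (fun=> k) _ `|k|). Qed.

Lemma integrable_add (f g : R -> R) :
  mu.-integrable W (EFin \o f) -> mu.-integrable W (EFin \o g) ->
  mu.-integrable W (fun v => (f v + g v)%:E).
Proof.
move=> i1 i2.
have h : mu.-integrable W ((EFin \o f) \+ (EFin \o g))%E by apply: integrableD.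
exact: h.
Qed.

Lemma ge0_integral_scale (q : R) (g : R -> R) : measurable_fun setT g -> 0 <= q ->
  (forall s, 0 <= g s) ->
  (\int[mu]_(s in W) (q * g s)%:E = q%:E * \int[mu]_(s in W) (g s)%:E)%E.
Proof.
move=> mg q0 g0; rewrite -ge0_integralZl//.
  by apply/measurable_EFinP; exact: measurable_funTS.
by move=> s _; rewrite lee_fin.
Qed.

Lemma Rintegral_set_le (g : R -> R) (C : R) :
  measurable_fun setT g -> (forall v, W v -> 0 <= g v <= C) ->
  \int[mu]_(v in W) g v <= C * fine (mu W).
Proof.
move=> mg gC; rewrite -Rintegral_cst//; apply: le_Rintegral => //.
- apply: (integrable_set _ C) => // v /gC /andP[g0 g1].
  by rewrite ger0_norm.
- by apply: (integrable_set _ `|C|) => // v _.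
- by move=> v /gC /andP[].
Qed.

(** A function with zero integral and positive on W would force W to be null. *)
Lemma Rintegral_set_gt0 (g : R -> R) :
  mu.-integrable W (EFin \o g) -> (0 < mu W)%E -> (forall v, W v -> 0 < g v) ->
  0 < \int[mu]_(v in W) g v.
Proof.
move=> ig W0 g0; rewrite lt_neqAle Rintegral_ge0 ?andbT; last first.
  by move=> v /g0/ltW.
apply/eqP => /esym i0.
have e0 : (\int[mu]_(v in W) (g v)%:E = 0)%E.
  by rewrite -EFin_Rintegral// i0.
have mg : measurable_fun W (EFin \o g) by case/integrableP : ig.
have := (ae_eq_integral_abs mu mW mg).1.
case => [|N [mN N0 WN]].
  rewrite -[RHS]e0; apply: eq_integral => v; rewrite inE => Wv.
  by rewrite /= ger0_norm// ltW// g0.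
have : (mu W <= mu N)%E.
  apply: le_measure; rewrite ?inE// => v Wv; apply: WN => /= /(_ Wv) h.
  by have := g0 v Wv; rewrite -lte_fin (_ : (g v)%:E = 0%E) ?ltxx.
by rewrite N0 leNgt W0.
Qed.

Lemma Tonelli_set (A B : set R) (g : R * R -> \bar R) :
  measurable A -> measurable B ->
  measurable_fun setT g -> (forall x, A x.1 -> B x.2 -> 0 <= g x)%E ->
  (\int[mu]_(x in A) \int[mu]_(y in B) g (x, y) =
   \int[mu]_(y in B) \int[mu]_(x in A) g (x, y))%E.
Proof.
move=> mA mB mg g0.
pose h (p : R * R) : \bar R := (g p * ((\1_A p.1)%:E * (\1_B p.2)%:E))%E.
have mh : measurable_fun setT h.
  apply: emeasurable_funM => //; apply: emeasurable_funM; apply/measurable_EFinP.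
    by apply: measurableT_comp => //; exact: measurable_indic.
  by apply: measurableT_comp => //; exact: measurable_indic.
have h0 p : (0 <= h p)%E.
  rewrite /h !indicE; case: (boolP (p.1 \in A)) => [|_]; last by rewrite mul0e mule0.
  case: (boolP (p.2 \in B)) => [|_]; last by rewrite mule0 mule0.
  by rewrite !inE => pB pA; rewrite !mule1 g0.
have := @fubini_tonelli _ _ _ _ _ mu mu h mh h0.
rewrite [X in X = _ -> _](_ : _ = \int[mu]_(x in A) \int[mu]_(y in B) g (x, y))%E; last first.
  rewrite [RHS]integral_mkcond; apply: eq_integral => x _.
  rewrite patchE /h/=; case: ifPn => xA; last first.
    by apply: integral0_eq => y _; rewrite indicE (negbTE xA) mul0e mule0.
  rewrite [RHS]integral_mkcond; apply: eq_integral => y _.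
  by rewrite patchE !indicE xA/= mul1e; case: ifPn => yB; rewrite ?mule1 ?mule0.
move=> ->.
rewrite [RHS]integral_mkcond; apply: eq_integral => x _.
rewrite patchE /h/=; case: ifPn => xA; last first.
  by apply: integral0_eq => y _; rewrite !indicE (negbTE xA) !mule0.
rewrite [RHS]integral_mkcond; apply: eq_integral => y _.
by rewrite patchE !indicE xA/= mule1; case: ifPn => yB; rewrite ?mule1 ?mule0.
Qed.
End SetIntegrals.

(** * The super- and subsolutions *)

Section Profiles.
Context {R : realType}.
Notation mu := (@lebesgue_measure R).
Context (r c la D MB : R) (W : set R) (M : R -> R).
Context (r0 : 0 < r) (la0 : 0 < la) (D0 : 0 < D).
Context (mW : measurable W) (finW : (mu W < +oo)%E) (W0 : (0 < mu W)%E).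
Context (mM : measurable_fun setT M) (M0 : forall v, 0 <= M v) (MB_ : forall v, M v <= MB).

(** The dispersion function over a general velocity set. *)
Definition disp (m : R) : \bar R :=
  ((1 + r)%:E * \int[mu]_(v in W) (M v / den c m v)%:E)%E.

Context (den_pos : forall m v, 0 <= m <= la -> W v -> 0 < den c m v)
  (den_cmp : forall m v, 0 <= m <= la -> W v -> den c la v <= D * den c m v)
  (speedD : forall v, W v -> la * (v - c) <= D).
Context (disp_la : (disp la <= 1)%E)
  (disp_gt1 : forall m, 0 <= m < la -> (1 < disp m)%E)
  (disp_leD : forall m, 0 <= m <= la -> (disp m <= D%:E)%E).

Let r1 : 0 < 1 + r. Proof. by rewrite ltr_wpDr// ltW. Qed.
Let laE : 0 <= la <= la. Proof. by rewrite lexx ltW. Qed.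

Lemma measurable_den2 d (T : measurableType d) (f g : T -> R) :
  measurable_fun setT f -> measurable_fun setT g ->
  measurable_fun setT (fun x => den c (f x) (g x)).
Proof.
move=> mf mg; apply: measurable_funD => //; apply: measurable_funM => //.
exact: measurable_funB.
Qed.

Lemma measurable_den1 m : measurable_fun setT (den c m).
Proof. exact: measurable_den2. Qed.

Lemma measurable_disp : measurable_fun setT disp.
Proof.
apply: emeasurable_funM => //.
apply: (measurable_set_integral _ mW _ _ (fun p => (M p.2 / den c p.1 p.2)%:E)).
apply/measurable_EFinP; apply: measurable_funM.
  exact: measurableT_comp.
by apply: measurable_funV; apply: measurable_den2.
Qed.

(** The rates are lowered proportionally to den la: this keeps
    den la v - (v - c) kappa v nonnegative, as the transport of the damped
    exponentials in F requires. *)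
Definition kappa (v : R) : R := \1_W v * (la * den c la v / D).
(** The spectral gap at the lowered rate: the factor by which the exponential of
    this rate fails to be a supersolution. *)
Definition gap (v : R) : R := \1_W v * (fine (disp (la - kappa v)) - 1).

Lemma den_leD v : W v -> den c la v <= D.
Proof.
move=> Wv; apply: le_trans (den_cmp 0 v _ Wv) _; first by rewrite lexx ltW.
by rewrite /den mul0r addr0 mulr1.
Qed.

Lemma indic_in v : W v -> \1_W v = 1 :> R.
Proof. by move=> Wv; rewrite indicE mem_set. Qed.

Lemma indic_out v : ~ W v -> \1_W v = 0 :> R.
Proof. by move=> Wv; rewrite indicE memNset. Qed.

Lemma measurable_kappa : measurable_fun setT kappa.
Proof.
apply: measurable_funM; first exact: measurable_indic.
apply: measurable_funM => //; apply: measurable_funM => //; exact: measurable_den1.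
Qed.

Lemma kappa_gt0 v : W v -> 0 < kappa v.
Proof.
move=> Wv; rewrite /kappa indic_in// mul1r divr_gt0// mulr_gt0//.
exact: den_pos.
Qed.

Lemma kappa_le v : kappa v <= la.
Proof.
have [Wv|Wv] := pselect (W v); last by rewrite /kappa indic_out// mul0r ltW.
rewrite /kappa indic_in// mul1r ler_pdivrMr// ler_wpM2l ?(ltW la0)// den_leD//.
Qed.

Lemma kappa_ge0 v : 0 <= kappa v.
Proof.
have [Wv|Wv] := pselect (W v); first exact: ltW (kappa_gt0 v Wv).
by rewrite /kappa indic_out// mul0r.
Qed.

Lemma rate_range v : 0 <= la - kappa v <= la.
Proof. by rewrite subr_ge0 kappa_le gerBl kappa_ge0. Qed.

Lemma disp_fin m : 0 <= m <= la -> disp m \is a fin_num.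
Proof.
move=> hm; rewrite ge0_fin_numE; first exact: le_lt_trans (disp_leD m hm) (ltry _).
rewrite mule_ge0 ?lee_fin ?(ltW r1)//; apply: integral_ge0 => v Wv.
by rewrite lee_fin divr_ge0// ltW// den_pos.
Qed.

Lemma measurable_gap : measurable_fun setT gap.
Proof.
apply: measurable_funM; first exact: measurable_indic.
apply: measurable_funB => //; apply: measurableT_comp => //.
apply: measurableT_comp => //; first exact: measurable_disp.
by apply: measurable_funB => //; exact: measurable_kappa.
Qed.

Lemma gap_gt0 v : W v -> 0 < gap v.
Proof.
move=> Wv; rewrite /gap indic_in// mul1r subr_gt0 -lte_fin fineK ?disp_fin ?rate_range//.
apply: disp_gt1; case/andP: (rate_range v) => -> _ /=.
by rewrite gtrBl kappa_gt0.
Qed.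

Lemma gap_ge0 v : 0 <= gap v.
Proof.
have [Wv|Wv] := pselect (W v); first exact: ltW (gap_gt0 v Wv).
by rewrite /gap indic_out// mul0r.
Qed.

Lemma gap_le v : gap v <= D.
Proof.
have [Wv|Wv] := pselect (W v); last by rewrite /gap indic_out// mul0r ltW.
rewrite /gap indic_in// mul1r lerBlDr; apply: (@le_trans _ _ D); last by rewrite lerDl.
by rewrite -lee_fin fineK ?disp_fin ?rate_range// disp_leD ?rate_range.
Qed.

Definition pospart (z : R) : R := Num.max z 0.

Definition damp (z v : R) : R := expR (- (kappa v * pospart z)).
Definition gap_mass (z : R) : R := \int[mu]_(v in W) (gap v * damp z v).
Definition mass_damp (z : R) : R := \int[mu]_(v in W) damp z v.
Definition gap_mass0 : R := \int[mu]_(v in W) gap v.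
Definition volume : R := fine (mu W).
Definition Mden_mass : R := \int[mu]_(v in W) (M v / den c la v).

Lemma pospart_ge0 z : 0 <= pospart z.
Proof. by rewrite le_max lexx orbT. Qed.

Lemma measurable_damp : measurable_fun setT (fun x : R * R => damp x.1 x.2).
Proof.
apply: measurableT_comp => //; apply: measurableT_comp => //; apply: measurable_funM.
  by apply: measurableT_comp => //; exact: measurable_kappa.
apply: measurableT_comp => //; exact: measurable_maxr.
Qed.

Lemma measurable_damp1 z : measurable_fun setT (damp z).
Proof. exact: (measurable_fun_pair_r _ _ _ _ _ _ _ z measurable_damp). Qed.

Lemma damp_range z v : 0 <= damp z v <= 1.
Proof. by rewrite expR_ge0 -expR0 ler_expR oppr_le0 mulr_ge0 ?kappa_ge0 ?pospart_ge0. Qed.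

Lemma damp0 z v : z <= 0 -> damp z v = 1.
Proof. by move=> z0; rewrite /damp /pospart max_r// mulr0 oppr0 expR0. Qed.

Lemma gap_damp_range z v : 0 <= gap v * damp z v <= D.
Proof.
have /andP[e0 e1] := damp_range z v.
rewrite mulr_ge0 ?gap_ge0//= -[leRHS]mulr1 ler_pM ?gap_ge0 ?gap_le//.
Qed.

Lemma measurable_gap_damp z : measurable_fun setT (fun v => gap v * damp z v).
Proof. by apply: measurable_funM; [exact: measurable_gap|exact: measurable_damp1]. Qed.

Lemma integrable_gap_damp z : mu.-integrable W (EFin \o (fun v => gap v * damp z v)).
Proof.
apply: (integrable_set _ mW finW _ D); first exact: measurable_gap_damp.
by move=> v _; case/andP: (gap_damp_range z v) => h1 h2; rewrite ger0_norm.
Qed.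

Lemma integrable_gap : mu.-integrable W (EFin \o gap).
Proof.
apply: (integrable_set _ mW finW _ D); first exact: measurable_gap.
by move=> v _; rewrite ger0_norm ?gap_ge0 ?gap_le.
Qed.

Lemma integrable_damp z : mu.-integrable W (EFin \o damp z).
Proof.
apply: (integrable_set _ mW finW _ 1); first exact: measurable_damp1.
by move=> v _; case/andP: (damp_range z v) => h1 h2; rewrite ger0_norm.
Qed.

Lemma gap_mass0_gt0 : 0 < gap_mass0.
Proof.
apply: (Rintegral_set_gt0 _ mW _ integrable_gap W0) => v Wv; exact: gap_gt0.
Qed.

Lemma gap_mass_ge0 z : 0 <= gap_mass z.
Proof. by apply: Rintegral_ge0 => v _; case/andP: (gap_damp_range z v). Qed.

Lemma gap_mass_le z : gap_mass z <= gap_mass0.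
Proof.
apply: le_Rintegral => //; [exact: integrable_gap_damp|exact: integrable_gap|].
move=> v _; rewrite ler_piMr ?gap_ge0//; by case/andP: (damp_range z v).
Qed.

Lemma gap_mass_left z : z <= 0 -> gap_mass z = gap_mass0.
Proof. by move=> z0; apply: eq_Rintegral => v _; rewrite damp0// mulr1. Qed.

(** No damping rate exceeds la, so the gain e^(la z) gap_mass z never falls below
    its value at 0. *)
Lemma gap_mass_right z : 0 <= z -> gap_mass0 <= expR (la * z) * gap_mass z.
Proof.
move=> z0; rewrite -RintegralZl//; last exact: integrable_gap_damp.
apply: le_Rintegral => //; first exact: integrable_gap.
  apply: (integrable_bddM _ _ _ _ (fun=> expR (la * z)) _ (expR (la * z))) => //.
    by move=> v _; rewrite ger0_norm// expR_ge0.
  exact: integrable_gap_damp.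
move=> v _; rewrite mulrCA ler_peMr ?gap_ge0// /damp -expRD -expR0 ler_expR.
by rewrite /pospart max_l// subr_ge0 ler_wpM2r// kappa_le.
Qed.

Lemma volume_ge0 : 0 <= volume.
Proof. by rewrite fine_ge0. Qed.

Lemma mass_damp_left z : z <= 0 -> mass_damp z = volume.
Proof.
move=> z0; rewrite -[RHS]mul1r -Rintegral_cst//.
by apply: eq_Rintegral => v _; rewrite damp0.
Qed.

Lemma measurable_gap_mass : measurable_fun setT gap_mass.
Proof.
apply: (measurable_set_Rintegral _ mW _ _ (fun p => gap p.2 * damp p.1 p.2)).
apply: measurable_funM; last exact: measurable_damp.
by apply: measurableT_comp => //; exact: measurable_gap.
Qed.

Lemma measurable_Mden_la : measurable_fun setT (fun v => M v / den c la v).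
Proof.
by apply: measurable_funM => //; apply: measurable_funV; exact: measurable_den1.
Qed.

Lemma Mden_la_ge0 v : W v -> 0 <= M v / den c la v.
Proof. by move=> Wv; rewrite divr_ge0// ltW// den_pos. Qed.

Lemma integrable_Mden m : 0 <= m <= la ->
  mu.-integrable W (fun v => (M v / den c m v)%:E).
Proof.
move=> hm; apply: (ge0_integrable _ (fun v => M v / den c m v)).
- by apply: measurable_funM => //; apply: measurable_funV; exact: measurable_den1.
- by move=> v Wv; rewrite divr_ge0// ltW// den_pos.
rewrite ltey; apply/eqP => h; have := disp_leD m hm.
by rewrite /disp h gt0_muley ?lte_fin.
Qed.

Lemma disp_Rintegral m : 0 <= m <= la ->
  disp m = ((1 + r) * \int[mu]_(v in W) (M v / den c m v))%:E.
Proof.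
by move=> hm; rewrite EFinM EFin_Rintegral//; exact: integrable_Mden.
Qed.

Lemma Mden_mass_ge0 : 0 <= Mden_mass.
Proof. by apply: Rintegral_ge0 => v; exact: Mden_la_ge0. Qed.

Lemma Mden_mass_le : (1 + r) * Mden_mass <= 1.
Proof. by rewrite -lee_fin -disp_Rintegral. Qed.


(** Large enough for the two uses of A: the subtracted integral is at most half
    of the leading term of G (second summand), and on the left half line its
    transport is absorbed by r rho_f G (first summand). *)
Definition coefA : R := 8 * D ^+ 2 * volume / r + 2 * volume * D.
(** Half of the gain available on the right half line. *)
Definition delta : R := gap_mass0 / 2.
(** So small that the slack b, paid twice by G, uses half of the gain. *)
Definition eta : R := (4 * (1 + r) * (coefA + delta))^-1.
Definition dissip : R := Num.min (r / 8) (delta / (coefA + delta)).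

Let Ac0 : 0 <= coefA.
Proof. by rewrite addr_ge0 ?divr_ge0 ?mulr_ge0 ?sqr_ge0 ?volume_ge0 ?(ltW D0) ?(ltW r0). Qed.
Let de0 : 0 < delta. Proof. by rewrite divr_gt0// gap_mass0_gt0. Qed.
Let Ade0 : 0 < coefA + delta. Proof. by rewrite ltr_wpDl. Qed.
Lemma eta_gt0 : 0 < eta. Proof. by rewrite invr_gt0 !mulr_gt0. Qed.
Lemma dissip_gt0 : 0 < dissip.
Proof. by rewrite lt_min; apply/andP; split; rewrite divr_gt0. Qed.

Lemma kexpE (al be z : R) : kexp al be z = expR (al * z) * expR (- (be * pospart z)).
Proof. by rewrite /kexp expRD. Qed.

Lemma kexp_damp (al z v : R) : kexp al (kappa v) z = expR (al * z) * damp z v.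
Proof. exact: kexpE. Qed.

Lemma kexp_be0 (al z : R) : kexp al 0 z = expR (al * z).
Proof. by rewrite kexpE mul0r oppr0 expR0 mulr1. Qed.

Lemma kexp_gt0 (al be z : R) : 0 < kexp al be z.
Proof. exact: expR_gt0. Qed.

(** The value 1 off W only serves to have F positive everywhere. *)
Definition profF (z v : R) : R :=
  \1_W v * (M v / den c la v * kexp (- la) 0 z + eta * gap v * kexp (- la) (kappa v) z)
  + (1 - \1_W v).

(** The derivative in z of profF for v in W. *)
Definition dprofF (z v : R) : R :=
  M v / den c la v * dkexp (- la) 0 z + eta * gap v * dkexp (- la) (kappa v) z.

(** The coefficient b of the overview. *)
Definition slack (z v : R) : R := \1_W v * ((1 + r) * eta * gap_mass z * den c la v).

Lemma profFE z v : W v -> profF z v =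
  M v / den c la v * kexp (- la) 0 z + eta * gap v * kexp (- la) (kappa v) z.
Proof. by move=> Wv; rewrite /profF indic_in// mul1r subrr addr0. Qed.

Lemma profF_gt0 z v : 0 < profF z v.
Proof.
have [Wv|Wv] := pselect (W v); last by rewrite /profF indic_out// mul0r subr0 add0r.
rewrite profFE//; apply: ltr_wpDl.
  by apply: mulr_ge0; [exact: Mden_la_ge0|exact: ltW (kexp_gt0 _ _ _)].
apply: mulr_gt0; last exact: kexp_gt0.
by apply: mulr_gt0; [exact: eta_gt0|exact: gap_gt0].
Qed.

Lemma slack_ge0 z v : 0 <= slack z v.
Proof.
have [Wv|Wv] := pselect (W v); last by rewrite /slack indic_out// mul0r.
rewrite /slack indic_in// mul1r; apply: mulr_ge0; last exact/ltW/den_pos.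
by rewrite !mulr_ge0 ?gap_mass_ge0 ?(ltW r1) ?(ltW eta_gt0).
Qed.

Lemma slack_le z v : slack z v <= (1 + r) * eta * gap_mass0 * D.
Proof.
have h0 : 0 <= (1 + r) * eta * gap_mass0 * D.
  by rewrite !mulr_ge0 ?(ltW gap_mass0_gt0) ?(ltW r1) ?(ltW eta_gt0) ?(ltW D0).
have [Wv|Wv] := pselect (W v); last by rewrite /slack indic_out// mul0r.
rewrite /slack indic_in// mul1r ler_pM ?mulr_ge0 ?gap_mass_ge0 ?(ltW r1) ?(ltW eta_gt0)//.
- by rewrite ltW// den_pos.
- by rewrite ler_wpM2l ?mulr_ge0 ?(ltW r1) ?(ltW eta_gt0)// gap_mass_le.
- exact: den_leD.
Qed.

Lemma measurable_kexp2 d (T : measurableType d) (al : R) (be z : T -> R) :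
  measurable_fun setT be -> measurable_fun setT z ->
  measurable_fun setT (fun x => kexp al (be x) (z x)).
Proof.
move=> mb mz; apply: measurableT_comp => //; apply: measurable_funB.
  by apply: measurable_funM.
by apply: measurable_funM => //; apply: measurable_maxr.
Qed.

Let m_indic1 : measurable_fun setT (\1_W : R -> R).
Proof. exact: measurable_indic. Qed.
Let m_indic : measurable_fun setT (fun x : R * R => \1_W x.2 : R).
Proof. by apply: measurableT_comp. Qed.
Let mkap2 : measurable_fun setT (fun x : R * R => kappa x.2).
Proof. by apply: measurableT_comp => //; exact: measurable_kappa. Qed.
Let mMd2 : measurable_fun setT (fun x : R * R => M x.2 / den c la x.2).
Proof. by apply: (measurableT_comp measurable_Mden_la). Qed.
Let mJ2 : measurable_fun setT (fun x : R * R => gap x.2).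
Proof. by apply: (measurableT_comp measurable_gap). Qed.

Lemma measurable_profF : measurable_fun setT (fun x : R * R => profF x.1 x.2).
Proof.
apply: measurable_funD; last exact: measurable_funB.
apply: measurable_funM => //; apply: measurable_funD; apply: measurable_funM => //.
- exact: measurable_kexp2.
- exact: measurable_funM.
- exact: measurable_kexp2.
Qed.

Lemma measurable_slack : measurable_fun setT (fun x : R * R => slack x.1 x.2).
Proof.
apply: measurable_funM => //; apply: measurable_funM.
  by apply: measurable_funM => //; apply: (measurableT_comp measurable_gap_mass).
by apply: measurableT_comp => //; exact: measurable_den1.
Qed.

Lemma massF_profF z :
  massF W profF z = (expR (- la * z) * (Mden_mass + eta * gap_mass z))%:E.
Proof.
rewrite /massF (_ : (\int[mu]_v _)%E =
  \int[mu]_(v in W) ((profF z v)%:E * (\1_W v)%:E))%E; last first.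
  rewrite [RHS]integral_indicE//; apply: eq_integral => v _.
  have [Wv|Wv] := pselect (W v); first by rewrite indic_in// !mule1 mulr1.
  by rewrite indic_out// mulr0 !mule0.
transitivity (\int[mu]_(v in W) (expR (- la * z) * (M v / den c la v)
   + expR (- la * z) * (eta * (gap v * damp z v)))%:E)%E.
  apply: eq_integral => v; rewrite inE => Wv.
  rewrite indic_in// mule1 profFE// kexp_be0 kexp_damp; congr EFin; ring.
have i1 : mu.-integrable W (fun v => (expR (- la * z) * (M v / den c la v))%:E).
  by apply: (integrable_scale _ mW _ (fun v => M v / den c la v)); exact: integrable_Mden.
have i2 : mu.-integrable W (fun v => (eta * (gap v * damp z v))%:E).
  by apply: (integrable_scale _ mW _ (fun v => gap v * damp z v)); exact: integrable_gap_damp.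
have i3 : mu.-integrable W (fun v => (expR (- la * z) * (eta * (gap v * damp z v)))%:E).
  exact: (integrable_scale _ mW _ (fun v => eta * (gap v * damp z v))).
have i4 : mu.-integrable W (fun v => (expR (- la * z) * (M v / den c la v)
    + expR (- la * z) * (eta * (gap v * damp z v)))%:E).
  exact: (integrable_add _ mW _ _ i1 i3).
rewrite -EFin_Rintegral//.
congr EFin; rewrite RintegralD// !RintegralZl//.
- by rewrite -mulrDr.
- exact: integrable_gap_damp.
- exact: integrable_Mden.
Qed.

(** Since d_la = 1 - la (v - c), transport turns the first term of F into
    e^(-la z) M and the slack b into (1 + r) eta gap_mass times that, together the
    bound for P rho_F; the second term of F contributes with the factor
    den la - (v - c) kappa, which the choice of kappa makes nonnegative. *)
Lemma profF_supersolution z v p rh : W v -> 0 <= rh -> 0 <= p <= (1 + r) * M v ->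
  p * (expR (- la * z) * (Mden_mass + eta * gap_mass z)) <=
  (1 + r * rh + slack z v) * profF z v + (v - c) * dprofF z v.
Proof.
move=> Wv rh0 /andP[p0 pM].
have d0 : 0 < den c la v by exact: den_pos.
have Yd : 0 <= damp z v by case/andP : (damp_range z v).
have X0 := expR_gt0 (- la * z).
pose k' := if 0 < z then kappa v else 0.
(* This is the place where kappa has to be proportional to den la. *)
have kd : 0 <= den c la v - (v - c) * k'.
  rewrite /k'; case: ifPn => _; last by rewrite mulr0 subr0 ltW.
  rewrite /kappa indic_in// mul1r (_ : _ - _ = den c la v / D * (D - la * (v - c))).
    by rewrite mulr_ge0 ?divr_ge0 ?(ltW d0) ?(ltW D0)// subr_ge0 speedD.
  by field; rewrite gt_eqF.
have e0 := gap_mass_ge0 z; have et0 := ltW eta_gt0; have J0 := gap_ge0 v.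
have S0 := Mden_mass_ge0; have S1 := Mden_mass_le; have b0 := slack_ge0 z v.
apply: (@le_trans _ _ (M v * expR (- la * z) * (1 + (1 + r) * eta * gap_mass z))).
  apply: (@le_trans _ _ ((1 + r) * M v * (expR (- la * z) * (Mden_mass + eta * gap_mass z)))).
    by rewrite ler_wpM2r// mulr_ge0 ?addr_ge0 ?mulr_ge0 ?(ltW X0).
  rewrite (_ : _ * _ = M v * expR (- la * z) * ((1 + r) * Mden_mass + (1 + r) * eta * gap_mass z)); last by ring.
  by rewrite ler_wpM2l ?mulr_ge0 ?(ltW X0)// lerD2r.
rewrite profFE// /dprofF /dkexp kexp_be0 kexp_damp -/k' if_same.
set X := expR _; set Y := damp z v.
rewrite -subr_ge0.
rewrite (_ : _ - _ = M v / den c la v * X * (r * rh)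
   + (slack z v - (1 + r) * eta * gap_mass z * den c la v) * (M v / den c la v * X)
   + eta * gap v * X * Y * (den c la v - (v - c) * k' + r * rh + slack z v)); last first.
  rewrite /den; field; rewrite -/(den c la v); exact: lt0r_neq0.
rewrite {1}/slack indic_in// mul1r subrr mul0r addr0.
have MX : 0 <= M v / den c la v * X by apply: mulr_ge0; [exact: Mden_la_ge0|exact: ltW].
have JX : 0 <= eta * gap v * X * Y.
  by apply: mulr_ge0 => //; apply: mulr_ge0; [exact: mulr_ge0|exact: ltW].
have rr : 0 <= r * rh by rewrite mulr_ge0// ltW.
apply: addr_ge0; [exact: mulr_ge0|apply: mulr_ge0 => //].
by apply: addr_ge0 => //; exact: addr_ge0.
Qed.


(** The exponential solution of the adjoint equation at the lowered rate of v'
    (to the right of the kink). *)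
Definition kern (z v v' : R) : R := kexp la (kappa v') z / den c (la - kappa v') v.
Definition kslope (z v' : R) : R := if 0 < z then kappa v' else 0.
Definition dkern (z v v' : R) : R := (la - kslope z v') * kern z v v'.
Definition kern_mass (z v : R) : R := \int[mu]_(v' in W) kern z v v'.
Definition profG (z v : R) : R :=
  \1_W v * ((coefA * kexp la 0 z + delta * kexp la la z) / den c la v - kern_mass z v).
(** The derivative in z of profG for v in W. *)
Definition dprofG (z v : R) : R :=
  (coefA * dkexp la 0 z + delta * dkexp la la z) / den c la v
  - \int[mu]_(v' in W) dkern z v v'.
(** The upper bound for int P G obtained from P <= (1 + r) M and I(la) <= 1. *)
Definition flux_bound (z : R) : R :=
  coefA * kexp la 0 z + delta * kexp la la z - expR (la * z) * (mass_damp z + gap_mass z).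

Lemma measurable_kern : measurable_fun setT (fun x : (R * R) * R => kern x.1.1 x.1.2 x.2).
Proof.
apply: measurable_funM.
  apply: measurable_kexp2; first by apply: (measurableT_comp measurable_kappa).
  by apply: measurableT_comp => //; exact: measurableT_comp.
apply: measurable_funV; apply: measurable_den2.
  by apply: measurable_funB => //; apply: (measurableT_comp measurable_kappa).
by apply: measurableT_comp => //; exact: measurableT_comp.
Qed.

Lemma measurable_kern1 z v : measurable_fun setT (kern z v).
Proof. exact: (measurable_fun_pair_r _ _ _ _ _ _ _ (z, v) measurable_kern). Qed.

Lemma measurable_kslope : measurable_fun setT (fun x : R * R => kslope x.1 x.2).
Proof.
by apply: measurable_fun_ifT => //=; exact: measurable_fun_ltr.
Qed.

Lemma kslope_range z v : 0 <= kslope z v <= la.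
Proof. by rewrite /kslope; case: ifPn; rewrite ?kappa_ge0 ?kappa_le ?lexx ?ltW. Qed.

Lemma measurable_dkern : measurable_fun setT (fun x : (R * R) * R => dkern x.1.1 x.1.2 x.2).
Proof.
apply: measurable_funM; last exact: measurable_kern.
apply: measurable_funB => //.
apply: (@measurableT_comp _ _ _ _ _ _ (fun x : R * R => kslope x.1 x.2) _
  (fun x : (R * R) * R => (x.1.1, x.2))); first exact: measurable_kslope.
by apply/measurable_fun_pair => //=; exact: measurableT_comp.
Qed.

Lemma measurable_dkern1 z v : measurable_fun setT (dkern z v).
Proof. exact: (measurable_fun_pair_r _ _ _ _ _ _ _ (z, v) measurable_dkern). Qed.

Lemma kern_range z v v' : W v -> 0 <= kern z v v' <= expR (la * z) * (D / den c la v).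
Proof.
move=> Wv; have hm := rate_range v'.
have dm := den_pos _ _ hm Wv; have dl := den_pos _ _ laE Wv.
have /andP[y0 y1] := damp_range z v'.
rewrite /kern kexp_damp divr_ge0 ?mulr_ge0 ?expR_ge0 ?(ltW dm)//=.
rewrite -mulrA ler_wpM2l ?expR_ge0// ler_pdivrMr// mulrAC ler_pdivlMr//.
apply: (@le_trans _ _ (den c la v)); first by rewrite ler_piMl// ltW.
exact: den_cmp.
Qed.

Lemma dkern_range z v v' : W v -> 0 <= dkern z v v' <= la * (expR (la * z) * (D / den c la v)).
Proof.
move=> Wv; have /andP[k0 k1] := kern_range z v v' Wv.
have /andP[s0 s1] := kslope_range z v'.
by rewrite mulr_ge0 ?subr_ge0//= ler_pM ?subr_ge0// gerBl.
Qed.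

Lemma integrable_kern z v : W v -> mu.-integrable W (EFin \o kern z v).
Proof.
move=> Wv; apply: (integrable_set _ mW finW _ (expR (la * z) * (D / den c la v))).
  exact: measurable_kern1.
by move=> v' _; case/andP: (kern_range z v v' Wv) => h1 h2; rewrite ger0_norm.
Qed.

Lemma integrable_dkern z v : W v -> mu.-integrable W (EFin \o dkern z v).
Proof.
move=> Wv; apply: (integrable_set _ mW finW _ (la * (expR (la * z) * (D / den c la v)))).
  exact: measurable_dkern1.
by move=> v' _; case/andP: (dkern_range z v v' Wv) => h1 h2; rewrite ger0_norm.
Qed.

Lemma kern_mass_le z v : W v -> kern_mass z v <= expR (la * z) * (D / den c la v) * volume.
Proof.
by move=> Wv; apply: Rintegral_set_le => // [|v' _]; [exact: measurable_kern1|exact: kern_range].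
Qed.

Lemma kern_mass_ge0 z v : W v -> 0 <= kern_mass z v.
Proof. by move=> Wv; apply: Rintegral_ge0 => v' _; case/andP: (kern_range z v v' Wv). Qed.

Lemma kexp_la_range z : 0 <= kexp la la z <= expR (la * z).
Proof.
rewrite expR_ge0 kexpE/= ler_piMr ?expR_ge0// -expR0 ler_expR.
by rewrite oppr_le0 mulr_ge0 ?pospart_ge0 ?ltW.
Qed.

Lemma profGE z v : W v -> profG z v =
  (coefA * kexp la 0 z + delta * kexp la la z) / den c la v - kern_mass z v.
Proof. by move=> Wv; rewrite /profG indic_in// mul1r. Qed.

Lemma profG_ge z v : W v -> coefA / 2 * expR (la * z) / den c la v <= profG z v.
Proof.
move=> Wv; have dl := den_pos _ _ laE Wv.
have /andP[y0 y1] := kexp_la_range z; have E0 := expR_gt0 (la * z).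
rewrite profGE// kexp_be0 lerBrDr.
apply: le_trans (_ : _ <= coefA / 2 * expR (la * z) / den c la v
  + expR (la * z) * (D / den c la v) * volume) _.
  by rewrite lerD2l kern_mass_le.
rewrite (_ : _ + _ = (coefA / 2 + D * volume) * expR (la * z) / den c la v); last by field; exact: lt0r_neq0.
rewrite ler_wpM2r ?invr_ge0 ?(ltW dl)//.
have h : D * volume <= coefA / 2.
  have a0 : 0 <= 8 * D ^+ 2 * volume / r.
    have v0 := volume_ge0; have D0' := ltW D0.
    by rewrite divr_ge0 ?(ltW r0)// !mulr_ge0.
  by rewrite /coefA; lra.
rewrite -[leLHS]addr0; apply: lerD; last by apply: mulr_ge0 => //; exact: ltW.
by rewrite ler_wpM2r ?(ltW E0)//; lra.
Qed.

Lemma profG_le z v : W v -> profG z v <= (coefA + delta) * expR (la * z) / den c la v.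
Proof.
move=> Wv; have dl := den_pos _ _ laE Wv.
have /andP[y0 y1] := kexp_la_range z.
rewrite profGE// kexp_be0.
apply: le_trans (_ : _ <= (coefA * expR (la * z) + delta * kexp la la z) / den c la v) _.
  by rewrite gerBl kern_mass_ge0.
by rewrite ler_wpM2r ?invr_ge0 ?(ltW dl)// (mulrDl coefA delta) lerD2l ler_wpM2l// ltW.
Qed.

Lemma profG_ge0 z v : 0 <= profG z v.
Proof.
have [Wv|Wv] := pselect (W v); last by rewrite /profG indic_out// mul0r.
apply: le_trans (profG_ge z v Wv).
have dl := den_pos _ _ laE Wv.
by rewrite mulr_ge0 ?invr_ge0 ?(ltW dl)// mulr_ge0 ?expR_ge0// divr_ge0.
Qed.

Lemma measurable_kern_mass : measurable_fun setT (fun x : R * R => kern_mass x.1 x.2).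
Proof. exact: (measurable_set_Rintegral _ mW _ _ _ measurable_kern). Qed.

Lemma measurable_profG : measurable_fun setT (fun x : R * R => profG x.1 x.2).
Proof.
apply: measurable_funM => //; apply: measurable_funB; last exact: measurable_kern_mass.
apply: measurable_funM.
  by apply: measurable_funD; apply: measurable_funM => //; exact: measurable_kexp2.
by apply: measurable_funV; apply: measurable_den2.
Qed.

(** To the right of the kink the kernel has rate la - kappa(v'), and transport
    turns its denominator den (la - kappa v') v into the factor 1; to the left
    all kernels have rate la. *)
Lemma kern_mass_transport z v : W v ->
  kern_mass z v - (v - c) * \int[mu]_(v' in W) dkern z v v' =
  if 0 < z then expR (la * z) * mass_damp z else den c la v * kern_mass z v.
Proof.
move=> Wv; rewrite -RintegralZl//; last exact: integrable_dkern.
rewrite /kern_mass -RintegralB//; last 2 first.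
- exact: integrable_kern.
- exact: (integrable_scale _ mW _ _ (integrable_dkern z v Wv)).
case: ifPn => z0.
  rewrite -RintegralZl//; last exact: integrable_damp.
  apply: eq_Rintegral => v' _; rewrite /dkern /kslope z0 /kern kexp_damp.
  have dm := den_pos _ _ (rate_range v') Wv.
  apply: (mulIf (lt0r_neq0 dm)); rewrite mulrBl.
  rewrite [X in _ - X](_ : _ = (v - c) * (la - kappa v') * (expR (la * z) * damp z v')); last first.
    by rewrite -!mulrA mulVf ?lt0r_neq0// mulr1.
  rewrite divfK ?lt0r_neq0// /den; ring.
rewrite -RintegralZl//; last exact: integrable_kern.
apply: eq_Rintegral => v' _; rewrite /dkern /kslope (negbTE z0) subr0 /den; ring.
Qed.


Lemma integrable_M_kern z v' : W v' -> mu.-integrable W (fun v => (M v * kern z v v')%:E).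
Proof.
move=> Wv'; rewrite (_ : (fun v => _) =
    (fun v => (kexp la (kappa v') z * (M v / den c (la - kappa v') v))%:E)); last first.
  by apply/funext => v; congr EFin; rewrite /kern mulrCA.
apply: (integrable_scale _ mW _ (fun v => M v / den c (la - kappa v') v)).
exact: (integrable_Mden _ (rate_range v')).
Qed.

(** The flux of the kernel of rate m is I(m) times its exponential, and
    I(m) = 1 + gap. *)
Lemma flux_kern z v' : W v' ->
  (1 + r) * (\int[mu]_(v in W) (M v * kern z v v')) =
  expR (la * z) * (damp z v' + gap v' * damp z v').
Proof.
move=> Wv'; have hm := rate_range v'.
rewrite (_ : \int[mu]_(v in W) _ = \int[mu]_(v in W)
    (kexp la (kappa v') z * (M v / den c (la - kappa v') v))); last first.
  by apply: eq_Rintegral => v _; rewrite /kern mulrCA.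
rewrite RintegralZl//; last exact: (integrable_Mden _ hm).
have : gap v' + 1 = (1 + r) * \int[mu]_(v in W) (M v / den c (la - kappa v') v).
  by rewrite /gap indic_in// mul1r subrK disp_Rintegral.
rewrite kexp_damp => h; rewrite mulrCA -h; ring.
Qed.

Lemma integral_M_kern_mass z :
  ((1 + r)%:E * \int[mu]_(v in W) (M v * kern_mass z v)%:E =
   (expR (la * z) * (mass_damp z + gap_mass z))%:E)%E.
Proof.
have mMk : measurable_fun setT (fun p : R * R => (M p.1 * kern z p.1 p.2)%:E).
  apply/measurable_EFinP; apply: measurable_funM; first exact: measurableT_comp.
  apply: (@measurableT_comp _ _ _ _ _ _ (fun x : (R * R) * R => kern x.1.1 x.1.2 x.2) _
    (fun p : R * R => ((z, p.1), p.2))); first exact: measurable_kern.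
  by apply/measurable_fun_pair => //=; apply/measurable_fun_pair.
rewrite (_ : (\int[mu]_(v in W) _)%E =
   (\int[mu]_(v in W) \int[mu]_(v' in W) (M v * kern z v v')%:E)%E); last first.
  apply: eq_integral => v; rewrite inE => Wv.
  rewrite -EFin_Rintegral//.
    by congr EFin; rewrite RintegralZl//; exact: integrable_kern.
  exact: (integrable_scale _ mW _ _ (integrable_kern z v Wv)).
rewrite (Tonelli_set _ _ (fun p => (M p.1 * kern z p.1 p.2)%:E) mW mW mMk); last first.
  by move=> [v v']/= Wv _; rewrite lee_fin mulr_ge0//; case/andP: (kern_range z v v' Wv).
rewrite -ge0_integralZl//; last 3 first.
- apply: measurable_funTS; apply: (measurable_set_integral _ mW _ _
    (fun p => (M p.2 * kern z p.2 p.1)%:E)).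
  apply: (@measurableT_comp _ _ _ _ _ _ (fun p : R * R => (M p.1 * kern z p.1 p.2)%:E) _
    (fun p : R * R => (p.2, p.1)) mMk).
  exact/measurable_fun_pair.
- move=> v' _; apply: integral_ge0 => v Wv.
  by rewrite lee_fin mulr_ge0//; case/andP: (kern_range z v v' Wv).
- by rewrite lee_fin ltW.
transitivity (\int[mu]_(v' in W) (expR (la * z) * (damp z v' + gap v' * damp z v'))%:E)%E.
  apply: eq_integral => v'; rewrite inE => Wv'.
  rewrite -EFin_Rintegral//; last exact: integrable_M_kern.
  by rewrite -EFinM flux_kern.
have i1 := integrable_damp z; have i2 := integrable_gap_damp z.
have i3 := integrable_add _ mW _ _ i1 i2.
rewrite -EFin_Rintegral//; last exact: (integrable_scale _ mW _ _ i3).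
by congr EFin; rewrite RintegralZl// RintegralD.
Qed.

Lemma fluxG_profG (P : R -> R -> R) z :
  measurable_fun setT (fun x : R * R => P x.1 x.2) ->
  (forall v, 0 <= P z v <= (1 + r) * M v) -> (forall v, ~ W v -> P z v = 0) ->
  (fluxG P profG z <= (flux_bound z)%:E)%E.
Proof.
move=> mP PM PW.
pose a := coefA * kexp la 0 z + delta * kexp la la z.
have iN : mu.-integrable W (EFin \o (fun v => M v * kern_mass z v)).
  apply: (ge0_integrable W) => [|v Wv|].
  - apply: measurable_funM => //.
    exact: (measurable_fun_pair_r _ _ _ _ _ _ _ z measurable_kern_mass).
  - by rewrite mulr_ge0// kern_mass_ge0.
  have h := integral_M_kern_mass z; rewrite ltey; apply/eqP => hoo; move: h.
  by rewrite hoo gt0_muley ?lte_fin.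
have iM : mu.-integrable W (EFin \o (fun v => M v / den c la v)).
  exact: (integrable_Mden _ laE).
have iG : mu.-integrable W (EFin \o (fun v => a * (M v / den c la v) - M v * kern_mass z v)).
  apply: (integrable_add _ mW (fun v => a * (M v / den c la v)) (fun v => - (M v * kern_mass z v))).
    exact: integrable_scale.
  rewrite (_ : EFin \o _ = (fun v => (-1 * (M v * kern_mass z v))%:E)); last first.
    by apply/funext => v; rewrite /= mulN1r.
  exact: integrable_scale.
apply: (@le_trans _ _ (\int[mu]_(v in W)
   ((1 + r) * (a * (M v / den c la v) - M v * kern_mass z v))%:E)%E).
  rewrite [leRHS]integral_mkcond; apply: ge0_le_integral => //.
  - by move=> v _; rewrite lee_fin mulr_ge0 ?profG_ge0//; case/andP: (PM v).
  - apply/measurable_EFinP; apply: measurable_funM.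
      exact: (measurable_fun_pair_r _ _ _ _ _ _ _ z mP).
    exact: (measurable_fun_pair_r _ _ _ _ _ _ _ z measurable_profG).
  - apply/(measurable_restrictT _ _).1 => //; apply/measurable_EFinP; apply: measurable_funM => //.
    by case/integrableP : iG => /measurable_EFinP.
  move=> v _; rewrite patchE; case: ifPn => [|/negP]; rewrite inE => Wv; last by rewrite PW// mul0r.
  rewrite lee_fin (_ : _ - _ = M v * profG z v); last first.
    by rewrite profGE// /a; ring.
  by rewrite mulrA ler_wpM2r ?profG_ge0//; case/andP: (PM v).
rewrite -EFin_Rintegral//; last exact: (integrable_scale _ mW _ _ iG).
rewrite lee_fin RintegralZl// RintegralB//; last exact: integrable_scale.
rewrite RintegralZl// mulrBr.
have -> : (1 + r) * \int[mu]_(v in W) (M v * kern_mass z v) = expR (la * z) * (mass_damp z + gap_mass z).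
  by apply: EFin_inj; rewrite EFinM EFin_Rintegral// integral_M_kern_mass.
rewrite /flux_bound lerD2r mulrCA -/Mden_mass -[leRHS]mulr1 ler_wpM2l ?Mden_mass_le//.
have /andP[y0 y1] := kexp_la_range z.
by rewrite addr_ge0// mulr_ge0// ?(ltW de0)// kexp_be0 expR_ge0.
Qed.


Lemma slack_profG z v : W v -> 2 * slack z v * profG z v <= expR (la * z) * gap_mass z / 2.
Proof.
move=> Wv; have dl := den_pos _ _ laE Wv.
have s0 := slack_ge0 z v.
apply: (@le_trans _ _ (2 * slack z v * ((coefA + delta) * expR (la * z) / den c la v))).
  by rewrite ler_wpM2l ?profG_le// mulr_ge0.
rewrite /slack indic_in// mul1r /eta.
have r1' := lt0r_neq0 r1; have Ad' := lt0r_neq0 Ade0; have dl' := lt0r_neq0 dl.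
rewrite le_eqVlt; apply/orP; left; apply/eqP.
by field; rewrite dl' r1' Ad'.
Qed.

(** For z > 0, den la times e^(la z) / den la cancels the flux of the leading
    term; the flux delta of the second term and the slack are paid by the gain,
    which is at least 2 delta, and delta / den la remains for sigma.  For z <= 0,
    where rho_f >= 1/2, half of r rho_f G pays for the subtracted kernels and the
    other half remains for sigma. *)
Lemma profG_supersolution z v rh : W v -> 0 <= rh -> (z <= 0 -> 1 / 2 <= rh) ->
  flux_bound z + dissip * (rh + expR (- (la * pospart z))) * profG z v
    + 2 * slack z v * profG z v <=
  (1 + r * rh) * profG z v - (v - c) * dprofG z v.
Proof.
move=> Wv rh0 hrh; have dl := den_pos _ _ laE Wv.
have dl' := lt0r_neq0 dl.
have G0 := profG_ge0 z v; have Gl := profG_le z v Wv; have Gg := profG_ge z v Wv.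
have bG := slack_profG z v Wv.
have tr := kern_mass_transport z v Wv.
have c10 := ltW dissip_gt0.
have c1r : dissip <= r / 8 by rewrite ge_min lexx.
have c1d : dissip <= delta / (coefA + delta) by rewrite ge_min lexx orbT.
have E0 := expR_gt0 (la * z).
have GE := profGE z v Wv.
have [z0|z0] := ltP 0 z.
  rewrite z0 in tr.
  have pz : pospart z = z by rewrite /pospart max_l// ltW.
  have k1 : kexp la la z = 1 by rewrite kexpE pz -expRD subrr expR0.
  have Ee : expR (la * z) * expR (- (la * z)) = 1 by rewrite -expRD subrr expR0.
  (* The gain is at least gap_mass0 = 2 delta. *)
  have er := gap_mass_right z (ltW z0).
  rewrite /flux_bound /dprofG /dkexp z0 k1 kexp_be0 pz subr0 subrr mul0r mulr0 addr0.
  rewrite kexp_be0 k1 in GE.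
  have H : profG z v - (v - c) * (coefA * (la * expR (la * z)) / den c la v
      - \int[mu]_(v' in W) dkern z v v') =
    coefA * expR (la * z) + delta / den c la v - expR (la * z) * mass_damp z.
    rewrite GE -tr.
    move: dl'; rewrite /den; move: (kern_mass z v) (\int[mu]_(v' in W) _) => N I d'.
    by field.
  have H1 : dissip * rh * profG z v <= r * rh * profG z v.
    by rewrite ler_wpM2r// ler_wpM2r//; lra.
  (* The part of sigma that does not come from rho_f. *)
  have H2 : dissip * expR (- (la * z)) * profG z v <= delta / den c la v.
    apply: (@le_trans _ _ (delta / (coefA + delta) * expR (- (la * z)) *
        ((coefA + delta) * expR (la * z) / den c la v))).
      apply: ler_pM => //; first by rewrite mulr_ge0 ?expR_ge0.
      by rewrite ler_wpM2r ?expR_ge0.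
    have Ad' := lt0r_neq0 Ade0.
    rewrite (_ : _ * _ = delta / den c la v * (expR (la * z) * expR (- (la * z)))); last first.
      by field; rewrite dl' Ad'.
    by rewrite Ee mulr1.
  have de2 : gap_mass0 = 2 * delta by rewrite /delta; field.
  rewrite [X in _ <= X](_ : _ = r * rh * profG z v + (profG z v - (v - c) *
    (coefA * (la * expR (la * z)) / den c la v - \int[mu]_(v' in W) dkern z v v'))); last by ring.
  rewrite H; rewrite de2 in er; lra.
have pz : pospart z = 0 by rewrite /pospart max_r.
rewrite ltNge z0 /= in tr.
have k1 : kexp la la z = expR (la * z) by rewrite kexpE pz mulr0 oppr0 expR0 mulr1.
have z0' : (0 < z) = false by rewrite ltNge z0.
rewrite /flux_bound /dprofG /dkexp z0' k1 kexp_be0 pz mulr0 oppr0 expR0 /= addr0.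
rewrite gap_mass_left// in bG *; rewrite mass_damp_left//.
have rh2 := hrh z0.
rewrite kexp_be0 k1 in GE.
have H : profG z v - (v - c) * ((coefA * (la * expR (la * z)) + delta * (la * expR (la * z)))
     / den c la v - \int[mu]_(v' in W) dkern z v v') =
    coefA * expR (la * z) + delta * expR (la * z) - den c la v * kern_mass z v.
  rewrite GE -tr.
  move: dl'; rewrite /den; move: (kern_mass z v) (\int[mu]_(v' in W) _) => N I d'.
  by field.
(* The subtracted kernels, absorbed by r rho_f G since A is large. *)
have H3 : den c la v * kern_mass z v <= expR (la * z) * (D * volume).
  apply: (@le_trans _ _ (den c la v * (expR (la * z) * (D / den c la v) * volume))).
    by rewrite ler_wpM2l ?kern_mass_le// ltW.
  by rewrite le_eqVlt; apply/orP; left; apply/eqP; field.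
have H4 : expR (la * z) * (D * volume) <= r / 4 * profG z v.
  apply: (@le_trans _ _ (r / 4 * (coefA / 2 * expR (la * z) / D))); last first.
    rewrite ler_wpM2l ?divr_ge0 ?(ltW r0)//; apply: le_trans Gg.
    rewrite ler_wpM2l ?mulr_ge0 ?(ltW E0) ?divr_ge0// lef_pV2 ?posrE//.
    exact: den_leD.
  rewrite (_ : r / 4 * _ = expR (la * z) * (r * coefA / (8 * D))); last first.
    by field; exact: lt0r_neq0.
  rewrite ler_wpM2l ?(ltW E0)// ler_pdivlMr ?mulr_gt0//.
  have D0' := lt0r_neq0 D0; have r0' := lt0r_neq0 r0.
  rewrite (_ : r * coefA = 8 * D ^+ 2 * volume + 2 * volume * D * r); last first.
    by rewrite /coefA; field.
  have v0 : 0 <= 2 * volume * D * r by rewrite !mulr_ge0 ?volume_ge0 ?(ltW D0) ?(ltW r0).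
  rewrite expr2; lra.
have H5 : dissip * (rh + 1) * profG z v + r / 4 * profG z v <= r * rh * profG z v.
  rewrite -mulrDl ler_wpM2r//.
  have : dissip * (rh + 1) <= r / 8 * (rh + 1) by rewrite ler_wpM2r// addr_ge0.
  nra.
have v0 : 0 <= expR (la * z) * volume by rewrite mulr_ge0 ?volume_ge0 ?(ltW E0).
have e0 : 0 <= expR (la * z) * gap_mass0 by rewrite mulr_ge0 ?(ltW gap_mass0_gt0) ?(ltW E0).
rewrite [X in _ <= X](_ : _ = r * rh * profG z v + (profG z v - (v - c) *
  ((coefA * (la * expR (la * z)) + delta * (la * expR (la * z))) / den c la v
    - \int[mu]_(v' in W) dkern z v v'))); last by ring.
rewrite H; lra.
Qed.


Context (k wmax : R) (wmaxP : forall v, W v -> `|v - c| < wmax) (kP : 2 * la * wmax <= k).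

(** The constant k exceeds every rate times every speed, so that the time
    derivatives of e^(k t) kexp and e^(- k t) kexp along characteristics have
    a sign. *)
Lemma kexp_speed v al be z : W v -> `|al| <= la -> 0 <= be <= la ->
  `|(v - c) * dkexp al be z| <= k * kexp al be z.
Proof.
move=> Wv al_la /andP[be0 be_la].
have w0 : 0 <= wmax by apply: le_trans (ltW (wmaxP v Wv)).
rewrite /dkexp mulrA normrM (ger0_norm (ltW (kexp_gt0 _ _ _))).
rewrite ler_wpM2r ?(ltW (kexp_gt0 _ _ _))// normrM.
apply: le_trans kP; rewrite mulrC ler_pM// ?(ltW (wmaxP v Wv))//.
have h1 := ler_normB al (if 0 < z then be else 0).
have h2 : `|if 0 < z then be else 0| <= la.
  by case: ifP; rewrite ?normr0 ?(ltW la0)// ger0_norm.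
lra.
Qed.

Lemma kexp_rise_ge0 v al be z : W v -> `|al| <= la -> 0 <= be <= la ->
  0 <= k * kexp al be z + (v - c) * dkexp al be z.
Proof.
move=> Wv h1 h2; have := kexp_speed v al be z Wv h1 h2.
by rewrite ler_norml => /andP[h _]; rewrite -lerBlDl sub0r.
Qed.

Lemma kexp_decay_ge0 v al be z : W v -> `|al| <= la -> 0 <= be <= la ->
  0 <= k * kexp al be z - (v - c) * dkexp al be z.
Proof.
move=> Wv h1 h2; have := kexp_speed v al be z Wv h1 h2.
by rewrite ler_norml => /andP[_ h]; rewrite subr_ge0.
Qed.

Let laN : `|- la| <= la. Proof. by rewrite normrN ger0_norm// ltW. Qed.
Let laP : `|la| <= la. Proof. by rewrite ger0_norm// ltW. Qed.
Let be_0 : 0 <= (0 : R) <= la. Proof. by rewrite lexx ltW. Qed.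
Let be_k v : 0 <= kappa v <= la. Proof. by rewrite kappa_ge0 kappa_le. Qed.

Lemma measurable_kexp_line (q al be y w : R) :
  measurable_fun setT (fun s => expR (q * s) *
    (k * kexp al be (y + w * s) + w * dkexp al be (y + w * s))).
Proof.
have mz : measurable_fun setT (fun s => y + w * s).
  by apply: measurable_funD => //; exact: measurable_funM.
apply: measurable_funM; first exact: measurable_expR_scale.
by apply: measurable_funD; apply: measurable_funM => //;
  apply: measurableT_comp mz; [exact: measurable_kexp|exact: measurable_dkexp].
Qed.

Lemma measurable_kexp_lineB (q al be y w : R) :
  measurable_fun setT (fun s => expR (q * s) *
    (k * kexp al be (y + w * s) - w * dkexp al be (y + w * s))).
Proof.
have mz : measurable_fun setT (fun s => y + w * s).
  by apply: measurable_funD => //; exact: measurable_funM.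
apply: measurable_funM; first exact: measurable_expR_scale.
by apply: measurable_funB; apply: measurable_funM => //;
  apply: measurableT_comp mz; [exact: measurable_kexp|exact: measurable_dkexp].
Qed.

Lemma profF_path y v t : W v -> 0 <= t ->
  (\int[mu]_(s in `[0%R, t]) (expR (k * s) *
     (k * profF (y + (v - c) * s) v + (v - c) * dprofF (y + (v - c) * s) v))%:E =
   (expR (k * t) * profF (y + (v - c) * t) v - profF y v)%:E)%E.
Proof.
move=> Wv t0; set w := v - c.
pose m := M v / den c la v; pose j := eta * gap v.
have m0 : 0 <= m by exact: Mden_la_ge0.
have j0 : 0 <= j by rewrite mulr_ge0 ?gap_ge0// ltW// eta_gt0.
pose g be s := expR (k * s) * (k * kexp (- la) be (y + w * s) + w * dkexp (- la) be (y + w * s)).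
have mg be : measurable_fun setT (g be) by exact: (measurable_kexp_line _ _ _ _ _).
have g0 be s : 0 <= be <= la -> 0 <= g be s.
  by move=> h; rewrite mulr_ge0 ?expR_ge0// kexp_rise_ge0.
have mgE q be : measurable_fun `[0, t] (fun s => (q * g be s)%:E).
  apply/measurable_EFinP; apply: measurable_funTS; apply: measurable_funM => //.
transitivity (\int[mu]_(s in `[0%R, t]) ((m * g 0 s)%:E + (j * g (kappa v) s)%:E))%E.
  apply: eq_integral => s _; rewrite profFE// /dprofF -/m -/j -EFinD; congr EFin.
  by rewrite /g; ring.
rewrite ge0_integralD//; last 4 first.
- by move=> s _; rewrite lee_fin mulr_ge0 ?g0.
- exact: mgE.
- by move=> s _; rewrite lee_fin mulr_ge0 ?g0.
- exact: mgE.
have m0t : measurable `[0, t]%classic by [].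
rewrite (ge0_integral_scale _ m0t m (g 0))//; last by move=> s; exact: g0.
rewrite (ge0_integral_scale _ m0t j (g (kappa v)))//; last by move=> s; exact: g0.
rewrite !kexp_path// -!EFinM -EFinD !profFE// -/m -/j (mulr0 w) addr0 (mulr0 k) expR0; congr EFin; ring.
Qed.

Lemma kexp_path_decay v al be y a b : W v -> `|al| <= la -> 0 <= be <= la -> a <= b ->
  (\int[mu]_(s in `[a, b]) (expR (- k * s) * (k * kexp al be (y + (v - c) * s)
     - (v - c) * dkexp al be (y + (v - c) * s)))%:E =
   (expR (- k * a) * kexp al be (y + (v - c) * a)
     - expR (- k * b) * kexp al be (y + (v - c) * b))%:E)%E.
Proof.
move=> Wv h1 h2 ab; apply: oppe_inj.
rewrite -integral_ge0N; last first.
  by move=> s _; rewrite lee_fin mulr_ge0 ?expR_ge0// kexp_decay_ge0.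
rewrite -EFinN opprB -kexp_path//; apply: eq_integral => s _.
by rewrite -EFinN; congr EFin; ring.
Qed.

(** The kernels are integrated along the characteristic one velocity v' at a
    time, and Tonelli's theorem puts the pieces together. *)
Lemma profG_path y v a b : W v -> a <= b ->
  (\int[mu]_(s in `[a, b]) (expR (- k * s) *
     (k * profG (y + (v - c) * s) v - (v - c) * dprofG (y + (v - c) * s) v))%:E =
   (expR (- k * a) * profG (y + (v - c) * a) v
     - expR (- k * b) * profG (y + (v - c) * b) v)%:E)%E.
Proof.
move=> Wv ab; set w := v - c; have mab : measurable `[a, b]%classic by [].
have dl := den_pos _ _ laE Wv.
pose g be s := expR (- k * s) * (k * kexp la be (y + w * s) - w * dkexp la be (y + w * s)).
have mg be : measurable_fun setT (g be) by exact: measurable_kexp_lineB.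
have g0 be s : 0 <= be <= la -> 0 <= g be s.
  by move=> h; rewrite mulr_ge0 ?expR_ge0// kexp_decay_ge0.
have gi be : 0 <= be <= la -> mu.-integrable `[a, b] (EFin \o g be).
  move=> h; apply: (ge0_integrable _) => // [s _|]; first exact: g0.
  by rewrite kexp_path_decay// ltry.
pose A1 := coefA / den c la v; pose d1 := delta / den c la v.
pose n s := \int[mu]_(v' in W) (g (kappa v') s / den c (la - kappa v') v).
pose N s := expR (- k * s) * kern_mass (y + w * s) v.
have mq : measurable_fun setT (fun p : R * R => g (kappa p.2) p.1 / den c (la - kappa p.2) v).
  apply: measurable_funM; last first.
    apply: measurable_funV; apply: measurable_den2 => //.
    by apply: measurable_funB => //; apply: (measurableT_comp measurable_kappa).
  have mz : measurable_fun setT (fun p : R * R => y + w * p.1).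
    by apply: measurable_funD => //; exact: measurable_funM.
  apply: measurable_funM; first by apply: measurableT_comp => //; exact: measurable_funM.
  have mke : measurable_fun setT (fun p : R * R => kexp la (kappa p.2) (y + w * p.1)).
    exact: measurable_kexp2.
  apply: measurable_funB; apply: measurable_funM => //.
  apply: measurable_funM => //; apply: measurable_funB => //.
  by apply: measurable_fun_ifT => //; exact: measurable_fun_ltr.
have q0 s v' : 0 <= g (kappa v') s / den c (la - kappa v') v.
  by rewrite divr_ge0 ?g0// ltW// den_pos// rate_range.
have iker s : mu.-integrable W (EFin \o (fun v' => g (kappa v') s / den c (la - kappa v') v)).
  rewrite (_ : _ \o _ = (fun v' => (expR (- k * s) * k * kern (y + w * s) v v'
     + (- (expR (- k * s) * w)) * dkern (y + w * s) v v')%:E)); last first.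
    apply/funext => v' /=; congr EFin; rewrite /g /dkern /dkexp /kern /kslope; ring.
  apply: (integrable_add _ mW (fun v' => expR (- k * s) * k * kern (y + w * s) v v')
    (fun v' => (- (expR (- k * s) * w)) * dkern (y + w * s) v v')).
    exact: (integrable_scale _ mW _ _ (integrable_kern _ v Wv)).
  exact: (integrable_scale _ mW _ _ (integrable_dkern _ v Wv)).
have nE : (\int[mu]_(s in `[a, b]) (n s)%:E = (N a - N b)%:E)%E.
  transitivity (\int[mu]_(s in `[a, b]) \int[mu]_(v' in W) (g (kappa v') s / den c (la - kappa v') v)%:E)%E.
    by apply: eq_integral => s _; rewrite EFin_Rintegral.
  rewrite (Tonelli_set _ _ (fun p => (g (kappa p.2) p.1 / den c (la - kappa p.2) v)%:E))//; last 2 first.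
  - exact/measurable_EFinP.
  - by move=> x _ _; rewrite lee_fin q0.
  have ik s : mu.-integrable W (EFin \o (fun v' => expR (- k * s) * kern (y + w * s) v v')).
    exact: (integrable_scale _ mW _ _ (integrable_kern _ v Wv)).
  transitivity (\int[mu]_(v' in W) (expR (- k * a) * kern (y + w * a) v v'
     - expR (- k * b) * kern (y + w * b) v v')%:E)%E.
    apply: eq_integral => v' _.
    have dm := den_pos _ _ (rate_range v') Wv.
    transitivity (\int[mu]_(s in `[a, b])
        ((den c (la - kappa v') v)^-1 * g (kappa v') s)%:E)%E.
      by apply: eq_integral => s _; rewrite mulrC.
    rewrite (ge0_integral_scale _ mab _ (g (kappa v')))//; last 2 first.
    - by rewrite invr_ge0 ltW.
    - by move=> s; exact: g0.
    rewrite kexp_path_decay// -EFinM /kern -/w; congr EFin; ring.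
  rewrite -EFin_Rintegral//.
    congr EFin; rewrite RintegralB// /N /kern_mass !RintegralZl//; exact: integrable_kern.
  apply: (integrable_add _ mW (fun v' => expR (- k * a) * kern (y + w * a) v v')
    (fun v' => - (expR (- k * b) * kern (y + w * b) v v'))) => //.
  rewrite (_ : EFin \o _ = (fun v' => (-1 * (expR (- k * b) * kern (y + w * b) v v'))%:E)); last first.
    by apply/funext => v'; rewrite /= mulN1r.
  exact: integrable_scale.
have mn : measurable_fun setT n.
  exact: (measurable_set_Rintegral _ mW _ _ (fun p => g (kappa p.2) p.1 / den c (la - kappa p.2) v)).
have ni : mu.-integrable `[a, b] (EFin \o n).
  apply: (ge0_integrable _) => // [s _|]; first exact: Rintegral_ge0.
  by rewrite nE ltry.
have i1 := gi 0 be_0; have i2 := gi la laE.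
have i1' := integrable_scale _ mab A1 _ i1; have i2' := integrable_scale _ mab d1 _ i2.
have i12 := integrable_add _ mab _ _ i1' i2'.
transitivity (\int[mu]_(s in `[a, b]) ((A1 * g 0 s + d1 * g la s)%:E - (n s)%:E))%E.
  apply: eq_integral => s _; rewrite -EFinB; congr EFin.
  rewrite profGE// /dprofG mulrBr.
  have -> : n s = expR (- k * s) * (k * kern_mass (y + w * s) v
      - w * \int[mu]_(v' in W) dkern (y + w * s) v v').
    rewrite mulrBr !mulrA /kern_mass -!RintegralZl//; last 2 first.
    - exact: integrable_dkern.
    - exact: integrable_kern.
    rewrite -RintegralB//; last 2 first.
    - exact: (integrable_scale _ mW _ _ (integrable_kern _ v Wv)).
    - exact: (integrable_scale _ mW _ _ (integrable_dkern _ v Wv)).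
    apply: eq_Rintegral => v' _; rewrite /g /dkern /dkexp /kern /kslope; ring.
  rewrite /A1 /d1 /g; ring.
rewrite integralB_EFin// nE -EFin_Rintegral//.
have gR be : 0 <= be <= la -> \int[mu]_(s in `[a, b]) g be s =
    expR (- k * a) * kexp la be (y + w * a) - expR (- k * b) * kexp la be (y + w * b).
  move=> h; apply: EFin_inj; rewrite EFin_Rintegral//; last exact: gi.
  exact: kexp_path_decay.
rewrite -EFinB; congr EFin.
rewrite RintegralD// !RintegralZl// !gR//.
rewrite !profGE// /N /A1 /d1; ring.
Qed.


Context (kP2 : 1 + r + 2 * ((1 + r) * eta * gap_mass0 * D) <= k).
Context (zs : R) (rf : R -> R) (P : R -> R -> R).
Context (mrf : measurable_fun setT rf) (rf01 : forall z, 0 <= rf z <= 1)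
  (rf_left : forall z, z <= zs -> 1 / 2 <= rf z).
Context (mP : measurable_fun setT (fun x : R * R => P x.1 x.2))
  (P0 : forall z v, 0 <= P z v) (PMr : forall z v, P z v <= (1 + r) * M v)
  (PW : forall z v, ~ W v -> P z v = 0).

(** From here on z is the original variable, and zs the point z_*. *)
Definition wF (z v : R) : R := profF (z - zs) v.
Definition wG (z v : R) : R := profG (z - zs) v.
Definition wslack (z v : R) : R := slack (z - zs) v.
Definition wsigma (z v : R) : R := dissip * (rf z + expR (- (la * pospart (z - zs)))).
Definition wabsorb (z : R) : R := 1 + r * rf z.

Lemma measurable_shifted (f : R -> R -> R) : measurable_fun setT (fun x : R * R => f x.1 x.2) ->
  measurable_fun setT (fun x : R * R => f (x.1 - zs) x.2).
Proof.
move=> mf; apply: (@measurableT_comp _ _ _ _ _ _ (fun x : R * R => f x.1 x.2) _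
  (fun x : R * R => (x.1 - zs, x.2)) mf).
by apply/measurable_fun_pair => //=; exact: measurable_funB.
Qed.

Lemma measurable_wabsorb : measurable_fun setT wabsorb.
Proof. by apply: measurable_funD => //; exact: measurable_funM. Qed.

Lemma measurable_wsigma : measurable_fun setT (fun x : R * R => wsigma x.1 x.2).
Proof.
apply: measurable_funM => //; apply: measurable_funD; first exact: measurableT_comp.
apply: measurableT_comp => //; apply: measurableT_comp => //; apply: measurable_funM => //.
by apply: measurable_maxr => //; exact: measurable_funB.
Qed.

Lemma wabsorb_range z : 0 <= wabsorb z <= k.
Proof.
have /andP[h0 h1] := rf01 z.
have rh : 0 <= r * rf z <= r by rewrite mulr_ge0 ?(ltW r0)//= ler_piMr// ltW.
have e0 : 0 <= (1 + r) * eta * gap_mass0 * D.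
  by rewrite !mulr_ge0 ?(ltW gap_mass0_gt0) ?(ltW r1) ?(ltW eta_gt0) ?(ltW D0).
rewrite /wabsorb; move/andP : rh => [rh0 rh1]; rewrite addr_ge0//=.
apply: le_trans kP2; rewrite -[leLHS]addr0; apply: lerD; first by rewrite lerD2l.
by rewrite mulr_ge0.
Qed.

Lemma wslack_le z v : 2 * wslack z v <= k - wabsorb z.
Proof.
have /andP[h0 h1] := rf01 z.
have rh : r * rf z <= r by rewrite ler_piMr// ltW.
rewrite lerBrDl; apply: le_trans kP2; apply: lerD; first by rewrite lerD2l.
by rewrite ler_wpM2l// slack_le.
Qed.

Lemma wsigma_ge0 z v : 0 <= wsigma z v.
Proof.
by rewrite mulr_ge0 ?(ltW dissip_gt0)// addr_ge0 ?expR_ge0//; case/andP : (rf01 z).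
Qed.

Lemma massF_wF z : massF W wF z = massF W profF (z - zs).
Proof. by []. Qed.

Lemma fluxG_wG z : fluxG P wG z = fluxG (fun z' => P (z' + zs)) profG (z - zs).
Proof. by rewrite /fluxG subrK. Qed.

Lemma fluxG_wG_le z : (fluxG P wG z <= (flux_bound (z - zs))%:E)%E.
Proof.
rewrite fluxG_wG; apply: fluxG_profG.
- apply: (@measurableT_comp _ _ _ _ _ _ (fun x : R * R => P x.1 x.2) _
    (fun x : R * R => (x.1 + zs, x.2)) mP).
  by apply/measurable_fun_pair => //=; exact: measurable_funD.
- by move=> v; rewrite subrK P0 PMr.
- by move=> v Wv; rewrite PW.
Qed.

Lemma fluxG_wG_ge0 z : (0 <= fluxG P wG z)%E.
Proof. by apply: integral_ge0 => v _; rewrite lee_fin mulr_ge0 ?profG_ge0. Qed.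

Lemma fluxG_wG_loc L : exists C : R,
   forall z, `|z| <= L -> (fluxG P wG z <= C%:E)%E.
Proof.
exists ((coefA + delta) * expR (la * (L + `|zs|))) => z zL.
apply: le_trans (fluxG_wG_le z) _; rewrite lee_fin /flux_bound.
have /andP[y0 y1] := kexp_la_range (z - zs).
have e1 : expR (la * (z - zs)) <= expR (la * (L + `|zs|)).
  rewrite ler_expR ler_wpM2l ?(ltW la0)//.
  apply: le_trans (ler_norm _) _; apply: le_trans (ler_normB _ _) _.
  by rewrite lerD2r.
have h0 : 0 <= expR (la * (z - zs)) * (mass_damp (z - zs) + gap_mass (z - zs)).
  rewrite mulr_ge0 ?expR_ge0// addr_ge0 ?gap_mass_ge0//.
  by apply: Rintegral_ge0 => v _; case/andP: (damp_range (z - zs) v).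
apply: (@le_trans _ _ ((coefA + delta) * expR (la * (z - zs)))); last first.
  by rewrite ler_wpM2l// ltW.
rewrite kexp_be0 (mulrDl coefA delta) lerBlDr -addrA lerD2l.
apply: (@le_trans _ _ (delta * expR (la * (z - zs)))); first by rewrite ler_wpM2l// ltW.
by rewrite lerDl.
Qed.

Lemma path_shift y v s : y + (v - c) * s - zs = y - zs + (v - c) * s.
Proof. by rewrite addrAC. Qed.

Lemma wF_rise y v t : W v -> 0 <= t ->
  ((wF y v)%:E + \int[mu]_(s in `[0%R, t]) ((expR (k * s))%:E *
     ((P (path_of c (s, (y, v))).1 v)%:E * massF W wF (path_of c (s, (y, v))).1 +
      ((k - wabsorb (path_of c (s, (y, v))).1 - wslack (path_of c (s, (y, v))).1 v) *
        wF (path_of c (s, (y, v))).1 v)%:E)) <=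
   (expR (k * t) * wF (path_of c (t, (y, v))).1 v)%:E)%E.
Proof.
move=> Wv t0.
have := profF_path (y - zs) v t Wv t0; rewrite -path_shift => H.
have {}H : ((wF y v)%:E + \int[mu]_(s in `[0%R, t]) (expR (k * s) *
     (k * profF (y - zs + (v - c) * s) v + (v - c) * dprofF (y - zs + (v - c) * s) v))%:E)%E
   = (expR (k * t) * wF (path_of c (t, (y, v))).1 v)%:E.
  by rewrite H -EFinD /wF /path_of/=; congr EFin; ring.
rewrite -[leRHS]H; apply: leeD2l.
pose h (z : R) := P z v * (expR (- la * (z - zs)) * (Mden_mass + eta * gap_mass (z - zs)))
   + (k - wabsorb z - wslack z v) * wF z v.
have mw : measurable_fun setT (fun s : R => y + (v - c) * s).
  by apply: measurable_funD => //; exact: measurable_funM.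
have mz : measurable_fun setT (fun z : R => z - zs) by exact: measurable_funB.
have mh : measurable_fun setT h.
  apply: measurable_funD; apply: measurable_funM.
  - exact: (measurable_fun_pair_l _ _ _ _ _ _ _ v mP).
  - apply: measurable_funM; first by apply: measurableT_comp => //; exact: measurable_funM.
    apply: measurable_funD => //; apply: measurable_funM => //.
    by apply: (measurableT_comp measurable_gap_mass).
  - apply: measurable_funB; first by apply: measurable_funB => //; exact: measurable_wabsorb.
    exact: (measurable_fun_pair_l _ _ _ _ _ _ _ v (measurable_shifted _ measurable_slack)).
  - exact: (measurable_fun_pair_l _ _ _ _ _ _ _ v (measurable_shifted _ measurable_profF)).
have h0 z : 0 <= h z.
  apply: addr_ge0.
    apply: mulr_ge0 => //; apply: mulr_ge0; first exact: expR_ge0.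
    by apply: addr_ge0; [exact: Mden_mass_ge0|rewrite mulr_ge0 ?gap_mass_ge0 ?(ltW eta_gt0)].
  apply: mulr_ge0; last exact/ltW/profF_gt0.
  by have := wslack_le z v; have := slack_ge0 (z - zs) v; rewrite -/(wslack z v); lra.
have hle s : expR (k * s) * h (y + (v - c) * s) <= expR (k * s) *
     (k * profF (y - zs + (v - c) * s) v + (v - c) * dprofF (y - zs + (v - c) * s) v).
  rewrite ler_wpM2l ?expR_ge0// -path_shift /h /wF /wslack /wabsorb.
  set z := y + _.
  have := profF_supersolution (z - zs) v (P z v) (rf z) Wv _ _.
  have /andP[h1 _] := rf01 z; rewrite P0 PMr => /(_ h1 isT); lra.
rewrite (_ : (\int[mu]_(s in _) _)%E =
    (\int[mu]_(s in `[0%R, t]) (expR (k * s) * h (y + (v - c) * s))%:E)%E); last first.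
  apply: eq_integral => s _; rewrite /path_of/= massF_wF massF_profF.
  by rewrite [RHS]EFinM; congr (_ * _)%E; rewrite /h [RHS]EFinD; congr (_ + _)%E.
have mS : measurable_fun setT (fun s : R => expR (k * s) *
    (k * profF (y - zs + (v - c) * s) v + (v - c) * dprofF (y - zs + (v - c) * s) v)).
  have mw' : measurable_fun setT (fun s : R => y - zs + (v - c) * s).
    by apply: measurable_funD => //; exact: measurable_funM.
  apply: measurable_funM; first exact: measurable_expR_scale.
  have mFv : measurable_fun setT (fun z => profF z v).
    exact: (measurable_fun_pair_l _ _ _ _ _ _ _ v measurable_profF).
  apply: measurable_funD; apply: measurable_funM => //; first exact: (measurableT_comp mFv).
  by apply: measurable_funD; apply: measurable_funM => //;
    apply: measurableT_comp mw'; exact: measurable_dkexp.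
apply: ge0_le_integral => //.
- by move=> s _; rewrite lee_fin mulr_ge0 ?expR_ge0.
- apply/measurable_EFinP; apply: measurable_funTS.
  apply: measurable_funM; first exact: measurable_expR_scale.
  exact: (measurableT_comp mh).
- by apply/measurable_EFinP; apply: measurable_funTS.
- by move=> s _; rewrite lee_fin.
Qed.

Lemma wG_decay y v s t : W v -> 0 <= s <= t ->
  ((expR (- k * t) * wG (path_of c (t, (y, v))).1 v)%:E +
   \int[mu]_(x in `[s, t]) ((expR (- k * x))%:E *
     ((fluxG P wG (path_of c (x, (y, v))).1 +
        (wsigma (path_of c (x, (y, v))).1 v * wG (path_of c (x, (y, v))).1 v)%:E) +
      ((k - wabsorb (path_of c (x, (y, v))).1 + 2 * wslack (path_of c (x, (y, v))).1 v) *
        wG (path_of c (x, (y, v))).1 v)%:E)) <=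
   (expR (- k * s) * wG (path_of c (s, (y, v))).1 v)%:E)%E.
Proof.
move=> Wv /andP[s0 st].
have H := profG_path (y - zs) v s t Wv st; rewrite -!path_shift in H.
rewrite /path_of/=.
have {}H : ((expR (- k * t) * wG (y + (v - c) * t) v)%:E +
    \int[mu]_(x in `[s, t]) (expR (- k * x) * (k * profG (y - zs + (v - c) * x) v
      - (v - c) * dprofG (y - zs + (v - c) * x) v))%:E)%E
   = (expR (- k * s) * wG (y + (v - c) * s) v)%:E.
  by rewrite /wG H -EFinD addrC subrK.
rewrite -[leRHS]H; apply: leeD2l.
have mw : measurable_fun setT (fun s : R => y + (v - c) * s).
  by apply: measurable_funD => //; exact: measurable_funM.
have mw' : measurable_fun setT (fun s : R => y - zs + (v - c) * s).
  by apply: measurable_funD => //; exact: measurable_funM.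
have mGv : measurable_fun setT (fun z => profG z v).
  exact: (measurable_fun_pair_l _ _ _ _ _ _ _ v measurable_profG).
have mdG : measurable_fun setT (fun z => dprofG z v).
  rewrite /dprofG; apply: measurable_funB.
    apply: measurable_funM => //; apply: measurable_funD; apply: measurable_funM => //;
      exact: measurable_dkexp.
  apply: (measurable_set_Rintegral _ mW _ _ (fun p => dkern p.1 v p.2)).
  apply: (@measurableT_comp _ _ _ _ _ _ (fun x : (R * R) * R => dkern x.1.1 x.1.2 x.2) _
    (fun p : R * R => ((p.1, v), p.2)) measurable_dkern).
  by apply/measurable_fun_pair => //=; exact/measurable_fun_pair.
have mdrift : measurable_fun setT (fun z => k * profG z v - (v - c) * dprofG z v).
  apply: (measurable_funB (measurable_funM (measurable_cst k) mGv)).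
  exact: (measurable_funM (measurable_cst (v - c)) mdG).
have mwG : measurable_fun setT (fun z => wG z v).
  exact: (measurable_fun_pair_l _ _ _ _ _ _ _ v (measurable_shifted _ measurable_profG)).
have mwb : measurable_fun setT (fun z => wslack z v).
  exact: (measurable_fun_pair_l _ _ _ _ _ _ _ v (measurable_shifted _ measurable_slack)).
have mwsg : measurable_fun setT (fun z => wsigma z v).
  exact: (measurable_fun_pair_l _ _ _ _ _ _ _ v measurable_wsigma).
have mflux : measurable_fun setT (fluxG P wG).
  apply: (@measurable_parametric_integral _ _ _ _ _ mu (fun x => (P x.1 x.2 * wG x.1 x.2)%:E)).
  by apply/measurable_EFinP; apply: measurable_funM => //; exact: measurable_shifted measurable_profG.
have kb z : 0 <= k - wabsorb z + 2 * wslack z v.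
  have := wslack_le z v; have := slack_ge0 (z - zs) v; rewrite -/(wslack z v); lra.
pose g (z : R) : \bar R := (fluxG P wG z + (wsigma z v * wG z v)%:E +
  ((k - wabsorb z + 2 * wslack z v) * wG z v)%:E)%E.
have mg : measurable_fun setT g.
  apply: emeasurable_funD.
    apply: emeasurable_funD => //; apply/measurable_EFinP; exact: measurable_funM.
  apply/measurable_EFinP; apply: measurable_funM => //; apply: measurable_funD.
    by apply: measurable_funB => //; exact: measurable_wabsorb.
  exact: measurable_funM.
have g0 z : (0 <= g z)%E.
  apply: adde_ge0; last by rewrite lee_fin mulr_ge0// profG_ge0.
  by apply: adde_ge0; [exact: fluxG_wG_ge0|rewrite lee_fin mulr_ge0 ?wsigma_ge0 ?profG_ge0].
have gle x : (g (y + (v - c) * x)%R <=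
   (k * profG (y - zs + (v - c) * x) v - (v - c) * dprofG (y - zs + (v - c) * x) v)%:E)%E.
  rewrite -path_shift; set z := y + _.
  apply: (@le_trans _ _ ((flux_bound (z - zs))%:E + (wsigma z v * wG z v)%:E +
     ((k - wabsorb z + 2 * wslack z v) * wG z v)%:E)%E).
    by rewrite leeD2r// leeD2r// fluxG_wG_le.
  rewrite -!EFinD lee_fin.
  have /andP[h1 _] := rf01 z.
  have hl : z - zs <= 0 -> 1 / 2 <= rf z by rewrite subr_le0; exact: rf_left.
  have := profG_supersolution (z - zs) v (rf z) Wv h1 hl.
  rewrite /wG /wsigma /wslack /wabsorb; lra.
have gfin x : 0 <= k * profG (y - zs + (v - c) * x) v - (v - c) * dprofG (y - zs + (v - c) * x) v.
  by rewrite -lee_fin; apply: le_trans (gle x).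
apply: ge0_le_integral => //.
- by move=> x _; rewrite mule_ge0 ?lee_fin ?expR_ge0//; exact: g0.
- apply: emeasurable_funM.
    by apply/measurable_EFinP; exact: measurable_expR_scale.
  by apply: measurable_funTS; exact: (measurableT_comp mg).
- apply/measurable_EFinP; apply: measurable_funTS; apply: measurable_funM.
    exact: measurable_expR_scale.
  exact: (measurableT_comp mdrift mw').
- by move=> x _; rewrite [leRHS]EFinM; apply: lee_wpmul2l; [rewrite lee_fin expR_ge0|exact: gle].
Qed.


Lemma coefA_gt0 : 0 < coefA.
Proof.
have v0 : 0 < volume by rewrite fine_gt0// W0.
by apply: ltr_wpDl; rewrite ?mulr_gt0// divr_ge0 ?(ltW r0)// mulr_ge0 ?(ltW v0)// mulr_ge0 ?sqr_ge0.
Qed.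

Lemma wG_gt0 z v : W v -> 0 < wG z v.
Proof.
move=> Wv; apply: lt_le_trans (profG_ge (z - zs) v Wv).
by rewrite divr_gt0 ?den_pos// mulr_gt0 ?expR_gt0// divr_gt0 ?coefA_gt0.
Qed.

(** The denominators den la cancel in F / G, so the ratio is locally bounded
    uniformly in v although F and G may blow up as v tends to vmax. *)
Lemma wF_wG_ratio z v : W v ->
  wF z v / wG z v <= (MB + eta * D ^+ 2) * (2 / coefA) * expR (- (2 * la) * (z - zs)).
Proof.
move=> Wv; have dl := den_pos _ _ laE Wv.
have dD := den_leD v Wv.
have A0 := coefA_gt0; have e0 := eta_gt0.
set ze := z - zs.
have F1 : wF z v <= (MB + eta * D ^+ 2) / den c la v * expR (- la * ze).
  have /andP[y0 y1] := damp_range ze v.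
  rewrite /wF profFE// -/ze kexp_be0 kexp_damp.
  rewrite (_ : _ + _ = (M v / den c la v + eta * gap v * damp ze v) * expR (- la * ze)); last by ring.
  rewrite ler_wpM2r ?expR_ge0// ler_pdivlMr// mulrDl divfK ?lt0r_neq0//; apply: lerD => //.
  rewrite -(mulrA eta) -(mulrA eta) ler_wpM2l ?(ltW e0)// expr2.
  by case/andP : (gap_damp_range ze v) => h0 h1; rewrite ler_pM ?(ltW dl).
have G1 : coefA / 2 * expR (la * ze) / den c la v <= wG z v by exact: profG_ge.
have G0 := wG_gt0 z v Wv.
rewrite ler_pdivrMr//.
have -> : expR (- (2 * la) * ze) = expR (- la * ze) * expR (- la * ze).
  by rewrite -expRD; congr expR; ring.
have Ee : expR (- la * ze) * expR (la * ze) = 1.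
  by rewrite -expRD mulNr addNr expR0.
have C0 : 0 <= MB + eta * D ^+ 2.
  rewrite addr_ge0 ?mulr_ge0 ?(ltW e0) ?(ltW D0)//.
  exact: le_trans (M0 v) (MB_ v).
apply: le_trans F1 _.
apply: le_trans (_ : _ <= (MB + eta * D ^+ 2) * (2 / coefA) * (expR (- la * ze) * expR (- la * ze))
   * (coefA / 2 * expR (la * ze) / den c la v)) _; last first.
  by rewrite ler_wpM2l// !mulr_ge0 ?expR_ge0 ?invr_ge0 ?(ltW A0).
rewrite (_ : _ * (_ / den c la v) = (MB + eta * D ^+ 2) / den c la v * expR (- la * ze) *
   (expR (- la * ze) * expR (la * ze))); last first.
  by field; rewrite !lt0r_neq0.
by rewrite Ee mulr1.
Qed.

Lemma wsigma_left z0 z v : z <= z0 -> dissip * expR (- (la * pospart (z0 - zs))) <= wsigma z v.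
Proof.
move=> zz; rewrite /wsigma ler_wpM2l ?(ltW dissip_gt0)//.
have /andP[h _] := rf01 z; rewrite -[leLHS]add0r lerD// ler_expR lerN2 ler_wpM2l ?(ltW la0)//.
by rewrite /pospart ge_max le_max le_max lerD2r zz lexx orbT.
Qed.

Lemma wsigma_right z v : dissip * rf z <= wsigma z v.
Proof. by rewrite /wsigma ler_wpM2l ?(ltW dissip_gt0)// lerDl expR_ge0. Qed.

Lemma measurable_wF : measurable_fun setT (fun x : R * R => wF x.1 x.2).
Proof. exact: measurable_shifted measurable_profF. Qed.

Lemma measurable_wG : measurable_fun setT (fun x : R * R => wG x.1 x.2).
Proof. exact: measurable_shifted measurable_profG. Qed.

Lemma profile_energy (u : R -> R -> R -> R) (u0 : R -> R -> R) : 0 < wmax ->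
  measurable_fun setT (fun p : R * (R * R) => u p.1 p.2.1 p.2.2) ->
  (forall t z v, ~ W v -> u t z v = 0) ->
  measurable_fun setT (fun x : R * R => u0 x.1 x.2) ->
  (forall T L : R, (\int[mu]_(s in `[0%R, T]) \int[mu]_(z in `[(- L)%R, L])
     \int[mu]_v `|u s z v|%:E < +oo)%E) ->
  (forall t, 0 <= t -> {ae (mu \x mu)%E, forall x : R * R, W x.2 ->
   u t x.1 x.2 = u0 (x.1 - (x.2 - c) * t) x.2 +
     \int[mu]_(s in `[0, t]) ksource P wabsorb u s (x.1 - (x.2 - c) * (t - s)) x.2}) ->
  forall t, 0 <= t ->
  (\int[(mu \x mu)%E]_x (`|u t x.1 x.2| ^+ 2 / wF x.1 x.2 * wG x.1 x.2)%:E +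
   \int[mu]_(s in `[0%R, t]) \int[(mu \x mu)%E]_x
      (`|u s x.1 x.2| ^+ 2 / wF x.1 x.2 * (wsigma x.1 x.2 * wG x.1 x.2))%:E <=
   \int[(mu \x mu)%E]_x (`|u0 x.1 x.2| ^+ 2 / wF x.1 x.2 * wG x.1 x.2)%:E)%E.
Proof.
move=> wmax0 mu_ uW mu0 uloc mild t t0.
apply: (weighted_energy c wmax k W P wF wG wslack wsigma wabsorb ((1 + r) * MB)) => //.
- by move=> z v; apply: le_trans (PMr z v) _; rewrite ler_wpM2l// ltW.
- exact: measurable_wabsorb.
- exact: wabsorb_range.
- exact: measurable_wF.
- exact: measurable_wG.
- exact: measurable_shifted measurable_slack.
- exact: measurable_wsigma.
- by move=> z v; exact: profF_gt0.
- by move=> z v; exact: profG_ge0.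
- by move=> z v; exact: slack_ge0.
- exact: wslack_le.
- exact: wsigma_ge0.
- exact: wF_rise.
- exact: wG_decay.
- exact: fluxG_wG_loc.
Qed.
End Profiles.

(** * The wave and its density *)

Section PlaneMeasurability.
Context {R : realType}.

(** Open sets of the plane are countable unions of rational boxes. *)
Lemma open_measurable_plane (O : set (R * R)) : open O -> measurable O.
Proof.
move=> oO.
pose box (q : rat * rat * rat) : set (R * R) :=
  `](ratr q.1.1 - ratr q.2), (ratr q.1.1 + ratr q.2)[ `*`
  `](ratr q.1.2 - ratr q.2), (ratr q.1.2 + ratr q.2)[.
pose F q := if `[< box q `<=` O >] then box q else set0.
have -> : O = \bigcup_q F q.
  apply/seteqP; split => [[x y] Oxy|p [q _]]; last first.
    by rewrite /F; case: asboolP => // h; exact: h.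
  have /nbhs_ballP[e /= e0 He] : nbhs (x, y) O by move: oO; rewrite openE => /(_ _ Oxy).
  have e2 : 0 < e / 2 by rewrite divr_gt0.
  have [d] := rat_in_itvoo e2; rewrite in_itv/= => /andP[d0 de].
  have xd : x - ratr d < x + ratr d by lra.
  have yd : y - ratr d < y + ratr d by lra.
  have [a] := rat_in_itvoo xd; rewrite in_itv/= => /andP[a1 a2].
  have [b] := rat_in_itvoo yd; rewrite in_itv/= => /andP[b1 b2].
  exists (a, b, d) => //; rewrite /F; case: asboolP => [_|]; last first.
    case=> -[x' y'] [/=]; rewrite !in_itv/= => /andP[p1 p2] /andP[p3 p4].
    apply: He; split => /=; rewrite /ball/= ltr_norml; apply/andP; split; lra.
  by split; rewrite /= in_itv/=; apply/andP; split; lra.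
apply: countable_bigcupT_measurable; first exact: countableP.
move=> q; rewrite /F; case: asboolP => // _; apply: measurableX; exact: measurable_itv.
Qed.

Lemma within_continuous_measurable (A : set (R * R)) (f : R * R -> R) :
  measurable A -> {within A, continuous f} -> measurable_fun A f.
Proof.
move=> mA /continuousP cf; apply: (measurability _ (RGenOpens.measurableE R)).
move=> _ [_ [a [b ->] <-]].
have oab : open (`]a, b[%classic : set R) by apply: interval_open.
have /open_subspaceP[U oU UA] := cf _ oab.
rewrite setIC -UA; apply: measurableI => //; exact: open_measurable_plane.
Qed.
End PlaneMeasurability.

Section WaveDensity.
Context {R : realType}.
Notation mu := (@lebesgue_measure R).
Context (r c : R) (V : set R) (M : R -> R) (f : R -> R -> R).
Context (VM : velocity_model V M) (f_wave : travelling_wave r V M c f).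

(** The wave set to 0 off Vreg, as a measurable function on the whole plane. *)
Definition freg (z v : R) : R := \1_(Vreg V) v * f z v.

Let mW : measurable (Vreg V). Proof. exact: Vreg_measurable VM. Qed.

Lemma phase_space_measurable : measurable (phase_space V : set (R * R)).
Proof. by apply: measurableX => //; exact: V_measurable VM. Qed.

Lemma measurable_wave : measurable_fun (phase_space V) (fun x : R * R => f x.1 x.2).
Proof.
apply: within_continuous_measurable; first exact: phase_space_measurable.
exact: tw_continuous f_wave.
Qed.

Lemma measurable_patch_phase (g : R -> R -> R) :
  measurable_fun (phase_space V) (fun x : R * R => g x.1 x.2) ->
  measurable_fun setT (fun x : R * R => \1_(Vreg V) x.2 * g x.1 x.2).
Proof.
move=> mg.
have mS : measurable (setT `*` Vreg V : set (R * R)) by exact: measurableX.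
rewrite (_ : (fun x => _) = (fun x : R * R => g x.1 x.2) \_ (setT `*` Vreg V)); last first.
  apply/funext => x; rewrite patchE indicE; case: ifPn => [|/negP]; rewrite inE => xW.
    by rewrite mem_set ?mul1r//; case: xW.
  by rewrite memNset ?mul0r// => h; apply: xW.
have mg' : measurable_fun (setT `*` Vreg V) (fun x : R * R => g x.1 x.2).
  apply: measurable_funS mg; first exact: phase_space_measurable.
  by move=> x [_ [Vx _]]; split.
exact: (measurable_restrictT _ mS).1.
Qed.

Lemma measurable_freg : measurable_fun setT (fun x : R * R => freg x.1 x.2).
Proof. exact: measurable_patch_phase measurable_wave. Qed.

Lemma freg_range z v : 0 <= freg z v <= Mreg V M v.
Proof.
rewrite /freg /Mreg indicE patchE; case: ifPn => [|_]; last by rewrite mul0r lexx.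
by rewrite inE mul1r => -[Vv _]; exact: tw_bounds f_wave z v Vv.
Qed.

Lemma measurable_wave_V z : measurable_fun V (f z).
Proof.
have h := measurable_wave.
apply: (@measurable_comp _ _ _ _ _ _ (phase_space V) (fun x : R * R => f x.1 x.2) V (fun v => (z, v))) => //.
- exact: phase_space_measurable.
- by move=> _ [v Vv <-].
- by apply: measurable_funTS; apply/measurable_fun_pair.
Qed.

Lemma rho_Vreg (g : R -> R) : measurable_fun V g ->
  rho V g = \int[mu]_(v in Vreg V) (\1_(Vreg V) v * g v).
Proof.
move=> mg; rewrite /rho /Rintegral; congr fine.
rewrite -(integral_Vreg V M VM (fun v => (g v)%:E)); last exact/measurable_EFinP.
by apply: eq_integral => v vW; rewrite indicE vW mul1r.
Qed.

Lemma rho_freg z : rho V (f z) = \int[mu]_(v in Vreg V) freg z v.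
Proof. exact: rho_Vreg (measurable_wave_V z). Qed.

Lemma integrable_Mreg : mu.-integrable (Vreg V) (EFin \o Mreg V M).
Proof.
apply: (ge0_integrable (Vreg V)).
- exact: measurable_Mreg VM.
- by move=> v _; exact: Mreg_ge0 VM v.
- by rewrite (mass_Mreg V M VM) ltry.
Qed.

Lemma measurable_rho_wave : measurable_fun setT (fun z => rho V (f z)).
Proof.
under eq_fun do rewrite rho_freg.
exact: (measurable_set_Rintegral _ mW _ _ (fun p => freg p.1 p.2) measurable_freg).
Qed.

Lemma measurable_freg1 z : measurable_fun setT (freg z).
Proof. exact: (measurable_fun_pair_r _ _ _ _ _ _ _ z measurable_freg). Qed.

Lemma integrable_freg z : mu.-integrable (Vreg V) (EFin \o freg z).
Proof.
apply: le_integrable integrable_Mreg => //.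
  by apply/measurable_EFinP; apply: measurable_funTS; exact: measurable_freg1.
move=> v _ /=; have /andP[h0 h1] := freg_range z v.
by rewrite lee_fin !ger0_norm// (le_trans h0).
Qed.

Lemma rho_wave_range z : 0 <= rho V (f z) <= 1.
Proof.
rewrite rho_freg; apply/andP; split.
  by apply: Rintegral_ge0 => v _; case/andP: (freg_range z v).
have -> : 1 = \int[mu]_(v in Vreg V) Mreg V M v :> R.
  by apply: EFin_inj; rewrite EFin_Rintegral// ?(mass_Mreg V M VM)//; exact: integrable_Mreg.
apply: le_Rintegral => //; [exact: integrable_freg|exact: integrable_Mreg|].
by move=> v _; case/andP: (freg_range z v).
Qed.

(** Dominated convergence along a sequence tending to -oo. *)
Lemma rho_wave_left : exists zs, forall z, z <= zs -> 1 / 2 <= rho V (f z).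
Proof.
apply: contrapT => /forallNP h.
have /choice[zn hzn] : forall n : nat, exists z, z <= - n%:R /\ rho V (f z) < 1 / 2.
  move=> n; have /existsNP[z /not_implyP[h1 /negP h2]] := h (- n%:R).
  by exists z; split => //; rewrite ltNge.
have zn_oo : zn n @[n --> \oo] --> -oo.
  apply/cvgrNyPle => A; near=> n; apply: le_trans (proj1 (hzn n)) _.
  by rewrite lerNl; near: n; exact: nbhs_infty_ger.
have cvgM v : Vreg V v -> (freg (zn n) v)%:E @[n --> \oo] --> (Mreg V M v)%:E.
  move=> Wv; apply: cvg_EFin; first by near=> n.
  have -> : fine \o (fun n => (freg (zn n) v)%:E) = (fun n => f (zn n) v).
    by apply/funext => n /=; rewrite /freg indicE mem_set// mul1r.
  rewrite MregE//.
  exact: (cvg_comp _ _ zn_oo (tw_left f_wave (proj1 Wv))).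
have mfn n : measurable_fun (Vreg V) (fun v => (freg (zn n) v)%:E).
  by apply/measurable_EFinP; apply: measurable_funTS; exact: measurable_freg1.
have mMr : measurable_fun (Vreg V) (fun v => (Mreg V M v)%:E).
  by apply/measurable_EFinP; apply: measurable_funTS; exact: measurable_Mreg VM.
have dom v (n : nat) : Vreg V v -> (`|(freg (zn n) v)%:E| <= (Mreg V M v)%:E)%E.
  move=> _; have /andP[h0 h1] := freg_range (zn n) v.
  by rewrite abse_EFin lee_fin ger0_norm.
have [] := @dominated_convergence _ _ _ mu (Vreg V) mW (fun n v => (freg (zn n) v)%:E)
  (fun v => (Mreg V M v)%:E) (fun v => (Mreg V M v)%:E) mfn mMr.
- by apply: aeW => v; exact: cvgM.
- exact: integrable_Mreg.
- by apply: aeW => v n; exact: dom.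
move=> _ _ lim1.
have hb n : (\int[mu]_(x in Vreg V) (freg (zn n) x)%:E <= (1 / 2)%:E)%E.
  rewrite -EFin_Rintegral//; last exact: integrable_freg.
  by rewrite -rho_freg lee_fin ltW// (proj2 (hzn n)).
have : (\int[mu]_(x in Vreg V) (Mreg V M x)%:E <= (1 / 2)%:E)%E.
  by apply: (cvge_to_le lim1); apply: nearW => n; exact: hb.
by rewrite (mass_Mreg V M VM) lee_fin => h1; lra.
Unshelve. all: by end_near. Qed.
End WaveDensity.

(** * The weight *)

Section KineticWeight.
Context {R : realType}.
Notation mu := (@lebesgue_measure R).

(** The properties of the two profiles that the stability of the front uses. *)
Lemma kinetic_weight (r c la D MB wmax zs : R) (W : set R) (M rf : R -> R) (P : R -> R -> R) :
  0 < r -> 0 < la -> 0 < D -> 0 < wmax ->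
  measurable W -> (mu W < +oo)%E -> (0 < mu W)%E ->
  measurable_fun setT M -> (forall v, 0 <= M v) -> (forall v, M v <= MB) ->
  (forall m v, 0 <= m <= la -> W v -> 0 < den c m v) ->
  (forall m v, 0 <= m <= la -> W v -> den c la v <= D * den c m v) ->
  (forall v, W v -> la * (v - c) <= D) ->
  (disp r c W M la <= 1)%E ->
  (forall m, 0 <= m < la -> (1 < disp r c W M m)%E) ->
  (forall m, 0 <= m <= la -> (disp r c W M m <= D%:E)%E) ->
  (forall v, W v -> `|v - c| < wmax) ->
  measurable_fun setT rf -> (forall z, 0 <= rf z <= 1) ->
  (forall z, z <= zs -> 1 / 2 <= rf z) ->
  measurable_fun setT (fun x : R * R => P x.1 x.2) ->
  (forall z v, 0 <= P z v) -> (forall z v, P z v <= (1 + r) * M v) ->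
  (forall z v, ~ W v -> P z v = 0) ->
  exists F G sg : R -> R -> R,
  [/\ measurable_fun setT (fun x : R * R => F x.1 x.2),
      measurable_fun setT (fun x : R * R => G x.1 x.2) &
      measurable_fun setT (fun x : R * R => sg x.1 x.2)] /\
  [/\ forall z v, 0 < F z v, forall z v, 0 <= G z v, forall z v, W v -> 0 < G z v &
      exists C, forall z v, W v -> F z v / G z v <= C * expR (- (2 * la) * (z - zs))] /\
  (forall z0, exists2 C, 0 < C &
     forall z v, (if z <= z0 then 1 else rf z) <= C * sg z v) /\
  forall (u : R -> R -> R -> R) (u0 : R -> R -> R),
  measurable_fun setT (fun p : R * (R * R) => u p.1 p.2.1 p.2.2) ->
  (forall t z v, ~ W v -> u t z v = 0) ->
  measurable_fun setT (fun x : R * R => u0 x.1 x.2) ->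
  (forall T L : R, (\int[mu]_(s in `[0%R, T]) \int[mu]_(z in `[(- L)%R, L])
     \int[mu]_v `|u s z v|%:E < +oo)%E) ->
  (forall t, 0 <= t -> {ae (mu \x mu)%E, forall x : R * R, W x.2 ->
   u t x.1 x.2 = u0 (x.1 - (x.2 - c) * t) x.2 +
     \int[mu]_(s in `[0, t]) ksource P (fun z => 1 + r * rf z) u s
        (x.1 - (x.2 - c) * (t - s)) x.2}) ->
  forall t, 0 <= t ->
  (\int[(mu \x mu)%E]_x (`|u t x.1 x.2| ^+ 2 / F x.1 x.2 * G x.1 x.2)%:E +
   \int[mu]_(s in `[0%R, t]) \int[(mu \x mu)%E]_x
      (`|u s x.1 x.2| ^+ 2 / F x.1 x.2 * (sg x.1 x.2 * G x.1 x.2))%:E <=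
   \int[(mu \x mu)%E]_x (`|u0 x.1 x.2| ^+ 2 / F x.1 x.2 * G x.1 x.2)%:E)%E.
Proof.
move=> r0 la0 D0 wmax0 mW finW W0 mM M0 MB_ den_pos den_cmp speedD disp_la disp_gt1 disp_leD.
move=> wmaxP mrf rf01 rf_left mP P0 PMr PW.
(* k bounds the rates times the speeds, and the absorption plus twice the slack. *)
pose e := eta r c la D W M; pose q := 1 + r + 2 * ((1 + r) * e * gap_mass0 r c la D W M * D).
pose k := Num.max (2 * la * wmax) q.
have k1 : 2 * la * wmax <= k by rewrite le_max lexx.
have k2 : q <= k by rewrite le_max lexx orbT.
exists (wF r c la D W M zs), (wG r c la D W M zs), (wsigma r c la D W M zs rf).
split; [split|split; [split|split]].
- exact: measurable_wF.
- exact: measurable_wG.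
- exact: measurable_wsigma.
- by move=> z v; apply: profF_gt0.
- by move=> z v; apply: profG_ge0.
- by move=> z v Wv; apply: wG_gt0.
- by eexists => z v Wv; apply: wF_wG_ratio.
- move=> z0.
  have c0 : 0 < dissip r c la D W M by apply: dissip_gt0.
  pose a := expR (- (la * pospart (z0 - zs))).
  have a0 : 0 < a by exact: expR_gt0.
  have a1 : a <= 1 by rewrite -expR0 ler_expR oppr_le0 mulr_ge0 ?pospart_ge0// ltW.
  exists (dissip r c la D W M * a)^-1; first by rewrite invr_gt0 mulr_gt0.
  move=> z v; rewrite mulrC ler_pdivlMr ?mulr_gt0//.
  case: ifPn => [zz|_]; first by rewrite mul1r; apply: wsigma_left.
  have h : dissip r c la D W M * rf z <= wsigma r c la D W M zs rf z v by apply: wsigma_right.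
  apply: le_trans h; rewrite mulrC -mulrA ler_wpM2l ?(ltW c0)// ler_piMl//.
  by case/andP: (rf01 z).
- move=> u u0 h1 h2 h3 h4 h5 t t0.
  apply: (profile_energy _ _ _ _ MB _ _ r0 la0 D0 mW finW W0 mM M0 MB_ den_pos den_cmp speedD
    disp_la disp_gt1 disp_leD k wmax) => //; exact: mP.
Qed.
End KineticWeight.

Section PhaseIntegrals.
Context {R : realType}.
Notation mu := (@lebesgue_measure R).
Notation mu2 := (mu \x mu)%E.
Context (V : set R) (M : R -> R) (VM : velocity_model V M).

Let mV : measurable V. Proof. exact: V_measurable VM. Qed.
Let mW : measurable (Vreg V). Proof. exact: Vreg_measurable VM. Qed.

(** The line v = vmax is null. *)
Lemma integral_phase_strip (A : set R) (h : R * R -> \bar R) : measurable A ->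
  measurable_fun (A `*` V) h -> (forall x, 0 <= h x)%E ->
  (\int[mu2]_(x in A `*` V) h x =
   \int[mu2]_x (h x * (\1_A x.1 * \1_(Vreg V) x.2)%:E))%E.
Proof.
move=> mA mh h0.
have mAV : measurable (A `*` V : set (R * R)) by exact: measurableX.
have mN : measurable (setT `*` [set vmax V] : set (R * R)).
  by apply: measurableX => //; exact: measurable_set1.
have N0 : mu2 (setT `*` [set vmax V]) = 0%E.
  rewrite product_measure1E//.
  by rewrite [X in (_ * X)%E](_ : _ = 0%E) ?mule0//; exact: lebesgue_measure_set1.
have := @ge0_negligible_integral _ _ R mu2 (A `*` V) (setT `*` [set vmax V]) h
  mN mAV mh (fun x _ => h0 x) N0.
move=> ->.
have -> : A `*` V `\` setT `*` [set vmax V] = A `*` Vreg V.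
  apply/seteqP; split=> -[z v] /=.
    by move=> [[Az Vv] h1]; split => //; split => // vE; apply: h1.
  by move=> [Az [Vv h1]]; split => // -[_ h2]; apply: h1.
rewrite integral_mkcond; apply: eq_integral => x _.
rewrite patchE !indicE; case: ifPn => [|/negP]; rewrite inE.
  by move=> [xA xW]; rewrite !mem_set// mulr1 mule1.
move=> xN; case: (boolP (x.1 \in A)) => xA; last by rewrite mul0r mule0.
case: (boolP (x.2 \in Vreg V)) => xW; last by rewrite mulr0 mule0.
by exfalso; apply: xN; split; [rewrite inE in xA|rewrite inE in xW].
Qed.
End PhaseIntegrals.

(** * Stability of the front *)

Section WeightedStability.
Context {R : realType}.
Notation mu := (@lebesgue_measure R).
Notation mu2 := (mu \x mu)%E.
Context (r : R) (V : set R) (M : R -> R) (cstar c : R) (f : R -> R -> R).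
Context (r_gt0 : 0 < r) (VM : velocity_model V M)
  (cstar_min : is_minimal_speed r V M cstar)
  (c_range : cstar <= c < vmax V)
  (f_wave : travelling_wave r V M c f).

Let mV : measurable V. Proof. exact: V_measurable VM. Qed.
Let mW : measurable (Vreg V). Proof. exact: Vreg_measurable VM. Qed.

Lemma speed_ge0 : 0 <= c.
Proof.
by have [/andP[cs0 _] _ _] := cstar_min; case/andP : c_range => h _; exact: le_trans h.
Qed.

Lemma speed_lt : c < vmax V.
Proof. by case/andP : c_range. Qed.

(** The dispersion at a fixed rate decreases with the speed, so the decay rate
    for cstar is admissible for c. *)
Lemma decay_rate : exists la, [/\ 0 < la <= (vmax V - c)^-1,
    (dispersion r V M c la <= 1)%E &
    forall m, 0 <= m < la -> (1 < dispersion r V M c m)%E].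
Proof.
have [/andP[cs0 csV] [la1 [la1b hla1]] _] := cstar_min.
have /andP[csc cV] := c_range; have /andP[l0 l1] := la1b.
have la1c : 0 <= la1 <= (vmax V - c)^-1.
  by rewrite ltW//= (le_trans l1)// lef_pV2 ?posrE ?subr_gt0// lerD2l lerN2.
apply: (smallest_rate r V M r_gt0 VM c speed_ge0 cV la1).
  by rewrite l0; case/andP : la1c.
have mden : measurable_fun V (fun v => (M v / den cstar la1 v)%:E).
  apply/measurable_EFinP; apply: measurable_funM; first exact: measurable_M_V VM.
  by apply: measurable_funV; apply: measurable_funTS; exact: measurable_den.
rewrite -[leRHS]hla1 /dispersion; apply: lee_wpmul2l.
  by rewrite lee_fin addr_ge0// ltW.
rewrite -(integral_Vreg V M VM (fun v => (M v / den cstar la1 v)%:E))//.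
apply: ge0_le_integral => //.
- by move=> v Wv; apply: (Mden_ge0 V M VM c cV).
- by apply: measurable_funTS; apply: (measurable_Mden V M VM).
- by apply: measurable_funS mden => //; exact: subIsetl.
move=> v Wv; rewrite MregE// lee_fin.
(* den increases with the speed. *)
have d1 : 0 < den c la1 v by apply: (den_gt0 V M VM c cV).
have d2 : 0 < den cstar la1 v by apply: (den_gt0 V M VM cstar csV) => //; rewrite ltW.
rewrite ler_wpM2l//; first by apply: (vm_ge0 VM); case: Wv.
rewrite lef_pV2 ?posrE// /den lerD2l ler_wpM2l ?(ltW l0)//.
by rewrite lerD2r.
Qed.

(** The coefficient P of the overview. *)
Definition gain (z v : R) : R := (1 + r) * Mreg V M v - r * freg V f z v.

Lemma gain_range z v : 0 <= gain z v <= (1 + r) * Mreg V M v.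
Proof.
have /andP[f0 f1] := freg_range _ _ _ _ _ f_wave z v.
have h : r * freg V f z v <= r * Mreg V M v by rewrite ler_wpM2l// ltW.
have h0 : 0 <= r * freg V f z v by rewrite mulr_ge0// ltW.
have M0 := Mreg_ge0 V M VM v.
by rewrite /gain; apply/andP; split; lra.
Qed.

Lemma gain_out z v : ~ Vreg V v -> gain z v = 0.
Proof.
by move=> Wv; rewrite /gain /Mreg /freg patchE memNset// indicE memNset// mul0r !mulr0 subr0.
Qed.

Lemma measurable_gain : measurable_fun setT (fun x : R * R => gain x.1 x.2).
Proof.
apply: measurable_funB; apply: measurable_funM => //.
  by apply: measurableT_comp => //; exact: measurable_Mreg VM.
exact: measurable_freg VM f_wave.
Qed.

Lemma weight_profiles : exists F G sg : R -> R -> R, exists la zs : R,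
  [/\ measurable_fun setT (fun x : R * R => F x.1 x.2),
      measurable_fun setT (fun x : R * R => G x.1 x.2) &
      measurable_fun setT (fun x : R * R => sg x.1 x.2)] /\
  [/\ forall z v, 0 < F z v, forall z v, 0 <= G z v, forall z v, Vreg V v -> 0 < G z v &
      exists C, forall z v, Vreg V v -> F z v / G z v <= C * expR (- (2 * la) * (z - zs))] /\
  (forall z0, exists2 C, 0 < C &
     forall z v, (if z <= z0 then 1 else rho V (f z)) <= C * sg z v) /\
  forall (u : R -> R -> R -> R) (u0 : R -> R -> R),
  measurable_fun setT (fun p : R * (R * R) => u p.1 p.2.1 p.2.2) ->
  (forall t z v, ~ Vreg V v -> u t z v = 0) ->
  measurable_fun setT (fun x : R * R => u0 x.1 x.2) ->
  (forall T L : R, (\int[mu]_(s in `[0%R, T]) \int[mu]_(z in `[(- L)%R, L])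
     \int[mu]_v `|u s z v|%:E < +oo)%E) ->
  (forall t, 0 <= t -> {ae mu2, forall x : R * R, Vreg V x.2 ->
   u t x.1 x.2 = u0 (x.1 - (x.2 - c) * t) x.2 +
     \int[mu]_(s in `[0, t]) ksource gain (fun z => 1 + r * rho V (f z)) u s
        (x.1 - (x.2 - c) * (t - s)) x.2}) ->
  forall t, 0 <= t ->
  (\int[mu2]_x (`|u t x.1 x.2| ^+ 2 / F x.1 x.2 * G x.1 x.2)%:E +
   \int[mu]_(s in `[0%R, t]) \int[mu2]_x
      (`|u s x.1 x.2| ^+ 2 / F x.1 x.2 * (sg x.1 x.2 * G x.1 x.2))%:E <=
   \int[mu2]_x (`|u0 x.1 x.2| ^+ 2 / F x.1 x.2 * G x.1 x.2)%:E)%E.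
Proof.
have [la [/andP[la0 la1] dla dgt]] := decay_rate.
have [MB _ MBP] := Mreg_bounded V M VM.
have [zs zsP] := rho_wave_left _ _ _ _ _ VM f_wave.
have c0 := speed_ge0; have cV := speed_lt.
have V0 : 0 < vmax V by apply: le_lt_trans cV.
have cV0 : 0 <= c + vmax V by rewrite addr_ge0// ltW.
pose D := 1 + la * (c + vmax V).
have D0 : 0 < D by rewrite ltr_pwDl// mulr_ge0// ltW.
have DW m : 0 <= m <= la -> 1 + (la - m) * (c + vmax V) <= D.
  by case/andP=> m0 _; rewrite lerD2l ler_wpM2r// gerBl.
have mb m : 0 <= m <= la -> 0 <= m <= (vmax V - c)^-1.
  by case/andP=> m0 m1; rewrite m0 (le_trans m1).
have dpos m v : 0 <= m <= la -> Vreg V v -> 0 < den c m v.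
  by move=> hm Wv; apply: (den_gt0 V M VM c cV) => //; exact: mb.
have dcmp m v : 0 <= m <= la -> Vreg V v -> den c la v <= D * den c m v.
  move=> hm Wv; have d0 := dpos m v hm Wv.
  apply: le_trans (den_comparison V M VM c c0 la m v (proj1 Wv) hm (ltW d0)) _.
  by rewrite ler_wpM2r ?(ltW d0)//; exact: DW.
have spD v : Vreg V v -> la * (v - c) <= D.
  move=> Wv; have vV := ltW (Vreg_lt V M VM v Wv).
  rewrite -[leLHS]add0r lerD// ler_wpM2l ?(ltW la0)//; lra.
have dD m : 0 <= m <= la -> (dispersion r V M c m <= D%:E)%E.
  move=> hm; have /andP[m0 m1] := hm.
  apply: le_trans (dispersion_comparison r V M r_gt0 VM c c0 cV la m hm la1) _.
  have h0 : 0 <= 1 + (la - m) * (c + vmax V) by rewrite addr_ge0// mulr_ge0// subr_ge0.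
  apply: (@le_trans _ _ ((1 + (la - m) * (c + vmax V))%:E * 1)%E).
    by apply: lee_wpmul2l => //; rewrite lee_fin.
  by rewrite mule1 lee_fin; exact: DW.
have wV v : Vreg V v -> `|v - c| < vmax V + c + 1.
  move=> Wv; have vn := Vreg_norm_le V M VM v Wv.
  apply: le_lt_trans (ler_normB _ _) _; rewrite (ger0_norm c0); lra.
have wV0 : 0 < vmax V + c + 1 by rewrite ltr_wpDl// addr_ge0// ltW.
have [F [G [sg H]]] := @kinetic_weight R r c la D MB (vmax V + c + 1) zs (Vreg V) (Mreg V M)
  (fun z => rho V (f z)) gain r_gt0 la0 D0 wV0 mW (Vreg_finite V M VM) (Vreg_measure_gt0 V M VM)
  (measurable_Mreg V M VM) (Mreg_ge0 V M VM) MBP dpos dcmp spD dla dgt dD wV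
  (measurable_rho_wave _ _ _ _ _ VM f_wave) (rho_wave_range _ _ _ _ _ VM f_wave) zsP
  measurable_gain
  (fun z v => proj1 (andP (gain_range z v))) (fun z v => proj2 (andP (gain_range z v)))
  gain_out.
by exists F, G, sg, la, zs.
Qed.


(** Set to 0 at negative times and off Vreg, where the energy method needs a
    globally defined measurable function. *)
Definition upatch (u : R -> R -> R -> R) (t z v : R) : R :=
  if 0 <= t then \1_(Vreg V) v * u t z v else 0.

Lemma measurable_time_phase_space : measurable (time_phase_space V : set (R * R * R)).
Proof. by apply: measurableX => //; apply: measurableX => //; exact: measurable_itv. Qed.

Lemma measurable_upatch (u : R -> R -> R -> R) :
  measurable_fun (time_phase_space V) (fun x : R * R * R => u x.1.1 x.1.2 x.2) ->
  measurable_fun setT (fun p : R * (R * R) => upatch u p.1 p.2.1 p.2.2).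
Proof.
move=> mu_.
pose S : set (R * R * R) := (`[0, +oo[ `*` setT) `*` Vreg V.
have mS : measurable S.
  by apply: measurableX => //; apply: measurableX => //; exact: measurable_itv.
have mu' : measurable_fun S (fun x : R * R * R => u x.1.1 x.1.2 x.2).
  apply: measurable_funS mu_; first exact: measurable_time_phase_space.
  by move=> x [h [Vx _]]; split.
have := (measurable_restrictT _ mS).1 mu'; set h := _ \_ _ => mh.
rewrite (_ : (fun p => _) = h \o (fun p : R * (R * R) => (p.1, p.2.1, p.2.2))).
  apply: measurableT_comp => //; apply/measurable_fun_pair => /=; last exact: measurableT_comp.
  by apply/measurable_fun_pair => //=; exact: measurableT_comp.
apply/funext => -[t [z v]] /=; rewrite /h patchE /upatch indicE.
case: ifPn => t0.
  case: (boolP (v \in Vreg V)) => vW.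
    rewrite mul1r mem_set//; split; last by rewrite inE in vW.
    by split => //=; rewrite in_itv/= t0.
  by rewrite mul0r memNset// => -[_ /=]; rewrite notin_setE in vW.
by rewrite memNset// => -[[/=]]; rewrite in_itv/= andbT (negbTE t0).
Qed.

Lemma upatch_local (u : R -> R -> R -> R) (T L : R) :
  measurable_fun (time_phase_space V) (fun x : R * R * R => u x.1.1 x.1.2 x.2) ->
  (\int[(mu2 \x mu)%E]_(x in (`[0%R, T] `*` `[(- L)%R, L]) `*` V)
       (`|u x.1.1 x.1.2 x.2|)%:E < +oo)%E ->
  (\int[mu]_(s in `[0%R, T]) \int[mu]_(z in `[(- L)%R, L])
     \int[mu]_v `|upatch u s z v|%:E < +oo)%E.
Proof.
move=> mu_; apply: le_lt_trans.
pose h (x : R * R * R) : \bar R :=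
  ((\1_(`[0, T]%classic) x.1.1 * \1_(`[- L, L]%classic) x.1.2) * `|upatch u x.1.1 x.1.2 x.2|)%:E.
have mup : measurable_fun setT (fun x : R * R * R => upatch u x.1.1 x.1.2 x.2).
  apply: (@measurableT_comp _ _ _ _ _ _ (fun p : R * (R * R) => upatch u p.1 p.2.1 p.2.2) _
    (fun x : R * R * R => (x.1.1, (x.1.2, x.2)))); first exact: measurable_upatch.
  apply/measurable_fun_pair => /=; first exact: measurableT_comp.
  by apply/measurable_fun_pair => //=; exact: measurableT_comp.
have mh : measurable_fun setT h.
  apply/measurable_EFinP; apply: measurable_funM; last exact: measurableT_comp.
  have mi (a b : R) : measurable_fun setT (\1_(`[a, b]%classic) : R -> R).
    by apply: measurable_indic; exact: measurable_itv.
  by apply: measurable_funM; [apply: (measurableT_comp (mi 0 T))|apply: (measurableT_comp (mi (- L) L))];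
    exact: measurableT_comp.
have h0 x : (0 <= h x)%E by rewrite lee_fin mulr_ge0// mulr_ge0// indicE ler0n.
rewrite (_ : (\int[mu]_(s in _) _)%E = (\int[mu]_s \int[mu]_z \int[mu]_v h (s, z, v))%E).
  have mv : measurable_fun setT (fun y : R * R => (\int[mu]_v h (y, v))%E).
    exact: measurable_parametric_integral.
  rewrite -(integral_mu2E_vz (fun y => (\int[mu]_v h (y, v))%E))//; last first.
    by move=> y; exact: integral_ge0.
  rewrite -(@fubini_tonelli1 _ _ _ _ _ mu2S mu h mh h0).
  pose B : set (R * R * R) := (`[0, T] `*` `[- L, L]) `*` V.
  have mB : measurable B.
    by apply: measurableX => //; apply: measurableX; exact: measurable_itv.
  have mub : measurable_fun B
      (fun x : R * R * R => (`|u x.1.1 x.1.2 x.2|)%:E).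
    apply/measurable_EFinP; apply: measurableT_comp => //.
    apply: measurable_funS mu_; first exact: measurable_time_phase_space.
    move=> x [[/= h1 _] Vx]; split => //=; split => //=.
    by move: h1; rewrite !in_itv/= andbT => /andP[].
  rewrite [leRHS]integral_mkcond; apply: ge0_le_integral => //.
    exact: (measurable_restrictT _ mB).1.
  move=> [[s z] v] _; rewrite patchE /h /upatch/= !indicE.
  case: (boolP (s \in _)) => hs; last by rewrite !mul0r; case: ifP; rewrite lee_fin.
  case: (boolP (z \in _)) => hz; last by rewrite mulr0 !mul0r; case: ifP; rewrite lee_fin.
  rewrite mul1r mul1r; case: (boolP (v \in _)) => hv; last first.
    by rewrite mul0r if_same normr0; case: ifP; rewrite lee_fin.
  rewrite mul1r mem_set; last first.
    by split; [split; [rewrite inE in hs|rewrite inE in hz]|rewrite inE in hv; case: hv].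
  by rewrite lee_fin; case: ifP => //; rewrite normr0.
rewrite integral_mkcond; apply: eq_integral => s _; rewrite patchE; case: ifPn => hs; last first.
  apply/esym/integral0_eq => z _; apply: integral0_eq => v _.
  by rewrite /h/= indicE (negbTE hs) !mul0r.
rewrite integral_mkcond; apply: eq_integral => z _; rewrite patchE; case: ifPn => hz; last first.
  by apply/esym/integral0_eq => v _; rewrite /h/= !indicE (negbTE hz) mulr0 mul0r.
by apply: eq_integral => v _; rewrite /h/= !indicE hs hz !mul1r.
Qed.

Lemma rho_upatch (u : R -> R -> R -> R) (s z : R) : 0 <= s ->
  measurable_fun (time_phase_space V) (fun x : R * R * R => u x.1.1 x.1.2 x.2) ->
  \int[mu]_v upatch u s z v = rho V (u s z).
Proof.
move=> s0 mu_.
have mg : measurable_fun V (u s z).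
  apply: (@measurable_comp _ _ _ _ _ _ (time_phase_space V)
    (fun x : R * R * R => u x.1.1 x.1.2 x.2) V (fun v => ((s, z), v))) => //.
  - exact: measurable_time_phase_space.
  - by move=> _ [v Vv <-]; split => //; split => //=; rewrite in_itv/= s0.
  - by apply: measurable_funTS; apply/measurable_fun_pair.
rewrite (rho_Vreg V M VM _ mg) [RHS]Rintegral_mkcond; apply: eq_Rintegral => v _.
by rewrite /upatch s0 /= patchE; case: ifPn => // vW; rewrite indicE (negbTE vW) mul0r.
Qed.

Lemma mild_upatch (u0 : R -> R -> R) (u : R -> R -> R -> R) (t : R) :
  linearized_solution r V M c f u0 u -> 0 <= t ->
  {ae mu2, forall x : R * R, Vreg V x.2 ->
   upatch u t x.1 x.2 = \1_(Vreg V) x.2 * u0 (x.1 - (x.2 - c) * t) x.2 +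
     \int[mu]_(s in `[0, t]) ksource gain (fun z => 1 + r * rho V (f z)) (upatch u) s
        (x.1 - (x.2 - c) * (t - s)) x.2}.
Proof.
move=> sol t0; apply: ae_imp (ls_mild sol t0) => x hx Wx.
have {}hx := hx (conj I (proj1 Wx)).
have i1 : \1_(Vreg V) x.2 = 1 :> R by rewrite indicE mem_set.
rewrite /upatch t0 i1 !mul1r hx; congr (_ + _).
apply: eq_Rintegral => s; rewrite inE/= in_itv/= => /andP[s0 _].
rewrite /ksource /linearized_source -/(upatch u) (rho_upatch _ _ _ s0 (ls_measurable sol)).
by rewrite /upatch s0 i1 mul1r /gain MregE// /freg i1 mul1r.
Qed.


Section LogWeight.
Context (F G : R -> R -> R).
Context (mF : measurable_fun setT (fun x : R * R => F x.1 x.2))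
  (mG : measurable_fun setT (fun x : R * R => G x.1 x.2))
  (F0 : forall z v, 0 < F z v) (G0 : forall z v, 0 <= G z v)
  (GW0 : forall z v, Vreg V v -> 0 < G z v).

(** The function phi with e^(-2 phi) = G / F. *)
Definition log_weight (z v : R) : R := - (ln (G z v / F z v) / 2).

Lemma measurable_ratio : measurable_fun setT (fun x : R * R => G x.1 x.2 / F x.1 x.2).
Proof. by apply: measurable_funM => //; exact: measurable_funV. Qed.

Lemma measurable_log_weight : measurable_fun setT (fun x : R * R => log_weight x.1 x.2).
Proof.
apply: measurableT_comp => //; apply: measurable_funM => //.
exact: (measurableT_comp (@measurable_ln R) measurable_ratio).
Qed.

Lemma expR_log_weight z v : Vreg V v -> expR (- 2 * log_weight z v) = G z v / F z v.
Proof.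
move=> Wv; rewrite /log_weight (_ : - 2 * _ = ln (G z v / F z v)); last by field.
by rewrite lnK// posrE divr_gt0// GW0.
Qed.

Lemma expR_log_weightV z v : Vreg V v -> expR (2 * log_weight z v) = F z v / G z v.
Proof.
move=> Wv; rewrite -[2]opprK mulNr expRN expR_log_weight// invf_div //.
Qed.

Lemma phase_energyE (A : set R) (q : R -> R) (g : R -> R -> R) :
  measurable A -> measurable_fun setT q -> (forall z, 0 <= q z) ->
  measurable_fun (phase_space V) (fun x : R * R => g x.1 x.2) ->
  (\int[mu2]_(x in A `*` V)
     (q x.1 * `|g x.1 x.2| ^+ 2 * expR (- 2 * log_weight x.1 x.2))%:E =
   \int[mu2]_x ((\1_A x.1 * q x.1) *
      (`|\1_(Vreg V) x.2 * g x.1 x.2| ^+ 2 / F x.1 x.2 * G x.1 x.2))%:E)%E.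
Proof.
move=> mA mq q0 mg.
have mAV : measurable (A `*` V : set (R * R)) by exact: measurableX.
have mg' : measurable_fun (A `*` V) (fun x : R * R => g x.1 x.2).
  apply: measurable_funS mg; first exact: phase_space_measurable VM.
  by move=> x [_ Vx]; split.
rewrite (integral_phase_strip V M VM A (fun x => (q x.1 * `|g x.1 x.2| ^+ 2
   * expR (- 2 * log_weight x.1 x.2))%:E) mA).
- apply: eq_integral => x _; rewrite -EFinM; congr EFin.
  have [Wx|Wx] := pselect (Vreg V x.2).
    have -> : \1_(Vreg V) x.2 = 1 :> R by rewrite indicE mem_set.
    by rewrite mul1r mulr1 expR_log_weight//; ring.
  have -> : \1_(Vreg V) x.2 = 0 :> R by rewrite indicE memNset.
  by rewrite !mulr0 mul0r normr0 expr0n /= !mul0r mulr0.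
- apply/measurable_EFinP; apply: measurable_funM.
    apply: measurable_funM; first by apply: measurable_funTS; exact: measurableT_comp.
    by apply: measurable_funX; exact: measurableT_comp.
  apply: measurable_funTS; apply: measurableT_comp => //; apply: measurable_funM => //.
  exact: measurable_log_weight.
- by move=> x; rewrite lee_fin !mulr_ge0 ?expR_ge0.
Qed.

Lemma wnormE (g : R -> R -> R) :
  measurable_fun (phase_space V) (fun x : R * R => g x.1 x.2) ->
  wnorm V log_weight g = ((\int[mu2]_x (`|\1_(Vreg V) x.2 * g x.1 x.2| ^+ 2
     / F x.1 x.2 * G x.1 x.2)%:E) `^ 2^-1)%E.
Proof.
move=> mg; rewrite /wnorm; congr (_ `^ _)%E.
transitivity (\int[mu2]_(x in setT `*` V)
     (1 * `|g x.1 x.2| ^+ 2 * expR (- 2 * log_weight x.1 x.2))%:E)%E.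
  by apply: eq_integral => x _; rewrite mul1r.
rewrite (phase_energyE setT (fun=> 1))//.
by apply: eq_integral => x _; rewrite indicE in_setT !mul1r.
Qed.

Lemma local_energyE (g : R -> R -> R) (z0 : R) :
  measurable_fun (phase_space V) (fun x : R * R => g x.1 x.2) ->
  local_energy V log_weight f g z0 =
  (\int[mu2]_x ((\1_[set z | (z < z0)%R] x.1 + \1_[set z | (z0 < z)%R] x.1 * rho V (f x.1)) *
    (`|\1_(Vreg V) x.2 * g x.1 x.2| ^+ 2 / F x.1 x.2 * G x.1 x.2))%:E)%E.
Proof.
move=> mg; rewrite /local_energy.
have mlt : measurable [set z : R | z < z0].
  by rewrite (_ : [set z | _] = `]-oo, z0[%classic)//; apply/seteqP; split => z /=; rewrite in_itv.
have mgt : measurable [set z : R | z0 < z].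
  by rewrite (_ : [set z | _] = `]z0, +oo[%classic)//; apply/seteqP; split => z /=; rewrite in_itv/= andbT.
have mr := measurable_rho_wave _ _ _ _ _ VM f_wave.
have r01 := rho_wave_range _ _ _ _ _ VM f_wave.
have r0 z : 0 <= rho V (f z) by case/andP: (r01 z).
rewrite (_ : (\int[mu2]_(x in [set z | (z < z0)%R] `*` V) _)%E =
   \int[mu2]_(x in [set z | (z < z0)%R] `*` V)
     (1 * `|g x.1 x.2| ^+ 2 * expR (- 2 * log_weight x.1 x.2))%:E)%E; last first.
  by apply: eq_integral => x _; rewrite mul1r.
rewrite (phase_energyE _ (fun=> 1))// (phase_energyE _ (fun z => rho V (f z)))//.
have mgW := measurable_patch_phase V M VM g mg.
have mE : measurable_fun setT (fun x : R * R =>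
    `|\1_(Vreg V) x.2 * g x.1 x.2| ^+ 2 / F x.1 x.2 * G x.1 x.2).
  apply: measurable_funM => //; apply: measurable_funM; last exact: measurable_funV.
  by apply: measurable_funX; exact: measurableT_comp.
have E0 x : 0 <= `|\1_(Vreg V) x.2 * g x.1 x.2| ^+ 2 / F x.1 x.2 * G x.1 x.2.
  by rewrite mulr_ge0// divr_ge0// ltW.
have mi (A : set R) : measurable A -> measurable_fun setT (fun x : R * R => \1_A x.1 : R).
  by move=> mA; apply: (measurableT_comp (measurable_indic mA)).
have mr1 : measurable_fun setT (fun x : R * R => rho V (f x.1)) by exact: (measurableT_comp mr).
rewrite -ge0_integralD//.
- by apply: eq_integral => x _; rewrite -EFinD mulr1 -mulrDl.
- by move=> x _; rewrite lee_fin mulr_ge0// mulr_ge0// indicE.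
- apply/measurable_EFinP; apply: measurable_funM => //; apply: measurable_funM => //; exact: mi.
- by move=> x _; rewrite lee_fin mulr_ge0// mulr_ge0// indicE.
- apply/measurable_EFinP; apply: measurable_funM => //; apply: measurable_funM => //; exact: mi.
Qed.
End LogWeight.
End WeightedStability.


Theorem theorem1p7 (R : realType) (r : R) (V : set R) (M : R -> R)
    (cstar c : R) (f : R -> R -> R)
    (r_gt0 : 0 < r) (VM : velocity_model V M)
    (cstar_min : is_minimal_speed r V M cstar)
    (c_range : cstar <= c < vmax V)
    (f_wave : travelling_wave r V M c f) :
  exists phi : R -> R -> R, weight V phi /\
    forall (u0 : R -> R -> R) (u : R -> R -> R -> R),
      in_wL2 V phi u0 -> linearized_solution r V M c f u0 u ->
      (forall t : R, 0 <= t -> (wnorm V phi (u t) <= wnorm V phi u0)%E) /\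
      (forall z0 : R,
         (@lebesgue_measure R).-integrable `[0, +oo[
           (fun t : R => local_energy V phi f (u t) z0)).
Proof.
have [F [G [sg [la [zs [[mF mG msg] [[F0 G0 GW0 [C HC]] [sgC energy]]]]]]]] :=
  weight_profiles r V M cstar c f r_gt0 VM cstar_min c_range f_wave.
have mV := V_measurable V M VM; have mW := Vreg_measurable V M VM.
exists (log_weight F G); split; first split.
- exact: measurable_funTS (measurable_log_weight F G mF mG).
- move=> L.
  have mL : measurable `[(- L)%R, L]%classic by exact: measurable_itv.
  pose B := `|C| * expR (`|2 * la| * (`|L| + `|zs|)).
  have B0 : 0 <= B by rewrite mulr_ge0 ?expR_ge0.
  have hB x : `[- L, L]%classic x.1 -> Vreg V x.2 -> expR (2 * log_weight F G x.1 x.2) <= B.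
    rewrite /= in_itv/= => xL Wx.
    rewrite (expR_log_weightV V F G F0 GW0)//; apply: le_trans (HC x.1 x.2 Wx) _.
    apply: (@le_trans _ _ (`|C| * expR (- (2 * la) * (x.1 - zs)))).
      by rewrite ler_wpM2r ?expR_ge0// ler_norm.
    rewrite ler_wpM2l// ler_expR; apply: le_trans (ler_norm _) _.
    rewrite normrM normrN ler_wpM2l//; apply: le_trans (ler_normB _ _) _.
    by rewrite lerD2r; move: xL; rewrite -ler_norml => /le_trans; apply; exact: ler_norm.
  have mh : measurable_fun setT (fun x : R * R => (expR (2 * log_weight F G x.1 x.2))%:E).
    apply/measurable_EFinP; apply: measurableT_comp => //; apply: measurable_funM => //.
    exact: measurable_log_weight F G mF mG.
  rewrite (integral_phase_strip V M VM _ (fun x => (expR (2 * log_weight F G x.1 x.2))%:E) mL)//; last exact: measurable_funTS.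
  apply: (@le_lt_trans _ _ (\int[(lebesgue_measure \x lebesgue_measure)%E]_(x in `[(- L)%R, L] `*` V) B%:E)%E).
    rewrite (integral_phase_strip V M VM _ (fun=> B%:E) mL)//.
    have mi : measurable_fun setT (fun x : R * R => (\1_(`[(- L)%R, L]%classic) x.1 * \1_(Vreg V) x.2 : R)%:E).
      apply/measurable_EFinP; apply: measurable_funM.
        by apply: (measurableT_comp (measurable_indic mL)).
      by apply: (measurableT_comp (measurable_indic mW)).
    have i0 (A : set R) x : 0 <= \1_A x :> R by rewrite indicE.
    apply: ge0_le_integral => //.
    - exact: emeasurable_funM.
    - exact: emeasurable_funM.
    move=> x _; rewrite -!EFinM lee_fin.
    have [xL|xL] := pselect (`[- L, L]%classic x.1); last by rewrite indicE memNset// !mul0r !mulr0.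
    have [xW|xW] := pselect (Vreg V x.2).
      by rewrite ler_wpM2r ?mulr_ge0//; exact: hB.
    by rewrite [X in _ * (_ * X)](_ : _ = 0) ?mulr0 ?mulr_ge0// indicE memNset.
  have Bfin : ((@lebesgue_measure R \x @lebesgue_measure R)%E (`[(- L)%R, L]%classic `*` V) < +oo)%E.
    rewrite product_measure1E//; apply: lte_mul_pinfty => //.
      rewrite ge0_fin_numE// (_ : lebesgue_measure_lebesgue_measure__canonical__measure_function_Measure _ _ =
        lebesgue_measure `[(- L)%R, L]%classic)//.
      by rewrite lebesgue_measure_itv/=; case: ifP => // _; rewrite -EFinD ltry.
    exact: V_finite V M VM.
  rewrite integral_cst; last exact: measurableX.
  by apply: lte_mul_pinfty; rewrite ?lee_fin//; exact: Bfin.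
move=> u0 u [mu0 u0fin] sol.
have mu_ := ls_measurable sol.
have mut t : 0 <= t -> measurable_fun (phase_space V) (fun x : R * R => u t x.1 x.2).
  move=> t0; apply: (@measurable_comp _ _ _ _ _ _ (time_phase_space V)
    (fun x : R * R * R => u x.1.1 x.1.2 x.2) (phase_space V) (fun x : R * R => ((t, x.1), x.2))) => //.
  - exact: measurable_time_phase_space V M VM.
  - by move=> _ [x [_ Vx] <-]; split => //; split => //=; rewrite in_itv/= t0.
  - apply: measurable_funTS; apply/measurable_fun_pair => //=; exact/measurable_fun_pair.
pose E (g : R -> R -> R) := (\int[(lebesgue_measure \x lebesgue_measure)%E]_x
  (`|\1_(Vreg V) x.2 * g x.1 x.2| ^+ 2 / F x.1 x.2 * G x.1 x.2)%:E)%E.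
have E_ge0 g : (0 <= E g)%E.
  by apply: integral_ge0 => x _; rewrite lee_fin mulr_ge0// divr_ge0// ltW.
have upE t z v : 0 <= t -> upatch V u t z v = \1_(Vreg V) v * u t z v by rewrite /upatch => ->.
pose S t := (\int[(lebesgue_measure \x lebesgue_measure)%E]_x
  (`|upatch V u t x.1 x.2| ^+ 2 / F x.1 x.2 * (sg x.1 x.2 * G x.1 x.2))%:E)%E.
have mup := measurable_upatch V M VM u mu_.
have sg0 z v : 0 <= sg z v.
  have [a a0 /(_ z v)] := sgC z; rewrite lexx => h.
  by have := lt_le_trans ltr01 h; rewrite pmulr_rgt0// => /ltW.
have S_ge0 t : (0 <= S t)%E.
  apply: integral_ge0 => x _; rewrite lee_fin.
  by apply: mulr_ge0; [rewrite divr_ge0// ltW|exact: mulr_ge0].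
have en t : 0 <= t -> (E (u t) + \int[lebesgue_measure]_(s in `[0%R, t]) S s <= E u0)%E.
  move=> t0.
  have := energy (upatch V u) (fun z v => \1_(Vreg V) v * u0 z v) mup
    (fun t z v Wv => ltac:(by rewrite /upatch indicE memNset// mul0r if_same))
    (measurable_patch_phase V M VM u0 mu0)
    (fun T L => upatch_local V M VM u T L mu_ (ls_loc sol T L))
    (fun t t0 => mild_upatch r V M c f VM u0 u t sol t0) t t0.
  apply: le_trans; rewrite leeD2r//.
  by rewrite le_eqVlt; apply/orP; left; apply/eqP; apply: eq_integral => x _; rewrite upE.
split=> [t t0|z0].
  rewrite !(wnormE V M VM F G mF mG F0 GW0)//; last exact: mut.
  apply: gt0_ler_poweR => //; rewrite ?in_itv/= ?leey ?andbT ?E_ge0//; try exact: E_ge0.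
  apply: le_trans (en t t0); rewrite leeDl// integral_ge0//.
have E0fin : (E u0 < +oo)%E.
  move: u0fin; rewrite (wnormE V M VM F G mF mG F0 GW0)//.
  by apply: lty_poweRy; rewrite invr_eq0 pnatr_eq0.
have [a a0 ha] := sgC z0.
pose q (z : R) : R := \1_[set z | (z < z0)%R] z + \1_[set z | (z0 < z)%R] z * rho V (f z).
pose Q t := (\int[(lebesgue_measure \x lebesgue_measure)%E]_x
  (q x.1 * (`|upatch V u t x.1 x.2| ^+ 2 / F x.1 x.2 * G x.1 x.2))%:E)%E.
have r01 := rho_wave_range _ _ _ _ _ VM f_wave.
have q0 z : 0 <= q z.
  by rewrite addr_ge0 ?mulr_ge0 ?indicE//; case/andP: (r01 z).
have qle z v : q z <= a * sg z v.
  apply: le_trans (ha z v); rewrite /q !indicE; case: ifPn => zz.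
    rewrite [X in _ + X * _](_ : _ = 0) ?mul0r ?addr0; first by case: (_ \in _).
    by rewrite memNset// => /=; rewrite ltNge zz.
  rewrite memNset ?add0r; last by move=> /= /ltW; rewrite (negbTE zz).
  by rewrite mem_set ?mul1r//= ltNge zz.
have mlt : measurable [set z : R | z < z0].
  by rewrite (_ : [set z | _] = `]-oo, z0[%classic)//; apply/seteqP; split => z /=; rewrite in_itv.
have mgt : measurable [set z : R | z0 < z].
  by rewrite (_ : [set z | _] = `]z0, +oo[%classic)//; apply/seteqP; split => z /=; rewrite in_itv/= andbT.
have mq : measurable_fun setT q.
  apply: measurable_funD; first exact: measurable_indic.
  by apply: measurable_funM; [exact: measurable_indic|exact: (measurable_rho_wave _ _ _ _ _ VM f_wave)].
have mphase (h : R -> R -> R) : measurable_fun setT (fun x : R * R => h x.1 x.2) ->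
    measurable_fun setT (fun p : R * (R * R) => h p.2.1 p.2.2).
  by move=> mh; apply: (measurableT_comp mh).
have mdens : measurable_fun setT (fun p : R * (R * R) => `|upatch V u p.1 p.2.1 p.2.2| ^+ 2 / F p.2.1 p.2.2).
  apply: measurable_funM; first by apply: measurable_funX; exact: measurableT_comp.
  by apply: measurable_funV; exact: (mphase F).
have mQi : measurable_fun setT (fun p : R * (R * R) =>
    (q p.2.1 * (`|upatch V u p.1 p.2.1 p.2.2| ^+ 2 / F p.2.1 p.2.2 * G p.2.1 p.2.2))%:E).
  apply/measurable_EFinP; apply: measurable_funM.
    by apply: (measurableT_comp mq); exact: measurableT_comp.
  by apply: measurable_funM => //; exact: (mphase G).
have mSi : measurable_fun setT (fun p : R * (R * R) =>
    (`|upatch V u p.1 p.2.1 p.2.2| ^+ 2 / F p.2.1 p.2.2 * (sg p.2.1 p.2.2 * G p.2.1 p.2.2))%:E).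
  apply/measurable_EFinP; apply: measurable_funM => //.
  by apply: measurable_funM; [exact: (mphase sg)|exact: (mphase G)].
have mQ : measurable_fun setT Q := measurable_parametric_integral _ _ _ _ mu2S _ mQi.
have mS : measurable_fun setT S := measurable_parametric_integral _ _ _ _ mu2S _ mSi.
have Q0 t : (0 <= Q t)%E.
  apply: integral_ge0 => x _; rewrite lee_fin; apply: mulr_ge0 => //.
  by apply: mulr_ge0 => //; rewrite divr_ge0// ltW.
(* Up to the factor a, the local energy is at most the dissipation. *)
have QS t : (Q t <= a%:E * S t)%E.
  have mSt := measurable_fun_pair_r _ _ _ _ _ _ _ t mSi.
  have mQt := measurable_fun_pair_r _ _ _ _ _ _ _ t mQi.
  have d0 x : 0 <= `|upatch V u t x.1 x.2| ^+ 2 / F x.1 x.2 by rewrite divr_ge0// ltW.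
  rewrite -ge0_integralZl//; last 2 first.
  - by move=> x _; rewrite lee_fin; apply: mulr_ge0 => //; exact: mulr_ge0.
  - by rewrite lee_fin ltW.
  apply: ge0_le_integral => //.
  - by move=> x _; rewrite lee_fin; apply: mulr_ge0 => //; exact: mulr_ge0.
  - exact: emeasurable_funM.
  move=> x _; rewrite -EFinM lee_fin.
  rewrite (_ : a * _ = (a * sg x.1 x.2) * (`|upatch V u t x.1 x.2| ^+ 2 / F x.1 x.2 * G x.1 x.2)); last by ring.
  by rewrite ler_wpM2r// mulr_ge0.
have Qle t : 0 <= t -> (\int[lebesgue_measure]_(s in `[0%R, t]) Q s <= a%:E * E u0)%E.
  move=> t0; apply: (@le_trans _ _ (a%:E * \int[lebesgue_measure]_(s in `[0%R, t]) S s)%E).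
    rewrite -ge0_integralZl//; last 2 first.
    - exact: measurable_funTS.
    - by rewrite lee_fin ltW.
    apply: ge0_le_integral => //.
    - exact: measurable_funTS.
    - by apply: emeasurable_funM => //; exact: measurable_funTS.
  apply: lee_wpmul2l; first by rewrite lee_fin ltW.
  by apply: le_trans (en t t0); rewrite leeDr.
(* The dissipation up to time t is at most the initial energy, for every t. *)
have Qfin : (\int[lebesgue_measure]_(t in `[0%R, +oo[) Q t < +oo)%E.
  apply: (@le_lt_trans _ _ (a%:E * E u0)%E); last first.
    by apply: lte_mul_pinfty; rewrite ?lee_fin ?(ltW a0).
  have -> : `[0%R, +oo[%classic = \bigcup_n `[0%R, n%:R]%classic :> set R.
    apply/seteqP; split => [x|x [n _]]; rewrite /= !in_itv/= ?andbT; last by case/andP.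
    move=> x0; exists (Num.bound x) => //=; rewrite in_itv/= x0/= ltW//.
    exact: archi_boundP.
  pose I (n : nat) : set R := `[0%R, n%:R]%classic.
  have ndI : {homo I : n m / (n <= m)%N >-> (n <= m)%O}.
    move=> m n mn; apply/subsetPset => x /=; rewrite /I/= !in_itv/= => /andP[-> /= xm].
    by rewrite (le_trans xm)// ler_nat.
  have mI n : measurable (I n) by exact: measurable_itv.
  have mQI n : measurable_fun (I n) Q by exact: measurable_funTS.
  have Q0I n x : I n x -> (0 <= Q x)%E by move=> _; exact: Q0.
  have lim : (\int[lebesgue_measure]_(x in I i) Q x)%E @[i --> \oo] -->
      (\int[lebesgue_measure]_(x in \bigcup_i I i) Q x)%E.
    exact: ge0_nondecreasing_set_cvg_integral.
  apply: (cvge_to_le lim).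
  by apply: nearW => n; apply: Qle; rewrite ler0n.
have eQ t : 0 <= t -> local_energy V (log_weight F G) f (u t) z0 = Q t.
  move=> t0; rewrite (local_energyE r V M c f VM f_wave F G mF mG F0 G0 GW0 (u t) z0 (mut t t0)).
  by apply: eq_integral => x _; rewrite upE.
apply/integrableP; split.
  apply: (eq_measurable_fun Q); last exact: measurable_funTS.
  by move=> t; rewrite inE/= in_itv/= andbT => t0; rewrite eQ.
rewrite (_ : (\int[lebesgue_measure]_(x in _) _)%E = \int[lebesgue_measure]_(t in `[0%R, +oo[) Q t)%E//.
by apply: eq_integral => t; rewrite inE/= in_itv/= andbT => t0; rewrite /= eQ// gee0_abs.
Qed.
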